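(* Consider the parametric volatility model and the M-estimator $\hat\theta_n$ described in the context, with $\Theta$ compact. Assume: (ST) the process $(X_t)$ satisfying the model exists and is stationary, non anticipative and ergodic with finite logarithmic moments; (CI) the maps $\phi_t$ satisfy $\Lambda(\phi_t(\cdot,\theta))\le\Lambda_{\phi_t}(\theta)$ for a stationary sequence $(\Lambda_{\phi_t})$ of continuous functions $\Theta\to\mathbb R^+$, and there is a positive integer $r$ such that $\mathbb E[\log\Lambda^{(r)}_{\phi_0}(\theta)]<0$ for every $\theta\in\Theta$; moreover $\mathbb E[\sup_{\Theta}\log^+\Lambda^{(r)}_{\phi_0}(\theta)]<\infty$ and there exists $y\in E$ such that $\mathbb E[\sup_{\Theta}\log^+ d(\phi_0(y,\theta),y)]<\infty$; (IN) the $Z_t$ are iid and $\mathbb E[Z_0Z_0^T]$ is the identity matrix; (IV) the functions $y\mapsto\ell(y)^{-1}$ and $y\mapsto\log(\det(\ell(y)))$ are Lipschitz, and $\det(\ell(g_0(\theta)))\ge C(\theta)$ for some continuous function $C:\Theta\to(0,\infty)$; (identifiability) $g_0(\theta)=h(\Sigma_0)$ if and only if $\theta=\theta_0$. Then $\hat\theta_n\to\theta_0$ almost surely, for any $\theta_0\in\Theta$.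
   Context: Model. $(Z_t)_{t\in\mathbb Z}$ is a sequence of random vectors in $\mathbb R^m$, $\mathcal F_t=\sigma(Z_t,Z_{t-1},\ldots)$, and $X_t=\Sigma_t^{1/2}Z_t$ with $m\times m$ volatility matrices $\Sigma_t$. $h$ is an injective map from the space of real $m\times m$ matrices to a separable metric space $F$, with inverse $\ell$ (the link function) defined on the image of $h$; $\ell(y)^{-1}$ denotes the matrix inverse of $\ell(y)$. For the true parameter $\theta_0$ the volatilities satisfy a recursion $(h(\Sigma_k))_{k\le t}=\psi_t((h(\Sigma_k))_{k\le t-1},\theta_0)$ with $\psi_t$ an $\mathcal F_{t-1}$-measurable random map. Expressing the innovations through the observations, the recursion is rewritten with a finite number $p$ of lags as $(h(\Sigma_k))_{t-p+1\le k\le t}=\phi_t((h(\Sigma_k))_{t-p\le k\le t-1},\theta_0)$, where $(\phi_t)$ is a stationary ergodic sequence of random maps $\phi_t:E\times\Theta\to E$, each $\phi_t$ being generated by finitely many past observations $(X_{t-1},\ldots,X_{t-q})$. The state space $E$ is the product of $p$ copies of the image of $h$, a complete separable metric space for a product metric $d$ (e.g. $p^{-1}\sum_j d(x_j,y_j)$ or $(\sum_j d^2(x_j,y_j))^{1/2}$) built from the metric, also written $d$, of $F$. Non anticipative means that the solution at time $t$ is a function of $(Z_t,Z_{t-1},\ldots)$. Finite logarithmic moments means $\mathbb E[\log^+\|X_0\|]<\infty$ and $\mathbb E[\log^+ d(y,(h(\Sigma_k))_{1-p\le k\le 0})]<\infty$ for all $y\in E$. $\Lambda(f)=\sup_{x\ne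 y}d(f(x),f(y))/d(x,y)$ is the Lipschitz coefficient of $f:E\to E$. $\phi_t^{(r)}(\cdot,\theta)=\phi_t(\cdot,\theta)\circ\cdots\circ\phi_{t-r+1}(\cdot,\theta)$, and $\Lambda^{(r)}_{\phi_t}:\Theta\to\mathbb R^+$ denotes a (random) continuous function with $\Lambda(\phi_t^{(r)}(\cdot,\theta))\le\Lambda_{\phi_t}^{(r)}(\theta)$, stationary in $t$ ($\Lambda^{(1)}_{\phi_t}=\Lambda_{\phi_t}$). $g_t(\theta)$, $t\in\mathbb Z$, denotes the unique stationary solution of $(g_k(\theta))_{t-p+1\le k\le t}=\phi_t((g_k(\theta))_{t-p\le k\le t-1},\theta)$, $t\in\mathbb Z$ (it exists under (CI)). $\hat g_t(\theta)$ is defined by the same recursion for $t\ge1$ from arbitrary initial values $(\hat g_k(\cdot))_{1-p\le k\le 0}$ (continuous in the parameter). Estimator. $\hat\theta_n\in\operatorname{argmin}_{\theta\in\Theta}\hat S_n(\theta)$, where $$n\hat S_n(\theta)=\sum_{t=1}^n\hat s_t(\theta)=\sum_{t=1}^n 2^{-1}\left(X_t^T\ell(\hat g_t(\theta))^{-1}X_t+\log(\det(\ell(\hat g_t(\theta))))\right).$$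
   Formalization: The link function h is taken on a set of symmetric positive definite volatility matrices (so ℓ(y)^{-1} and log det ℓ(y) make sense on its image), and the random maps φ_t(y,θ) are assumed almost surely continuous in θ on Θ; without these the claim is ill-defined or false. *)

(* Defs.v *)
From HB Require Import structures.
From mathcomp Require Import all_boot all_order all_algebra.
From mathcomp Require Import all_classical all_reals all_analysis.

Set Implicit Arguments.
Unset Strict Implicit.
Unset Printing Implicit Defensive.

Import Order.TTheory GRing.Theory Num.Theory.
Import numFieldNormedType.Exports.

Local Open Scope classical_set_scope.
Local Open Scope ring_scope.

(* Sigma-algebras are handled as families of sets, because several of them
   (past of a process, path spaces, spaces of maps) live on the same type. *)
Section sigma_algebras.

Definition borel (S : topologicalType) : set_system S :=
  <<s [set A : set S | open A] >>.

Definition sigma_eval (I S : Type) (D : set I) (SS : set_system S) :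
    set_system (I -> S) :=
  <<s [set A | exists i B, [/\ D i, SS B & A = [set f | B (f i)]]] >>.

Definition sigma_prod (S1 S2 : Type) (SS1 : set_system S1)
    (SS2 : set_system S2) : set_system (S1 * S2) :=
  <<s [set A `*` B | A in SS1 & B in SS2] >>.

Definition sigma_gen (T : Type) (S : topologicalType) (D : set int)
    (Y : int -> T -> S) : set_system T :=
  <<s [set A | exists t B, [/\ D t, borel B & A = Y t @^-1` B]] >>.

Definition measurable_wrt (S1 S2 : Type) (D : set S1) (SS1 : set_system S1)
    (SS2 : set_system S2) (f : S1 -> S2) :=
  forall B, SS2 B -> SS1 (D `&` f @^-1` B).

End sigma_algebras.

Section processes.
Context d (T : measurableType d) (R : realType) (P : probability T R).

(* [stationary] and [ergodic] include that each Y t is measurable. *)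
Definition stationary (S : Type) (SS : set_system S) (Y : int -> T -> S) :=
  (forall t, measurable_wrt setT (@measurable d T) SS (Y t)) /\
  (forall A, sigma_eval [set: int] SS A ->
     P [set w | A (fun t => Y (t + 1) w)] = P [set w | A (fun t => Y t w)]).

Definition ergodic (S : Type) (SS : set_system S) (Y : int -> T -> S) :=
  (forall t, measurable_wrt setT (@measurable d T) SS (Y t)) /\
  (forall A, sigma_eval [set: int] SS A ->
     (forall u, A (fun t => u (t + 1)) <-> A u) ->
     P [set w | A (fun t => Y t w)] = 0%E \/
     P [set w | A (fun t => Y t w)] = 1%E).

Definition iid (S : topologicalType) (Y : int -> T -> S) :=
  [/\ forall t, measurable_wrt setT (@measurable d T) (@borel S) (Y t),
      forall t B, borel B -> P (Y t @^-1` B) = P (Y 0 @^-1` B) &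
      forall (s : seq int) (B : int -> set S), uniq s ->
        (forall t, borel (B t)) ->
        P (\bigcap_(t in [set` s]) Y t @^-1` B t) =
        (\prod_(t <- s) P (Y t @^-1` B t))%E].

End processes.

Section matrices.
Context (R : realType) (m : nat).

Definition quad (A : 'M[R]_m) (u : 'cV[R]_m) : R := (u^T *m A *m u) 0 0.

Definition psdmx (A : 'M[R]_m) := A^T = A /\ forall u, 0 <= quad A u.

Definition pdmx (A : 'M[R]_m) := A^T = A /\ forall u, u != 0 -> 0 < quad A u.

(* The symmetric positive semidefinite square root, which exists and is unique
   when A is positive semidefinite; the value is 0 if there is none. *)
Definition sqrtmx (A : 'M[R]_m) : 'M[R]_m :=
  xget 0 [set B | psdmx B /\ B *m B = A].

End matrices.

Definition log_plus (R : realType) (x : R) : R := Num.max 0 (ln x).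

(* Product metrics on F^p: a norm N on R^p, nondecreasing on the nonnegative
   orthant, applied to the vector of coordinatewise distances. For instance
   p^-1 sum_j |a_j| and (sum_j a_j^2)^(1/2). *)
Section product_metric.
Context (R : realType) (p : nat) (F : metricType R).

Definition monotone_norm (N : 'rV[R]_p -> R) :=
  [/\ forall a : 'rV[R]_p, N a = 0 -> a = 0,
      forall a b : 'rV[R]_p, N (a + b) <= N a + N b,
      forall (c : R) (a : 'rV[R]_p), N (c *: a) = `|c| * N a &
      forall a b : 'rV[R]_p, (forall j, 0 <= a 0 j <= b 0 j) -> N a <= N b].

Definition prod_dist (N : 'rV[R]_p -> R) (x y : 'I_p -> F) : R :=
  N (\row_j mdist (x j) (y j)).

Definition prod_set (I : set F) : set ('I_p -> F) := [set x | forall j, I (x j)].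

Definition separable (D : ('I_p -> F) -> ('I_p -> F) -> R)
    (E : set ('I_p -> F)) :=
  exists2 Q, Q `<=` E & countable Q /\
    forall x e, E x -> 0 < e -> exists2 y, Q y & D x y < e.

Definition complete (D : ('I_p -> F) -> ('I_p -> F) -> R)
    (E : set ('I_p -> F)) :=
  forall u : nat -> 'I_p -> F, (forall n, E (u n)) ->
    (forall e, 0 < e -> exists n0, forall i j, (n0 <= i)%N -> (n0 <= j)%N ->
       D (u i) (u j) < e) ->
    exists2 l, E l & D (u n) l @[n --> \oo] --> (0 : R).

Definition lipschitz_coef (D : ('I_p -> F) -> ('I_p -> F) -> R)
    (E : set ('I_p -> F)) (f : ('I_p -> F) -> ('I_p -> F)) : \bar R :=
  ereal_sup [set l | exists x y,
    [/\ E x, E y, x <> y & l = (D (f x) (f y) / D x y)%:E]].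

(* The block (u_k)_(t-p+1 <= k <= t), listed from the most recent entry. *)
Definition lags (u : int -> F) (t : int) : 'I_p -> F :=
  fun j => u (t - (j : nat)%:Z).

End product_metric.
Arguments lags {R} p {F} u t.

Section model.
Context d (T : measurableType d) (R : realType) (P : probability T R).
Context (m p : nat) (F : metricType R) (U : pseudoMetricType R).
Variables (Theta : set U) (theta0 : U).
Variables (M : set 'M[R]_m) (h : 'M[R]_m -> F) (ell : F -> 'M[R]_m).
Variable N : 'rV[R]_p -> R.

Local Notation I := (h @` M).
Local Notation E := (@prod_set R p F I).
Local Notation dE := (@prod_dist R p F N).
Local Notation Finf := (nat -> F).

(* M is the set of volatility matrices on which h is defined. *)
Definition link_function :=
  (forall A, M A -> pdmx A) /\ (forall A, M A -> ell (h A) = A).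

Definition state_space :=
  [/\ (0 < p)%N, exists2 Q : set F, countable Q & dense Q,
      monotone_norm N, complete dE E & separable dE E].

Variables (Z X : int -> T -> 'cV[R]_m) (Sigma : int -> T -> 'M[R]_m).

Definition past (t : int) : set_system T := sigma_gen [set s | s <= t] Z.

Definition hSigma (t : int) (w : T) : F := h (Sigma t w).

(* A sequence u : nat -> F stands for a past (u k is the value k steps before
   the current time). A random map is jointly measurable. *)
Definition volatility_model (psi : int -> T -> Finf -> U -> Finf) :=
  [/\ forall t, measurable_wrt setT (@measurable d T)
                  (@borel 'cV[R]_m) (Z t),
      forall t w, M (Sigma t w),
      {ae P, forall w, forall t, X t w = sqrtmx (Sigma t w) *m Z t w},
      forall t th, Theta th ->
        measurable_wrt [set wu : T * Finf | forall k, I (wu.2 k)]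
          (sigma_prod (past (t - 1)) (sigma_eval [set: nat] (@borel F)))
          (sigma_eval [set: nat] (@borel F))
          (fun wu => psi t wu.1 wu.2 th) &
      {ae P, forall w, forall t,
        (fun k : nat => hSigma (t - k%:Z) w) =
        psi t w (fun k : nat => hSigma (t - 1 - k%:Z) w) theta0}].

Definition sigma_maps : set_system (('I_p -> F) -> U -> ('I_p -> F)) :=
  sigma_eval E (sigma_eval Theta (sigma_eval [set: 'I_p] (@borel F))).

Variable phi : int -> T -> ('I_p -> F) -> U -> ('I_p -> F).

(* Continuity of theta |-> phi_t(y, theta) is part of the notion of a random
   map on E * Theta. *)
Definition observable_maps (q : nat) :=
  [/\ forall t w y th, E y -> Theta th -> E (phi t w y th),
      {ae P, forall w, forall t y j, E y ->
        {within Theta, continuous (fun th => phi t w y th j)}},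
      forall t, measurable_wrt setT
        (sigma_gen [set s | t - q%:Z <= s <= t - 1] X) sigma_maps (phi t),
      stationary P sigma_maps phi & ergodic P sigma_maps phi].

Definition solves_at (u : int -> T -> F) (th : U) :=
  {ae P, forall w, forall t,
    lags p (u ^~ w) t = phi t w (lags p (u ^~ w) (t - 1)) th}.

(* The stationary solution is a.s. unique under (CI). *)
Definition stationary_solution (g : int -> T -> U -> F) :=
  forall th, Theta th ->
    [/\ forall t w, I (g t w th),
        stationary P (@borel F) (fun t w => g t w th) &
        solves_at (fun t w => g t w th) th].

Definition approximate_solution (ghat : int -> T -> U -> F) :=
  (forall k, 1 - p%:Z <= k <= 0 -> forall w,
     (forall th, Theta th -> I (ghat k w th)) /\
     {within Theta, continuous (ghat k w)}) /\
  {ae P, forall w, forall t th, 1 <= t -> Theta th ->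
    lags p (fun k => ghat k w th) t =
    phi t w (lags p (fun k => ghat k w th) (t - 1)) th}.

(* phi_t o ... o phi_(t-r+1) at a fixed parameter. *)
Fixpoint phi_iter (r : nat) (t : int) (w : T) (th : U) (y : 'I_p -> F) :
    'I_p -> F :=
  if r is r'.+1 then phi t w (phi_iter r' (t - 1) w th y) th else y.

Definition ST :=
  [/\ stationary P (@borel ('cV[R]_m * F)%type)
        (fun t w => (X t w, hSigma t w)),
      ergodic P (@borel ('cV[R]_m * F)%type)
        (fun t w => (X t w, hSigma t w)),
      forall t, measurable_wrt setT (past t) (@borel ('cV[R]_m * F)%type)
        (fun w => (X t w, hSigma t w)),
      (\int[P]_w (log_plus `|X 0 w|)%:E < +oo)%E &
      forall y, E y ->
        (\int[P]_w (log_plus (dE y (lags p (hSigma ^~ w) 0)))%:E < +oo)%E].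

(* Lam r t w is the random function Lambda^(r)_(phi_t). *)
Definition lipschitz_bounds (Lam : nat -> int -> T -> U -> R) :=
  forall r, (0 < r)%N ->
    [/\ stationary P (sigma_eval Theta (@borel R)) (Lam r),
        {ae P, forall w, forall t,
          {within Theta, continuous (Lam r t w)}} &
        {ae P, forall w, forall t th, Theta th -> 0 <= Lam r t w th /\
          (lipschitz_coef dE E (phi_iter r t w th) <= (Lam r t w th)%:E)%E}].

(* lne is used so that log 0 = -oo; the expectation of the logarithm may be
   -oo, while its positive part is integrable by the moment condition. *)
Definition CI (Lam : nat -> int -> T -> U -> R) :=
  lipschitz_bounds Lam /\
  (exists r : nat,
    [/\ (0 < r)%N,
        forall th, Theta th -> (\int[P]_w lne (Lam r 0 w th)%:E < 0)%E &
        (\int[P]_w ereal_sup [set (log_plus (Lam r 0 w th))%:E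
                             | th in Theta] < +oo)%E]) /\
  (exists2 y, E y &
    (\int[P]_w ereal_sup [set (log_plus (dE (phi 0 w y th) y))%:E
                         | th in Theta] < +oo)%E).

Definition IN :=
  iid P Z /\
  forall i j : 'I_m,
    P.-integrable setT (fun w => (Z 0 w i 0 * Z 0 w j 0)%:E) /\
    ('E_P[fun w => (Z 0%R w i 0 * Z 0%R w j 0)%R] = ((1%:M : 'M[R]_m) i j)%:E)%E.

Definition IV (g : int -> T -> U -> F) :=
  [/\ exists K : R, forall y y', I y -> I y' ->
        `|invmx (ell y) - invmx (ell y')| <= K * mdist y y',
      exists K : R, forall y y', I y -> I y' ->
        `|ln (\det (ell y)) - ln (\det (ell y'))| <= K * mdist y y' &
      exists C : U -> R,
        [/\ {within Theta, continuous C},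
            forall th, Theta th -> 0 < C th &
            forall th, Theta th ->
              {ae P, forall w, C th <= \det (ell (g 0 w th))}]].

Definition identifiable (g : int -> T -> U -> F) :=
  forall th, Theta th ->
    {ae P, forall w, g 0 w th = hSigma 0 w} <-> th = theta0.

Definition shat (ghat : int -> T -> U -> F) (t : int) (w : T) (th : U) : R :=
  2^-1 * (quad (invmx (ell (ghat t w th))) (X t w)
          + ln (\det (ell (ghat t w th)))).

Definition Shat (ghat : int -> T -> U -> F) (n : nat) (w : T) (th : U) : R :=
  n%:R^-1 * \sum_(1 <= t < n.+1) shat ghat t%:Z w th.

Definition M_estimator (ghat : int -> T -> U -> F) (thetahat : nat -> T -> U) :=
  {ae P, forall w, forall n, (0 < n)%N ->
    Theta (thetahat n w) /\
    forall th, Theta th -> Shat ghat n w (thetahat n w) <= Shat ghat n w th}.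

End model.

(* Main.v *)
(* Under (CI) the composed maps contract along almost every path: near each parameter the ergodic
   theorem, applied to the logarithm of the Lipschitz constant of phi^(r), gives a geometric rate,
   and by compactness one rate serves all parameters. Hence g_t(theta) is the value at theta of a
   continuous function determined by the maps up to time t, h(Sigma_t) is its value at theta_0, and
   ghat_t(theta) is exponentially close to it, uniformly in theta.

   Twice the contrast at theta_0 tends to m + E ln det Sigma_0, which is finite because Sigma_0 is
   independent of Z_0 and E log^+ |X_0| is finite. Let theta_1 <> theta_0. On a small ball around
   theta_1, X_t^T ell(g_t)^-1 X_t is bounded below by a form Z_t^T B_t Z_t with B_t a function of the
   past. After truncation, the products of innovations may be replaced by their means, since the
   errors are orthogonal, and what remains is an ergodic average of a function of the maps. As the
   ball shrinks and the truncation is removed, Fatou's lemma and the positivity of the Kullback-Leibler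
   divergence between the centered Gaussian laws with covariances Sigma_0 and ell(g_0(theta_1)) show
   that its limit exceeds the one at theta_0. A finite cover of Theta concludes. *)

Require Import Defs.
From HB Require Import structures.
From mathcomp Require Import all_boot all_order all_algebra.
From mathcomp Require Import all_classical all_reals all_analysis.
From mathcomp Require Import measurable_realfun ring lra zify.

Set Implicit Arguments.
Unset Strict Implicit.
Unset Printing Implicit Defensive.

Import Order.TTheory GRing.Theory Num.Theory.
Import numFieldNormedType.Exports.

Local Open Scope classical_set_scope.
Local Open Scope ring_scope.

(** * Integrals over a probability space and Birkhoff's theorem *)

(** Ergodicity is given for the maps and for the pair (X_t, h(Sigma_t)), each by itself, but not for
    the maps jointly with the innovations: phi_t may depend on its finite past of X in a way that
    varies with t. At theta_0 the loss is a function of the pair, so the ergodic theorem applies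
    directly. At other parameters it mixes the maps with Z_t, which forces the separate treatment of
    the products of innovations.

    In the contraction, ln Lambda^(r) cannot be averaged along the multiples of r, because the r-th
    power of an ergodic shift may fail to be ergodic. All windows of length r are averaged instead,
    through geometric means. Coming back from these means to single times uses the one-step
    Lipschitz constants, whose logarithms have no moment when r > 1; the times where they are large
    are made rare and skipped.

    The solution g is determined for each parameter up to a null event that may vary with the
    parameter. Suprema over Theta are therefore taken of the limit of the iterated maps, which is
    continuous in theta, and they are computed on countable dense sets so as to be measurable. *)

Section measurability.
Context d (T : measurableType d) (R : realType).

Lemma measurable_lt_set (f g : T -> R) : measurable_fun setT f ->
  measurable_fun setT g -> measurable [set x | f x < g x].
Proof.
move=> mf mg; rewrite -[X in measurable X]setTI.
exact: (measurable_fun_ltr mf mg measurableT (Y := [set true])).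
Qed.

Lemma measurable_le_set (f g : T -> R) : measurable_fun setT f ->
  measurable_fun setT g -> measurable [set x | f x <= g x].
Proof.
move=> mf mg; rewrite -[X in measurable X]setTI.
exact: (measurable_fun_ler mf mg measurableT (Y := [set true])).
Qed.

End measurability.

Section expectation.
Context d (T : measurableType d) (R : realType) (mu : probability T R).
Local Notation integr f := (mu.-integrable setT (EFin \o f)).
Local Notation Ex f := (Rintegral mu setT f).

Lemma integr_meas (f : T -> R) : integr f -> measurable_fun setT f.
Proof. by move=> /integrableP[/measurable_EFinP]. Qed.

Lemma integr_le (f g : T -> R) : measurable_fun setT f ->
  (forall x, `|f x| <= g x) -> integr g -> integr f.
Proof.
move=> mf fg; apply: le_integrable => //; first exact/measurable_EFinP.
by move=> x _ /=; rewrite lee_fin (le_trans (fg x))// ler_norm.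
Qed.

Lemma integr_cst (a : R) : integr (fun=> a).
Proof. exact: finite_measure_integrable_cst. Qed.

Lemma integr_bounded (f : T -> R) (a : R) : measurable_fun setT f ->
  (forall x, `|f x| <= a) -> integr f.
Proof. by move=> mf fa; apply: (integr_le mf fa); exact: integr_cst. Qed.

Lemma integrD (f g : T -> R) : integr f -> integr g -> integr (fun x => f x + g x).
Proof.
move=> fi gi; rewrite (_ : EFin \o _ = (EFin \o f) \+ (EFin \o g))%E //.
exact: integrableD.
Qed.

Lemma integrB (f g : T -> R) : integr f -> integr g -> integr (fun x => f x - g x).
Proof.
move=> fi gi; rewrite (_ : EFin \o _ = (EFin \o f) \- (EFin \o g))%E //.
exact: integrableB.
Qed.

Lemma integrZ (a : R) (f : T -> R) : integr f -> integr (fun x => a * f x).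
Proof.
move=> fi; rewrite (_ : EFin \o _ = (fun x => a%:E * (EFin \o f) x))%E //.
exact: integrableZl.
Qed.

Lemma integr_norm (f : T -> R) : integr f -> integr (fun x => `|f x|).
Proof. by move=> ?; apply: integrable_norm. Qed.

Lemma integr_sum (I : Type) (s : seq I) (f : I -> T -> R) :
  (forall i, integr (f i)) -> integr (fun x => \sum_(i <- s) f i x).
Proof.
move=> fi; elim: s => [|i s ih].
  by under eq_fun do rewrite big_nil; exact: integr_cst.
by under eq_fun do rewrite big_cons; exact: integrD.
Qed.

Lemma integr_max (f g : T -> R) : integr f -> integr g ->
  integr (fun x => Num.max (f x) (g x)).
Proof.
move=> fi gi; apply: (@integr_le _ (fun x => `|f x| + `|g x|)).
- by apply: measurable_maxr; exact: integr_meas.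
- by move=> x; case: (leP (f x) (g x)) => _; rewrite ?lerDl ?lerDr.
- by apply: integrD; exact: integr_norm.
Qed.

Lemma integr_indic (f : T -> R) (A : set T) : measurable A -> integr f ->
  integr (fun x => f x * \1_A x).
Proof.
move=> mA fi; apply: (@integr_le _ (fun x => `|f x|)); last exact: integr_norm.
- by apply: measurable_funM; [exact: integr_meas|exact: measurable_indic].
- by move=> x; rewrite normrM ler_piMr// indicE; case: (_ \in _); rewrite ?normr1 ?normr0.
Qed.

Lemma Ex_cst (a : R) : Ex (fun=> a) = a.
Proof. by rewrite Rintegral_cst// [X in fine X](@probability_setT _ _ _ mu) mulr1. Qed.

Lemma ExD (f g : T -> R) : integr f -> integr g -> Ex (fun x => f x + g x) = Ex f + Ex g.
Proof. exact: RintegralD. Qed.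

Lemma ExB (f g : T -> R) : integr f -> integr g -> Ex (fun x => f x - g x) = Ex f - Ex g.
Proof. exact: RintegralB. Qed.

Lemma ExZ (a : R) (f : T -> R) : integr f -> Ex (fun x => a * f x) = a * Ex f.
Proof. exact: RintegralZl. Qed.

Lemma Ex_sum (I : Type) (s : seq I) (f : I -> T -> R) :
  (forall i, integr (f i)) -> Ex (fun x => \sum_(i <- s) f i x) = \sum_(i <- s) Ex (f i).
Proof.
move=> fi; elim: s => [|i s ih].
  by under eq_Rintegral do rewrite big_nil; rewrite Ex_cst big_nil.
under eq_Rintegral do rewrite big_cons.
by rewrite ExD// ?ih ?big_cons//; exact: integr_sum.
Qed.

Lemma Ex_ge0 (f : T -> R) : (forall x, 0 <= f x) -> 0 <= Ex f.
Proof. by move=> f0; exact: Rintegral_ge0. Qed.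

Lemma Ex_le (f g : T -> R) : integr f -> integr g -> (forall x, f x <= g x) ->
  Ex f <= Ex g.
Proof. by move=> fi gi fg; apply: le_Rintegral. Qed.

Lemma Ex_ae (f g : T -> R) : measurable_fun setT f -> measurable_fun setT g ->
  {ae mu, forall x, f x = g x} -> Ex f = Ex g.
Proof.
move=> mf mg fg; congr fine; apply: ae_eq_integral => //; try exact/measurable_EFinP.
by apply: filterS fg => x /= + _ => ->.
Qed.

Lemma integr_ae (f g : T -> R) : measurable_fun setT f ->
  {ae mu, forall x, f x = g x} -> integr g -> integr f.
Proof.
move=> mf fg /integrableP[mg gi]; apply/integrableP; split; first exact/measurable_EFinP.
apply: le_lt_trans gi; rewrite
  (@ae_eq_integral _ _ _ mu setT (fun x => `|(EFin \o g) x|) (fun x => `|(EFin \o f) x|))%E//.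
- by do 2 apply: measurableT_comp => //.
- by apply: measurableT_comp.
- by apply: filterS fg => x /= + _ => ->.
Qed.

Lemma Ex_dominated (f_ : nat -> T -> R) (f g : T -> R) :
  (forall n, measurable_fun setT (f_ n)) -> measurable_fun setT f -> integr g ->
  {ae mu, forall x, f_ n x @[n --> \oo] --> f x} ->
  (forall n x, `|f_ n x| <= g x) ->
  Ex (f_ n) @[n --> \oo] --> Ex f.
Proof.
move=> mf_ mf gi cf fg.
have [] := @dominated_convergence _ _ _ mu setT measurableT
  (fun n => EFin \o f_ n) (EFin \o f) (EFin \o g).
- by move=> n; exact/measurable_EFinP.
- exact/measurable_EFinP.
- by apply: filterS cf => x cf _; apply: cvg_EFin; [near=> n|exact: cf].
- exact: gi.
- by apply: aeW => x n _; rewrite lee_fin.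
move=> fi _ cv; apply: fine_cvg.
by rewrite /Rintegral fineK//; exact: integrable_fin_num.
Unshelve. all: by end_near. Qed.

Lemma ae_of_probability1 (A : set T) : measurable A -> mu A = 1%E ->
  {ae mu, forall x, A x}.
Proof.
move=> mA A1; exists (~` A); split=> //; first exact: measurableC.
by rewrite probability_setC// A1 subee.
Qed.

End expectation.

(** * Birkhoff's theorem for one ergodic transformation, from Garsia's maximal inequality *)

Section birkhoff.
Context d (T : measurableType d) (R : realType) (mu : probability T R).
Variable tau : T -> T.
Hypothesis mtau : measurable_fun setT tau.
Hypothesis tau_inv : forall A, measurable A -> mu (tau @^-1` A) = mu A.
Hypothesis tau_erg : forall A, measurable A -> tau @^-1` A = A ->
  mu A = 0%E \/ mu A = 1%E.
Local Notation integr f := (mu.-integrable setT (EFin \o f)).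
Local Notation Ex f := (Rintegral mu setT f).

Lemma eq_pushforward_tau (f : T -> \bar R) : measurable_fun setT f ->
  (forall x, 0 <= f x)%E -> (\int[mu]_x f (tau x) = \int[mu]_x f x)%E.
Proof.
move=> mf f0; have := @ge0_integral_pushforward _ _ _ _ R tau mtau mu setT f measurableT mf.
rewrite preimage_setT /= => <-; last by move=> x _; exact: f0.
by apply: eq_measure_integral => A mA _; rewrite /pushforward; first [exact: tau_inv|exact: esym (tau_inv mA)].
Qed.

Lemma integr_tau (f : T -> R) : integr f -> integr (f \o tau).
Proof.
move=> /integrableP[mf fi]; apply/integrableP; split.
  by apply/measurable_EFinP; apply: measurableT_comp => //; exact/measurable_EFinP.
rewrite (_ : (fun x => _) = (fun x => `|(EFin \o f) (tau x)|%E))//.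
by rewrite (@eq_pushforward_tau (fun x => `|(EFin \o f) x|%E))//; exact: measurableT_comp.
Qed.

Lemma Ex_tau (f : T -> R) : integr f -> Ex (f \o tau) = Ex f.
Proof.
move=> fi; have mf := integr_meas fi.
rewrite /Rintegral integralE [in RHS]integralE; congr (fine (_ - _)%E).
  have mfp : measurable_fun setT ((EFin \o f)^\+)%E.
    by apply: measurable_funepos; exact/measurable_EFinP.
  transitivity (\int[mu]_x ((EFin \o f)^\+ (tau x)))%E; last exact: eq_pushforward_tau.
  by apply: eq_integral => x _; rewrite !(funeposE, funenegE).
have mfn : measurable_fun setT ((EFin \o f)^\-)%E.
  by apply: measurable_funeneg; exact/measurable_EFinP.
transitivity (\int[mu]_x ((EFin \o f)^\- (tau x)))%E; last exact: eq_pushforward_tau.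
by apply: eq_integral => x _; rewrite !(funeposE, funenegE).
Qed.

(** This is the maximum of the Birkhoff sums of lengths 0 to [N]: every nonempty sum at [x] is [f x]
    followed by a sum at [tau x]. *)
Fixpoint running_max (f : T -> R) N x : R :=
  if N is N'.+1 then Num.max 0 (f x + running_max f N' (tau x)) else 0.

Lemma running_max_ge0 f N x : 0 <= running_max f N x.
Proof. by case: N => //= N; rewrite le_max lexx. Qed.

Lemma running_max_nd f N x : running_max f N x <= running_max f N.+1 x.
Proof.
elim: N x => [|N ih] x; first by rewrite running_max_ge0.
by rewrite /= ge_max le_max lexx/= le_max lerD2l ih orbT.
Qed.

Lemma running_max_ge f N n x : (n <= N)%N ->
  \sum_(k < n) f (iter k tau x) <= running_max f N x.
Proof.
elim: n N x => [|n ih] [|N] x //; rewrite ?big_ord0// ?running_max_ge0//.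
rewrite ltnS => nN; rewrite big_ord_recl /= le_max; apply/orP; right.
rewrite lerD2l (le_trans _ (ih N (tau x) nN))// le_eqVlt; apply/orP; left; apply/eqP.
by apply: eq_bigr => i _; rewrite -iterSr.
Qed.

Lemma integr_running_max f N : integr f -> integr (running_max f N).
Proof.
move=> fi; elim: N => [|N ih]; first exact: integr_cst.
by apply: integr_max; [exact: integr_cst|apply: integrD => //; exact: integr_tau].
Qed.

(* Garsia: on the set where the running maximum M is positive, f >= M - M o tau. *)
Lemma maximal_ergodic f N : integr f ->
  0 <= Ex (fun x => f x * \1_[set y | 0 < running_max f N y] x).
Proof.
move=> fi; have mi k := integr_running_max k fi.
have mS : measurable [set y | 0 < running_max f N y].
  by apply: measurable_lt_set => //; exact: integr_meas (mi N).
have mti := integr_tau (mi N).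
apply: (@le_trans _ _ (Ex (fun x => running_max f N x - running_max f N (tau x)))).
  by rewrite ExB//= (Ex_tau (mi N)) subrr.
apply: Ex_le.
- exact: integrB.
- exact: integr_indic.
move=> x; rewrite indicE; case: (boolP (x \in _)) => [/set_mem/=|].
  case: N {mi mS mti} => [|N]; first by rewrite ltxx.
  move=> Mx; have := running_max_nd f N (tau x).
  move: Mx; set q := running_max f N.+1 (tau x).
  by rewrite [running_max f N.+1 x]/= lt_max ltxx/= => h; rewrite max_r ?(ltW h)// => ?; lra.
rewrite notin_setE /= => /negP; rewrite -leNgt mulr0 => h; have := running_max_ge0 f N (tau x); lra.
Qed.

(** The sets where the running maximum is positive fill almost the whole space as [N] grows, so
    dominated convergence removes the indicator from Garsia's inequality. *)
Lemma maximal_ergodic_ge0 f : integr f ->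
  {ae mu, forall x, exists n, 0 < \sum_(k < n) f (iter k tau x)} -> 0 <= Ex f.
Proof.
move=> fi fpos.
have mS N : measurable [set y | 0 < running_max f N y].
  by apply: measurable_lt_set => //; exact: integr_meas (integr_running_max N fi).
have cv : Ex (fun x => f x * \1_[set y | 0 < running_max f N y] x) @[N --> \oo] --> Ex f.
  apply: (@Ex_dominated _ _ _ mu _ f (fun x => `|f x|)).
  - by move=> N; apply: (@integr_meas _ _ _ mu); exact: integr_indic.
  - exact: integr_meas fi.
  - exact: integr_norm.
  - apply: filterS fpos => x [n fn]; apply: cvg_near_cst; near=> N.
    rewrite indicE mem_set ?mulr1//=; apply: lt_le_trans fn _; apply: running_max_ge.
    by near: N; exists n.
  - move=> N x; rewrite normrM ler_piMr// indicE; case: (_ \in _); by rewrite ?normr1 ?normr0.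
rewrite -(cvg_lim _ cv)//; apply: limr_ge; first by apply/cvg_ex; exists (Ex f).
by apply: nearW => N; exact: maximal_ergodic.
Unshelve. all: by end_near. Qed.

Lemma measurable_birkhoff_sum (f : T -> R) n : measurable_fun setT f ->
  measurable_fun setT (fun x => \sum_(k < n) f (iter k tau x)).
Proof.
move=> mf; apply: measurable_sum => k.
apply: measurableT_comp => //; elim: (k : nat) => [|i ih] /=; first exact: measurable_id.
exact: measurableT_comp.
Qed.

(** For [b] strictly between the mean and [a], the set [A] of points whose averages exceed [b]
    infinitely often, by a fixed margin, is invariant. If it had probability one, the maximal
    inequality for [f - b] would give [b <= Ex f]. *)
Theorem birkhoff_upper (f : T -> R) (a : R) : integr f -> Ex f < a ->
  {ae mu, forall x, \forall n \near \oo, \sum_(k < n) f (iter k tau x) <= a * n%:R}.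
Proof.
move=> fi fa; have mf := integr_meas fi.
pose S n x := \sum_(k < n) f (iter k tau x).
pose b := (Ex f + a) / 2.
have [fb ba] : Ex f < b /\ b < a by rewrite /b; split; lra.
(* The slack 1/(j+1) makes the event strictly shift invariant. *)
pose A := \bigcup_j \bigcap_N \bigcup_(n in [set n | (N <= n)%N])
  [set x | (b + j.+1%:R^-1) * n%:R < S n x].
have mA : measurable A.
  apply: bigcup_measurable => j _; apply: bigcap_measurable => // N _.
  apply: bigcup_measurable => n _.
  by apply: measurable_lt_set => //; exact: measurable_birkhoff_sum.
have SS n x : S n.+1 x = f x + S n (tau x).
  rewrite /S big_ord_recl; congr (_ + _); apply: eq_bigr => i _ /=.
  by rewrite -iterS iterSr.
(* Moving between [x] and [tau x] changes the sum by [f x] and the length by one. Lowering the slack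
   from 1/(j+1) to 1/(j+2) absorbs both changes as soon as the length exceeds the number [M]
   below. *)
have Ainv : tau @^-1` A = A.
  apply/seteqP; split=> x /= [j _ Aj].
  - exists j.+1 => // N _.
    have d0 : 0 < (j.+1%:R^-1 - j.+2%:R^-1 : R) by rewrite subr_gt0 ltf_pV2 ?posrE ?ltr0n// ltr_nat.
    pose M := maxn N (Num.truncn ((`|f x| + `|b + j.+2%:R^-1|) / (j.+1%:R^-1 - j.+2%:R^-1))).+1.
    have [n /= Mn nS] := Aj M Logic.I; exists n.+1 => /=.
      by rewrite (leq_trans _ (leqnSn _))// (leq_trans (leq_maxl _ _) Mn).
    rewrite SS.
    have : (`|f x| + `|b + j.+2%:R^-1|) / (j.+1%:R^-1 - j.+2%:R^-1) < n%:R.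
      apply: lt_le_trans (truncnS_gt _) _; rewrite ler_nat (leq_trans _ Mn)//.
      exact: leq_maxr.
    rewrite ltr_pdivrMr// => h; rewrite -(natr1 n).
    have := ler_norm (- f x); have := ler_norm (b + j.+2%:R^-1); rewrite normrN.
    move: h nS; set u := _^-1; set v := _^-1 => h nS h1 h2.
    lra.
  - exists j.+1 => // N _.
    have d0 : 0 < (j.+1%:R^-1 - j.+2%:R^-1 : R) by rewrite subr_gt0 ltf_pV2 ?posrE ?ltr0n// ltr_nat.
    pose M := maxn N.+1 (Num.truncn ((`|f x| + `|b + j.+1%:R^-1|) / (j.+1%:R^-1 - j.+2%:R^-1))).+2.
    have [[|n] /= Mn nS] := Aj M Logic.I.
      by move: Mn; rewrite leqn0 /M maxnE.
    exists n => /=; first by rewrite -ltnS (leq_trans _ Mn)// leq_maxl.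
    move: nS; rewrite SS.
    have : (`|f x| + `|b + j.+1%:R^-1|) / (j.+1%:R^-1 - j.+2%:R^-1) < n%:R.
      apply: lt_le_trans (truncnS_gt _) _; rewrite ler_nat -ltnS (leq_trans _ Mn)//.
      exact: leq_maxr.
    rewrite ltr_pdivrMr// => h; rewrite -(natr1 n).
    have := ler_norm (f x); have := ler_norm (- (b + j.+1%:R^-1)); rewrite normrN.
    move: h; set u := _^-1; set v := _^-1 => h h1 h2.
    move=> h3; lra.
have [A0|A1] := tau_erg mA Ainv.
  exists A; split=> // x /=; apply: contra_notP => nA.
  have [j ja] : exists j : nat, b + j.+1%:R^-1 <= a.
    exists (Num.truncn (a - b)^-1).
    have ab : 0 < a - b by lra.
    rewrite -lerBrDl -[leRHS]invrK lef_pV2 ?posrE ?invr_gt0// ?ltr0n//.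
    by apply: ltW; exact: truncnS_gt.
  have : ~ (\bigcap_N \bigcup_(n in [set n | (N <= n)%N])
    [set x | (b + j.+1%:R^-1) * n%:R < S n x]) x by apply: contra_not nA => ?; exists j.
  move=> /existsNP[N /not_implyP[_ nN]]; exists N => // n /= Nn.
  rewrite leNgt; apply/negP => h; apply: nN; exists n => //=.
  by apply: le_lt_trans h; rewrite ler_wpM2r.
have : 0 <= Ex (fun x => f x - b).
  apply: maximal_ergodic_ge0; first by apply: integrB => //; exact: integr_cst.
  apply: filterS (ae_of_probability1 mA A1) => x [j _ /(_ 1%N Logic.I)[n /= n1 nS]].
  exists n; rewrite sumrB sumr_const card_ord subr_gt0.
  apply: le_lt_trans nS; by rewrite -(mulr_natr b n) ler_wpM2r// lerDl invr_ge0.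
rewrite ExB//; last exact: integr_cst.
by rewrite Ex_cst; lra.
Qed.

Lemma birkhoff_lower (f : T -> R) (a : R) : integr f -> a < Ex f ->
  {ae mu, forall x, \forall n \near \oo, a * n%:R <= \sum_(k < n) f (iter k tau x)}.
Proof.
move=> fi af; have fN : integr (fun x => -1 * f x) by exact: integrZ.
have : Ex (fun x => -1 * f x) < - a by rewrite ExZ// mulN1r ltrN2.
move=> /(birkhoff_upper fN); apply: filterS => x; apply: filterS => n.
under eq_bigr do rewrite mulN1r.
by rewrite sumrN mulNr lerN2.
Qed.

(** The [n]-th term is at most [K] plus the tail [g K]. The tail is nonnegative, so its [n]-th term
    is bounded by its own Birkhoff sum, whose rate is as small as desired once [K] is large. *)
Lemma birkhoff_small (f : T -> R) : integr f -> (forall x, 0 <= f x) ->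
  {ae mu, forall x, forall e, 0 < e -> \forall n \near \oo, f (iter n tau x) <= e * n%:R}.
Proof.
move=> fi f0; have mf := integr_meas fi.
have mB (K : R) : measurable [set x | K < f x].
  exact: measurable_lt_set.
pose g (K : nat) x := f x * \1_[set x | K%:R < f x] x.
have gi K : integr (g K) by exact: integr_indic.
have g0 K x : 0 <= g K x by rewrite /g mulr_ge0// indicE.
have cg : Ex (g K) @[K --> \oo] --> Ex (fun=> 0 : R).
  apply: (@Ex_dominated _ _ _ mu _ _ f) => //.
  - by move=> K; exact: integr_meas (gi K).
  - apply: aeW => x; apply: cvg_near_cst; near=> K.
    rewrite /g indicE memNset ?mulr0//= => /lt_geF/negP; apply; apply/negPn.
    rewrite (le_trans (ltW (truncnS_gt _)))// ler_nat; near: K; by exists (Num.truncn (f x)).+1.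
  - move=> K x; rewrite ger0_norm ?g0// /g ler_piMr// indicE; by case: (_ \in _).
move: cg; rewrite Ex_cst => cg.
have ae1 (j : nat) : {ae mu, forall x, \forall n \near \oo, f (iter n tau x) <= j.+1%:R^-1 * n%:R}.
  have /cvgr_lt/(_ (j.+2%:R^-1)) := cg; rewrite invr_gt0 ltr0n => /(_ isT) [K _ /(_ K (leqnn K))/= gK].
  apply: filterS (birkhoff_upper (gi K) gK) => x [N _ hN].
  have d0 : 0 < (j.+1%:R^-1 - j.+2%:R^-1 : R) by rewrite subr_gt0 ltf_pV2 ?posrE ?ltr0n// ltr_nat.
  near=> n.
  have := hN n.+1; rewrite /= leqW; last by near: n; exists N.
  move=> /(_ isT); rewrite big_ord_recr /=.
  have s0 : 0 <= \sum_(i < n) g K (iter i tau x) by rewrite sumr_ge0.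
  have fg : f (iter n tau x) <= K%:R + g K (iter n tau x).
    rewrite /g indicE; case: (boolP (_ \in _)) => [_|]; first by rewrite mulr1 lerDr.
    by rewrite notin_setE /= => /negP; rewrite -leNgt mulr0 addr0.
  have : (K%:R + j.+2%:R^-1) / (j.+1%:R^-1 - j.+2%:R^-1) <= n%:R :> R.
    near: n; exact: nbhs_infty_ger.
  rewrite ler_pdivrMr// -(natr1 n).
  set u := _^-1; set v := _^-1 => h1 h2; lra.
have := ae_foralln ae1.
apply: filterS => x /= h e e0.
have [j je] : exists j : nat, j.+1%:R^-1 <= e.
  exists (Num.truncn e^-1).
  rewrite -[leRHS]invrK lef_pV2 ?posrE ?invr_gt0// ?ltr0n//.
  by apply: ltW; exact: truncnS_gt.
apply: filterS (h j) => n /le_trans; apply; by rewrite ler_wpM2r.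
Unshelve. all: by end_near. Qed.

End birkhoff.

(** * Stationary processes as shifts on path spaces *)

Lemma preimage_sigma (aT rT : Type) (f : aT -> rT) (G : set_system rT)
    (H : set_system aT) : sigma_algebra setT H ->
  (forall A, G A -> H (f @^-1` A)) -> forall A, <<s G >> A -> H (f @^-1` A).
Proof.
move=> [H0 HC HU] GH A; apply: (@smallest_sub _ _ _ [set B | H (f @^-1` B)]) => //.
split=> /= [|B HB|B HB].
- by rewrite preimage_set0.
- by rewrite setTD preimage_setC -setTD; exact: HC.
- by rewrite preimage_bigcup; exact: HU.
Qed.

Lemma sigma_setC (T : Type) (G : set_system T) A : <<s G >> A -> <<s G >> (~` A).
Proof. by have [_ GC _] := @smallest_sigma_algebra _ setT G; rewrite -setTD; exact: GC. Qed.

Lemma sigma_bigcap (T : Type) (G : set_system T) (A : nat -> set T) :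
  (forall n, <<s G >> (A n)) -> <<s G >> (\bigcap_n A n).
Proof.
move=> GA; rewrite -[X in <<s _ >> X]setCK; apply: sigma_setC; rewrite setC_bigcap.
by apply: sigma_algebra_bigcup => n; exact: sigma_setC.
Qed.

Lemma measurable_wrtE d (T : measurableType d) (S : Type) (SS : set_system S) (f : T -> S) :
  measurable_wrt setT (@measurable d T) SS f <->
  (forall B, SS B -> measurable (f @^-1` B)).
Proof. by split=> h B /h; rewrite setTI. Qed.

Lemma prob_ae_eq d (T : measurableType d) (R : realType) (P : probability T R)
    (A B : set T) : measurable A -> measurable B ->
  {ae P, forall w, A w <-> B w} -> P A = P B.
Proof.
move=> mA mB [N [mN N0 AB]].
have nN : P.-null_set N by apply/measure0_null_setP.
rewrite -(iffLR (null_setU P mN) nN A mA) -(iffLR (null_setU P mN) nN B mB).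
congr (P _); apply/seteqP; split=> w [?|]; try by right.
  by apply: contrapT => /not_orP[nB nw]; apply/nw/AB => /= -[/(_ _)h _]; exact/nB/h.
by apply: contrapT => /not_orP[nB nw]; apply/nw/AB => /= -[_ /(_ _)h]; exact/nB/h.
Qed.

Section path_type.
Variables (S : Type) (SS : set_system S) (Good : set (int -> S)) (pt : {u | Good u}).

(** The arguments [SS] and [pt] index the type so that its sigma-algebra and its base point are
    found by inference. *)
Definition path_of (SS : set_system S) (pt : {u | Good u}) := {u | Good u}.
HB.instance Definition _ := gen_eqMixin (path_of SS pt).
HB.instance Definition _ := gen_choiceMixin (path_of SS pt).
HB.instance Definition _ := isPointed.Build (path_of SS pt) pt.

(** The trace of the product sigma-algebra. [Good] may lie outside that sigma-algebra, and the
    functionals studied later make sense only on good paths. *)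
Definition path_system : set_system (path_of SS pt) :=
  [set A | exists2 B, sigma_eval setT SS B & A = (fun u : path_of SS pt => sval u) @^-1` B].

Definition path_space := g_sigma_algebraType path_system.

Lemma path_measurableE (A : set path_space) : measurable A <-> path_system A.
Proof.
split=> [|pA]; last exact: sub_sigma_algebra.
rewrite /measurable /= sigma_algebra_id//; split=> [|B [C CS ->]|B Bn].
- by exists set0; rewrite ?preimage_set0//; exact: sigma_algebra0.
- by exists (~` C); [exact: sigma_setC|rewrite setTD preimage_setC].
- have {}Bn n : exists C, sigma_eval setT SS C /\
    B n = (fun u : path_of SS pt => sval u) @^-1` C by have [C] := Bn n; exists C.
  have [C CB] := boolp.choice Bn; exists (\bigcup_n C n).
    by apply: sigma_algebra_bigcup => n; have [] := CB n.
  by rewrite preimage_bigcup; apply: eq_bigcupr => n _; have [] := CB n.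
Qed.

Lemma measurable_coordinate (t : int) (B : set S) : SS B ->
  measurable [set u : path_space | B (sval u t)].
Proof.
move=> SB; apply/path_measurableE; exists [set u | B (u t)] => //.
by apply: sub_sigma_algebra; exists t, B.
Qed.

Lemma measurable_to_path d (T : measurableType d) (f : T -> path_space) :
  (forall t B, SS B -> measurable [set w | B (sval (f w) t)]) ->
  measurable_fun setT f.
Proof.
move=> mf _ A /path_measurableE[B SB ->]; rewrite setTI.
apply: (@preimage_sigma _ _ (fun w => sval (f w)) _ _ _ _ _ SB).
  exact: sigma_algebra_measurable.
by move=> C [t [D [_ SD ->]]]; exact: mf.
Qed.

Hypothesis Good_shift : forall (s : int) u, Good u -> Good (fun t => u (t + s)).

Definition path_shift (s : int) (u : path_space) : path_space :=
  exist _ (fun t => sval u (t + s)) (Good_shift s (svalP u)).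

Lemma path_ext (u v : path_space) : (forall t, sval u t = sval v t) -> u = v.
Proof.
case: u v => [u gu] [v gv] /= uv; have {}uv : u = v by apply/funext.
by subst v; congr exist; exact: Prop_irrelevance.
Qed.

Lemma path_shift_add s s' u : path_shift s (path_shift s' u) = path_shift (s + s') u.
Proof. by apply: path_ext => t /=; rewrite addrA. Qed.

Lemma path_shift0 u : path_shift 0 u = u.
Proof. by apply: path_ext => t /=; rewrite addr0. Qed.

Lemma path_shift_iter s n u : iter n (path_shift s) u = path_shift (s *+ n) u.
Proof.
elim: n => [|n ih]; first by rewrite mulr0n path_shift0.
by rewrite iterS ih path_shift_add mulrS.
Qed.

Lemma measurable_path_shift s : measurable_fun setT (path_shift s).
Proof. by apply: measurable_to_path => t B SB; exact: measurable_coordinate. Qed.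

End path_type.

Section ergodic_process.
Context d (T : measurableType d) (R : realType) (P : probability T R).
Variables (S : Type) (SS : set_system S) (Y Y' : int -> T -> S) (Good : set (int -> S)).
Hypothesis Good_shift : forall (s : int) u, Good u -> Good (fun t => u (t + s)).
Hypothesis Ystat : stationary P SS Y.
Hypothesis Yerg : ergodic P SS Y.
Hypothesis Y'good : forall w, Good (Y' ^~ w).
Hypothesis Y'meas : forall t B, SS B -> measurable (Y' t @^-1` B).
Hypothesis Y'ae : {ae P, forall w, forall t, Y' t w = Y t w}.

Let pt : {u | Good u} := exist _ (Y' ^~ point) (Y'good point).
Let Om := path_space SS pt.

Definition process_path (w : T) : path_space SS pt := exist _ (Y' ^~ w) (Y'good w).
Local Notation Phi := process_path.
Local Notation shift := (@path_shift _ SS _ pt Good_shift).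

Lemma measurable_process_path : measurable_fun setT Phi.
Proof. by apply: measurable_to_path => t B; exact: Y'meas. Qed.

HB.instance Definition _ := isMeasurableFun.Build _ _ _ _ Phi measurable_process_path.
Let Phi_mfun : {mfun T >-> Om} := Phi.
Let mu : probability Om R := distribution P Phi_mfun.

Lemma sigma_eval_measurable (B : set (int -> S)) : sigma_eval setT SS B ->
  measurable [set w | B (fun t => Y' t w)] /\ measurable [set w | B (fun t => Y t w)].
Proof.
move=> SB; split.
  apply: (@preimage_sigma _ _ (fun w t => Y' t w) _ _ _ _ _ SB).
    exact: sigma_algebra_measurable.
  by move=> C [t [D [_ SD ->]]]; exact: Y'meas.
apply: (@preimage_sigma _ _ (fun w t => Y t w) _ _ _ _ _ SB).
  exact: sigma_algebra_measurable.
move=> C [t [D [_ SD ->]]]; have /measurable_wrtE := Ystat.1 t; exact.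
Qed.

Lemma process_path_prob (B : set (int -> S)) : sigma_eval setT SS B ->
  P [set w | B (fun t => Y' t w)] = P [set w | B (fun t => Y t w)].
Proof.
move=> /sigma_eval_measurable[mB' mB]; apply: prob_ae_eq => //.
apply: filterS Y'ae => w YY /=; suff -> : (fun t => Y' t w) = (fun t => Y t w) by [].
exact/funext.
Qed.

Lemma process_path_shift1 A : measurable A -> mu (shift 1 @^-1` A) = mu A.
Proof.
move=> /path_measurableE[B SB ->].
rewrite /mu /distribution /pushforward /=.
have SB1 : sigma_eval setT SS [set u : int -> S | B (fun t => u (t + 1))].
  apply: (@preimage_sigma _ _ (fun u t => u (t + 1)) _ _ _ _ _ SB).
    exact: smallest_sigma_algebra.
  by move=> C [t [D [_ SD ->]]]; apply: sub_sigma_algebra; exists (t + 1), D.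
transitivity (P [set w | B (fun t => Y' (t + 1) w)]); first by [].
by rewrite (process_path_prob SB1) /= (Ystat.2 _ SB) -(process_path_prob SB).
Qed.

Lemma process_path_shiftN1 A : measurable A -> mu (shift (-1) @^-1` A) = mu A.
Proof.
move=> mA; have mA' : measurable (shift (-1) @^-1` A).
  by rewrite -[X in measurable X]setTI; exact: measurable_path_shift.
rewrite -(process_path_shift1 mA'); congr (mu _).
by apply/seteqP; split => u /=; rewrite path_shift_add addNr path_shift0.
Qed.

(* An invariant set of good paths is the trace of a strictly invariant set of all paths:
   the paths visiting it infinitely often. *)
Lemma process_path_erg1 A : measurable A -> shift 1 @^-1` A = A ->
  mu A = 0%E \/ mu A = 1%E.
Proof.
move=> /path_measurableE[B SB AB] Ainv.
pose B' := \bigcap_N \bigcup_(n in [set n | (N <= n)%N])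
  [set u : int -> S | B (fun t => u (t + n%:Z))].
have SB' : sigma_eval setT SS B'.
  have mS (n : nat) : sigma_eval setT SS [set u : int -> S | B (fun t => u (t + n%:Z))].
    apply: (@preimage_sigma _ _ (fun u t => u (t + n%:Z)) _ _ _ _ _ SB).
      exact: smallest_sigma_algebra.
    by move=> C [t [D [_ SD ->]]]; apply: sub_sigma_algebra; exists (t + n%:Z), D.
  apply: sigma_bigcap => N; rewrite bigcup_mkcond; apply: sigma_algebra_bigcup => n.
  by case: ifP => _; [exact: mS|exact: sigma_algebra0].
have B'inv u : B' (fun t => u (t + 1)) <-> B' u.
  split=> Bu N _.
    have [n /= Nn Bn] := Bu N Logic.I; exists n.+1 => /=; first exact: leqW.
    by move: Bn; congr B; apply/funext => t; rewrite intS (addrC 1) addrA.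
  have [[|n] /= Nn Bn] := Bu N.+1 Logic.I; first by [].
  exists n => //=; move: Bn; congr B; apply/funext => t.
  by rewrite intS (addrC 1) addrA.
have AB' u : A u <-> B' (sval u).
  have An n v : A (shift n%:Z v) <-> A v.
    elim: n v => [|n ih] v; first by rewrite path_shift0.
    rewrite -[in X in _ <-> X]Ainv /= -(ih (shift 1 v)) path_shift_add.
    by rewrite addrC intS.
  have An' n v : A v <-> B (fun t => sval v (t + n%:Z)) by rewrite -(An n) AB.
  split=> [Au N _|Bu]; first by exists N => //=; apply/An'.
  by have [n _ /An'] := Bu 0%N Logic.I.
have -> : mu A = P [set w | B' (fun t => Y' t w)].
  rewrite /mu /distribution /pushforward; congr (P _).
  by apply/seteqP; split => w /= h; exact/(AB' (Phi w)).
rewrite (process_path_prob SB'); exact: Yerg.2.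
Qed.

Lemma process_path_ergN1 A : measurable A -> shift (-1) @^-1` A = A ->
  mu A = 0%E \/ mu A = 1%E.
Proof.
move=> mA AN; apply: process_path_erg1 => //.
rewrite -{1}AN; apply/seteqP; split => u /=; by rewrite path_shift_add addNr path_shift0.
Qed.

Lemma ae_path_shift (Q : Om -> Prop) s : {ae mu, forall u, Q u} ->
  {ae mu, forall u, Q (shift s u)}.
Proof.
have H e : (forall A, measurable A -> mu (shift e @^-1` A) = mu A) ->
    forall Q : Om -> Prop, {ae mu, forall u, Q u} -> {ae mu, forall u, Q (shift e u)}.
  move=> inv Q' [N [mN N0 QN]]; exists (shift e @^-1` N); split.
  - by rewrite -[X in measurable X]setTI; exact: measurable_path_shift.
  - by rewrite inv.
  - by move=> u /= nQ; apply: QN.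
have Hn e n : (forall A, measurable A -> mu (shift e @^-1` A) = mu A) ->
    {ae mu, forall u, Q u} -> {ae mu, forall u, Q (shift (e *+ n) u)}.
  move=> inv hQ; elim: n => [|n ih].
    by apply: filterS hQ => u; rewrite mulr0n path_shift0.
  by apply: filterS (H e inv _ ih) => u; rewrite path_shift_add mulrSr.
move=> hQ; case: s => n.
  by have := Hn 1 n process_path_shift1 hQ; rewrite natz.
by have := Hn (-1) n.+1 process_path_shiftN1 hQ; rewrite mulNrn natz NegzE.
Qed.

Lemma ae_process_path (Q : Om -> Prop) : {ae mu, forall u, Q u} ->
  {ae P, forall w, forall s, Q (shift s (Phi w))}.
Proof.
move=> hQ.
(* All integer shifts share one null event because the integers are enumerated: [2k+2] codes [k] and
   [2k+3] codes [-(k+1)]. *)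
have : {ae mu, forall u, forall n, Q (shift (if n is k.+1 then
    (if odd k then Posz k./2 else - Posz k./2) else 0) u)}.
  by apply/ae_foralln => n; exact: ae_path_shift.
move=> [N [mN N0 QN]]; exists (Phi @^-1` N); split=> //.
  by rewrite -[X in measurable X]setTI; exact: measurable_process_path.
move=> w /= nQ; apply: QN => /= h; apply: nQ => s.
have := h (if s is Posz k then k.*2.+2 else if s is Negz k then k.+1.*2.+1 else 0%N).
by case: s => k /=; rewrite ?odd_double /= ?uphalf_double ?doubleK ?NegzE// half_bit_double.
Qed.

Lemma integr_process_path (f : Om -> R) : measurable_fun setT f ->
  P.-integrable setT (EFin \o (f \o Phi)) -> mu.-integrable setT (EFin \o f).
Proof.
move=> mf fi; rewrite /mu /distribution; apply: integrable_pushforward => //.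
exact/measurable_EFinP.
Qed.

Lemma Ex_process_path (f : Om -> R) : measurable_fun setT f ->
  P.-integrable setT (EFin \o (f \o Phi)) ->
  Rintegral mu setT f = Rintegral P setT (f \o Phi).
Proof.
move=> mf fi; rewrite /Rintegral; congr fine.
by rewrite (integral_distribution (X := Phi_mfun))//; exact/measurable_EFinP.
Qed.

Section birkhoff_process.
Variable f : Om -> R.
Hypothesis mf : measurable_fun setT f.
Hypothesis fi : P.-integrable setT (EFin \o (f \o Phi)).

Lemma process_upper (a : R) : Rintegral P setT (f \o Phi) < a ->
  {ae P, forall w, forall s, \forall n \near \oo,
    \sum_(k < n) f (shift (s + k%:Z) (Phi w)) <= a * n%:R}.
Proof.
rewrite -Ex_process_path// => fa.
have := birkhoff_upper (@measurable_path_shift _ SS _ pt Good_shift 1) process_path_shift1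
  process_path_erg1 (integr_process_path mf fi) fa.
move=> /ae_process_path; apply: filterS => w + s => /(_ s); apply: filterS => n.
by under eq_bigr do rewrite path_shift_iter path_shift_add natz addrC.
Qed.

Lemma process_lower (a : R) : a < Rintegral P setT (f \o Phi) ->
  {ae P, forall w, forall s, \forall n \near \oo,
    a * n%:R <= \sum_(k < n) f (shift (s + k%:Z) (Phi w))}.
Proof.
rewrite -Ex_process_path// => fa.
have := birkhoff_lower (@measurable_path_shift _ SS _ pt Good_shift 1) process_path_shift1
  process_path_erg1 (integr_process_path mf fi) fa.
move=> /ae_process_path; apply: filterS => w + s => /(_ s); apply: filterS => n.
by under eq_bigr do rewrite path_shift_iter path_shift_add natz addrC.
Qed.

Lemma process_upperN (a : R) : Rintegral P setT (f \o Phi) < a ->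
  {ae P, forall w, forall s, \forall n \near \oo,
    \sum_(k < n) f (shift (s - k%:Z) (Phi w)) <= a * n%:R}.
Proof.
rewrite -Ex_process_path// => fa.
have := birkhoff_upper (@measurable_path_shift _ SS _ pt Good_shift (-1)) process_path_shiftN1
  process_path_ergN1 (integr_process_path mf fi) fa.
move=> /ae_process_path; apply: filterS => w + s => /(_ s); apply: filterS => n.
by under eq_bigr do rewrite path_shift_iter path_shift_add mulNrn natz addrC.
Qed.

Hypothesis f0 : forall u, 0 <= f u.

Lemma process_small : {ae P, forall w, forall s e, 0 < e ->
  \forall n \near \oo, f (shift (s + n%:Z) (Phi w)) <= e * n%:R}.
Proof.
have := birkhoff_small (@measurable_path_shift _ SS _ pt Good_shift 1) process_path_shift1
  process_path_erg1 (integr_process_path mf fi) f0.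
move=> /ae_process_path; apply: filterS => w + s e e0 => /(_ s e e0); apply: filterS => n.
by rewrite path_shift_iter path_shift_add natz addrC.
Qed.

Lemma process_smallN : {ae P, forall w, forall s e, 0 < e ->
  \forall n \near \oo, f (shift (s - n%:Z) (Phi w)) <= e * n%:R}.
Proof.
have := birkhoff_small (@measurable_path_shift _ SS _ pt Good_shift (-1)) process_path_shiftN1
  process_path_ergN1 (integr_process_path mf fi) f0.
move=> /ae_process_path; apply: filterS => w + s e e0 => /(_ s e e0); apply: filterS => n.
by rewrite path_shift_iter path_shift_add mulNrn natz addrC.
Qed.

End birkhoff_process.
End ergodic_process.

Section modification.
Context d (T : measurableType d) (R : realType) (P : probability T R).
Variables (S : Type) (SS : set_system S) (Y : int -> T -> S) (Good : set (int -> S)).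

Lemma modification : {ae P, forall w, Good (Y ^~ w)} ->
  exists Om0 w0, [/\ measurable Om0, P (~` Om0) = 0%E, Om0 w0 &
    forall w, Om0 w -> Good (Y ^~ w)].
Proof.
move=> [N [mN N0 GN]]; have [w0 nw0] : exists w0, (~` N) w0.
  apply: contrapT => /forallNP h; have : P setT = 0%E.
    by rewrite -N0; congr (P _); apply/seteqP; split=> // w _; apply: contrapT => /h.
  by rewrite probability_setT => /eqP; rewrite eqe oner_eq0.
exists (~` N), w0; split=> //; first exact: measurableC.
  by rewrite setCK.
by move=> w nw; apply: contrapT => /GN.
Qed.

End modification.

(** * Positive definite matrices and square roots *)

Lemma cvg_sum (R : realType) (I : Type) (s : seq I) (f : I -> nat -> R) (l : I -> R) :
  (forall i, f i n @[n --> \oo] --> l i) ->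
  \sum_(i <- s) f i n @[n --> \oo] --> \sum_(i <- s) l i.
Proof.
move=> fl; elim: s => [|i s ih].
  by rewrite big_nil; under eq_fun do rewrite big_nil; exact: cvg_cst.
by rewrite big_cons; under eq_fun do rewrite big_cons; exact: cvgD.
Qed.

Section quadratic_forms.
Context (R : realType).

Lemma trmx_add m n (A B : 'M[R]_(m, n)) : (A + B)^T = A^T + B^T.
Proof. by apply/matrixP => i j; rewrite !mxE. Qed.

Lemma trmx_scale m n a (A : 'M[R]_(m, n)) : (a *: A)^T = a *: A^T.
Proof. by apply/matrixP => i j; rewrite !mxE. Qed.

Lemma trmx_sub m n (A B : 'M[R]_(m, n)) : (A - B)^T = A^T - B^T.
Proof. by apply/matrixP => i j; rewrite !mxE. Qed.

Lemma quadE m (A : 'M[R]_m) u : quad A u = \sum_i \sum_j A i j * (u i 0 * u j 0).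
Proof.
rewrite /quad mxE exchange_big /=; apply: eq_bigr => j _.
by rewrite mxE mulr_suml; apply: eq_bigr => i _; rewrite !mxE; ring.
Qed.

Lemma quadD m (A B : 'M[R]_m) u : quad (A + B) u = quad A u + quad B u.
Proof. by rewrite /quad mulmxDr mulmxDl mxE. Qed.

Lemma quadN m (A : 'M[R]_m) u : quad (- A) u = - quad A u.
Proof. by rewrite /quad mulmxN mulNmx mxE. Qed.

Lemma quadB m (A B : 'M[R]_m) u : quad (A - B) u = quad A u - quad B u.
Proof. by rewrite quadD quadN. Qed.

Lemma quadZ m a (A : 'M[R]_m) u : quad (a *: A) u = a * quad A u.
Proof. by rewrite /quad -scalemxAr -scalemxAl mxE. Qed.

Lemma quadZr m a (A : 'M[R]_m) u : quad A (a *: u) = a ^+ 2 * quad A u.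
Proof. by rewrite /quad trmx_scale -!scalemxAl -scalemxAr !mxE mulrA expr2. Qed.

Lemma quad0r m (A : 'M[R]_m) : quad A 0 = 0.
Proof. by rewrite /quad mulmx0 mxE. Qed.

Lemma quad_conj m n (A : 'M[R]_m) (B : 'M[R]_(m, n)) u : quad (B^T *m A *m B) u = quad A (B *m u).
Proof. by rewrite /quad trmx_mul !mulmxA. Qed.

Lemma quad1E m (u : 'cV[R]_m) : quad 1%:M u = \sum_i u i 0 ^+ 2.
Proof.
by rewrite /quad mulmx1 mxE; apply: eq_bigr => i _; rewrite mxE expr2.
Qed.

Lemma quad1_ge0 m (u : 'cV[R]_m) : 0 <= quad 1%:M u.
Proof. by rewrite quad1E sumr_ge0// => i _; exact: sqr_ge0. Qed.

Lemma quad1_eq0 m (u : 'cV[R]_m) : quad 1%:M u = 0 -> u = 0.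
Proof.
rewrite quad1E => /psumr_eq0P u0; apply/matrixP => i j; rewrite ord1 mxE.
by apply/eqP; rewrite -sqrf_eq0 u0// => k _; exact: sqr_ge0.
Qed.

Lemma quad_add m (A : 'M[R]_m) u v : A^T = A ->
  quad A (u + v) = quad A u + 2 * (u^T *m A *m v) 0 0 + quad A v.
Proof.
move=> sA; rewrite /quad trmx_add !mulmxDl !mulmxDr.
have vu : (v^T *m A *m u) 0 0 = (u^T *m A *m v) 0 0.
  have -> : v^T *m A *m u = (u^T *m A *m v)^T by rewrite !trmx_mul trmxK sA mulmxA.
  by rewrite mxE.
have addE (M N : 'M[R]_1) : (M + N) 0 0 = M 0 0 + N 0 0 by rewrite mxE.
by rewrite !addE vu; ring.
Qed.

Lemma psdD m (A B : 'M[R]_m) : psdmx A -> psdmx B -> psdmx (A + B).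
Proof.
move=> [sA pA] [sB pB]; split; first by rewrite trmx_add sA sB.
by move=> u; rewrite quadD addr_ge0.
Qed.

Lemma psdZ m a (A : 'M[R]_m) : 0 <= a -> psdmx A -> psdmx (a *: A).
Proof.
move=> a0 [sA pA]; split; first by rewrite trmx_scale sA.
by move=> u; rewrite quadZ mulr_ge0.
Qed.

Lemma psd_conj m n (A : 'M[R]_m) (B : 'M[R]_(m, n)) : psdmx A -> psdmx (B^T *m A *m B).
Proof.
move=> [sA pA]; split; first by rewrite !trmx_mul trmxK sA mulmxA.
by move=> u; rewrite quad_conj.
Qed.

Lemma psd1 m : psdmx (1%:M : 'M[R]_m).
Proof. by split; [rewrite trmx1|exact: quad1_ge0]. Qed.

Lemma psd0 m : psdmx (0 : 'M[R]_m).
Proof. by split; [rewrite trmx0|move=> u; rewrite /quad mulmx0 mul0mx mxE]. Qed.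

Lemma pd_psd m (A : 'M[R]_m) : pdmx A -> psdmx A.
Proof.
move=> [sA pA]; split=> // u; have [->|/pA/ltW//] := eqVneq u 0.
by rewrite quad0r.
Qed.

(** Otherwise moving from [u] against [v = A u] makes the form negative: [quad A (u - t v) = - 2 t
    |v|^2 + t^2 quad A v], which is below zero for the [t] chosen here. The [1] in its denominator
    covers [quad A v = 0]. *)
Lemma psd_quad0 m (A : 'M[R]_m) u : psdmx A -> quad A u = 0 -> A *m u = 0.
Proof.
move=> [sA pA] Au0; apply: quad1_eq0; set v := A *m u.
have vE : (u^T *m A *m v) 0 0 = quad 1%:M v.
  by rewrite /quad mulmx1 /v trmx_mul sA.
apply/eqP; rewrite -vE; apply/negP => /negP n0.
have vp : 0 < quad 1%:M v by rewrite lt_def quad1_ge0 -vE n0.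
pose t := quad 1%:M v / (quad A v + 1).
have qp : 0 < quad A v + 1 by rewrite ltr_wpDl.
have := pA (- t *: v + u); rewrite addrC quad_add// Au0 add0r quadZr -scalemxAr mxE vE.
rewrite leNgt => /negP; apply.
have tE : t * (quad A v + 1) = quad 1%:M v by rewrite /t divfK// gt_eqF.
have tp : 0 < t by rewrite divr_gt0.
have := pA v; nra.
Qed.

Lemma quad_bound m (A : 'M[R]_m) (K : R) u : (forall i j, `|A i j| <= K) ->
  `|quad A u| <= m%:R * K * quad 1%:M u.
Proof.
move=> AK; rewrite quadE quad1E.
apply: le_trans (ler_norm_sum _ _ _) _.
apply: (@le_trans _ _ (\sum_i \sum_j K * ((u i 0 ^+ 2 + u j 0 ^+ 2) / 2))).
  apply: ler_sum => i _; apply: le_trans (ler_norm_sum _ _ _) _.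
  apply: ler_sum => j _; rewrite normrM ler_pM// normrM.
  rewrite -[u i 0 ^+ 2]real_normK ?num_real// -[u j 0 ^+ 2]real_normK ?num_real//.
  have := sqr_ge0 (`|u i 0| - `|u j 0|); lra.
under eq_bigr do rewrite -mulr_sumr; rewrite -mulr_sumr.
under eq_bigr do rewrite -mulr_suml big_split /= sumr_const card_ord.
rewrite -mulr_suml big_split /= sumr_const card_ord.
under eq_bigr do rewrite -mulr_natl; rewrite -mulr_sumr -mulr_natl.
rewrite le_eqVlt; apply/orP; left; apply/eqP.
by rewrite -mulr_natr; field.
Qed.

Lemma quad_delta m (A : 'M[R]_m) i : quad A (delta_mx i 0) = A i i.
Proof.
rewrite quadE (bigD1 i)//= (bigD1 i)//= !mxE !eqxx !mulr1 !big1 ?addr0//.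
  by move=> k /negPf ki; rewrite big1// => j _; rewrite !mxE ki !mul0r mulr0.
by move=> j /negPf ji; rewrite !mxE ji !mulr0.
Qed.

Lemma delta_entry m (A : 'M[R]_m) i j :
  ((delta_mx i 0 : 'cV[R]_m)^T *m A *m (delta_mx j 0 : 'cV[R]_m)) 0 0 = A i j.
Proof.
rewrite trmx_delta -rowE mxE (bigD1 j)//= !mxE !eqxx mulr1 big1 ?addr0// => s /negPf sj.
by rewrite !mxE sj mulr0.
Qed.

Lemma psd_entry m (A : 'M[R]_m) i j : psdmx A -> `|A i j| <= (A i i + A j j) / 2.
Proof.
move=> [sA pA].
have := pA (delta_mx i 0 + delta_mx j 0); have := pA (delta_mx i 0 - delta_mx j 0).
rewrite -scaleN1r !quad_add// quadZr !quad_delta -scalemxAr.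
have -> (x : R) (M : 'M[R]_1) : (x *: M) 0 0 = x * M 0 0 by rewrite mxE.
rewrite !delta_entry => h1 h2.
rewrite ler_norml; apply/andP; split; lra.
Qed.

(* Schur complement of the top left entry. *)
Lemma pd_block n (A : 'M[R]_(1 + n)) : pdmx A ->
  let a := ulsubmx A 0 0 in let b := ursubmx A in
  let D := drsubmx A - a^-1 *: (b^T *m b) in
  [/\ 0 < a, pdmx D, \det A = a * \det D &
      \tr A = a + \tr D + a^-1 * quad 1%:M b^T].
Proof.
move=> pA a b D; have [sA qA] := pA.
have aA : a = A 0 0 by rewrite /a !mxE; congr (A _ _); apply: val_inj.
have a0 : 0 < a.
  rewrite aA -quad_delta; apply: qA; apply/negP => /eqP/matrixP/(_ 0 0)/eqP.
  by rewrite !mxE !eqxx oner_eq0.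
have AE : A = block_mx a%:M b b^T (drsubmx A).
  rewrite -[LHS]submxK; congr block_mx.
    by apply/matrixP => i j; rewrite !ord1 [RHS]mxE eqxx.
  by rewrite /b -[in LHS]sA trmx_ursub.
have sDr : (drsubmx A)^T = drsubmx A by rewrite trmx_drsub sA.
have an : a != 0 by rewrite gt_eqF.
split=> //.
- split; first by rewrite trmx_sub sDr trmx_scale trmx_mul trmxK.
  move=> v vn.
  (* This first coordinate minimizes the form for given [v]: the first block of [u^T A] vanishes and
     only the Schur complement remains. *)
  have := qA (col_mx (- a^-1 *: (b *m v)) v).
  have -> : quad A (col_mx (- a^-1 *: (b *m v)) v) = quad D v.
    rewrite {1}AE /quad tr_col_mx mul_row_block mul_row_col.
    rewrite trmx_scale trmx_mul.
    have -> : - a^-1 *: (v^T *m b^T) *m a%:M + v^T *m b^T = 0.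
      by rewrite mul_mx_scalar scalerA mulrN mulfV// scaleN1r addNr.
    rewrite mul0mx add0r /D; congr ((_ *m v) 0 0).
    by rewrite mulmxBr -scalemxAr mulmxA -scalemxAl scaleNr addrC.
  apply; apply/negP => /eqP/(congr1 dsubmx); rewrite col_mxKd linear0 => v0.
  by rewrite v0 eqxx in vn.
- have -> : A = block_mx 1%:M 0 (a^-1 *: b^T) 1%:M *m block_mx a%:M b 0 D.
    rewrite mulmx_block !mul1mx !mul0mx !addr0 {1}AE; congr block_mx.
      by rewrite mul_mx_scalar scalerA mulfV// scale1r.
    by rewrite /D -scalemxAl addrC subrK.
  by rewrite det_mulmx det_lblock det_ublock !det1 !mul1r det_scalar1.
- rewrite {1}AE mxtrace_block /D linearB /= linearZ /= mxtrace_scalar mulr1n.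
  have -> : \tr (b^T *m b) = quad 1%:M b^T.
    by rewrite mxtrace_mulC /quad mulmx1 trmxK /mxtrace big_ord1.
  by rewrite /=; ring.
Qed.

Lemma ln_ltB1 (x : R) : 0 < x -> x != 1 -> ln x < x - 1.
Proof.
move=> x0 x1; rewrite -[ltRHS]expRK ltr_ln ?posrE ?expR_gt0//.
have : x - 1 != 0 by rewrite subr_eq0.
by move=> /expR_gt1Dx; rewrite addrC subrK.
Qed.

Lemma ln_leB1 (x : R) : 0 < x -> ln x <= x - 1.
Proof.
move=> x0; have [->|x1] := eqVneq x 1; first by rewrite ln1 subrr.
exact: ltW (ln_ltB1 x0 x1).
Qed.

(** Induction through the Schur complement takes the place of diagonalization. Each pivot
    contributes [ln a <= a - 1], and the trace keeps the additional term [a^-1 |b|^2]; equality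
    therefore forces [a = 1] and [b = 0] at every stage. *)
Lemma pd_ln_det m (A : 'M[R]_m) : pdmx A ->
  [/\ 0 < \det A, ln (\det A) <= \tr A - m%:R &
      ln (\det A) = \tr A - m%:R -> A = 1%:M].
Proof.
elim: m A => [|n ih] A pA.
  rewrite det_mx00 ln1 subr0 /mxtrace big_ord0; split=> // _.
  by apply/matrixP => -[].
have [] := @pd_block n A pA.
move: (A : 'M[R]_(1 + n)) pA => {}A pA; set a := ulsubmx A 0 0; set b := ursubmx A.
set D := drsubmx A - _ => a0 pD dA tA.
have [D0 Dl De] := ih D pD.
have b0 := quad1_ge0 b^T.
have ai : 0 < a^-1 by rewrite invr_gt0.
have la := ln_leB1 a0.
have lnA : ln (\det A) = ln a + ln (\det D) by rewrite dA lnM ?posrE.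
split; first by rewrite dA mulr_gt0.
  rewrite lnA tA -natr1; have : 0 <= a^-1 * quad 1%:M b^T by rewrite mulr_ge0// ltW.
  lra.
rewrite lnA tA -natr1 => eA.
have h : 0 <= a^-1 * quad 1%:M b^T by rewrite mulr_ge0// ltW.
have a1 : a = 1.
  by apply/eqP; apply: contraT => /(ln_ltB1 a0); lra.
have bz : b = 0.
  rewrite -[b]trmxK; have -> : b^T = 0 by apply: quad1_eq0; move: h eA la; rewrite a1 invr1 mul1r ln1; lra.
  by rewrite trmx0.
have D1 : D = 1%:M by apply: De; lra.
have aE : ulsubmx A = 1%:M by apply/matrixP => i j; rewrite !ord1 -/a a1 mxE.
have dr : drsubmx A = 1%:M by rewrite -D1 /D bz trmx0 mulmx0 scaler0 subr0.
have bl : dlsubmx A = 0 by rewrite -[LHS]trmxK trmx_dlsub pA.1 -/b bz trmx0.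
by rewrite -[A]submxK aE dr bl -/b bz -scalar_mx_block.
Qed.

(* Riesz: the square root of 1 - C, for 0 <= C <= 1, is 1 - lim X_k. *)
Fixpoint riesz m (C : 'M[R]_m) k : 'M[R]_m :=
  if k is k'.+1 then 2^-1 *: (C + riesz C k' *m riesz C k') else 0.

(** Squaring does not preserve the order of symmetric matrices, so the monotonicity of the Riesz
    iterates is read off from coefficients: a polynomial with nonnegative coefficients maps a
    positive semidefinite matrix to a positive semidefinite one. *)
Definition nneg_poly (p : {poly R}) := forall i, 0 <= p`_i.

Lemma nneg_polyD p q : nneg_poly p -> nneg_poly q -> nneg_poly (p + q).
Proof. by move=> np nq i; rewrite coefD addr_ge0. Qed.

Lemma nneg_polyM p q : nneg_poly p -> nneg_poly q -> nneg_poly (p * q).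
Proof. by move=> np nq i; rewrite coefM sumr_ge0// => j _; rewrite mulr_ge0. Qed.

Lemma nneg_polyZ a p : 0 <= a -> nneg_poly p -> nneg_poly (a *: p).
Proof. by move=> a0 np i; rewrite coefZ mulr_ge0. Qed.

Fixpoint riesz_poly k : {poly R} :=
  if k is k'.+1 then 2^-1 *: ('X + riesz_poly k' * riesz_poly k') else 0.

Lemma riesz_poly_nneg k : nneg_poly (riesz_poly k).
Proof.
elim: k => [|k ih] /=; first by move=> i; rewrite coef0.
apply: nneg_polyZ; first by rewrite invr_ge0.
by apply: nneg_polyD (nneg_polyM ih ih) => i; rewrite coefX.
Qed.

Lemma riesz_poly_nd k : nneg_poly (riesz_poly k.+1 - riesz_poly k).
Proof.
elim: k => [|k ih]; first by rewrite [riesz_poly 0]/= subr0; exact: riesz_poly_nneg.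
have qE : riesz_poly k.+1 = 2^-1 *: ('X + riesz_poly k * riesz_poly k) by [].
have -> : riesz_poly k.+2 - riesz_poly k.+1 = 2^-1 *:
    ((riesz_poly k.+1 - riesz_poly k) * (riesz_poly k.+1 + riesz_poly k)).
  rewrite [riesz_poly k.+2](_ : _ = 2^-1 *: ('X + riesz_poly k.+1 * riesz_poly k.+1))//.
  move: (riesz_poly k.+1) qE => q qE; rewrite [X in _ - X]qE -scalerBr.
  by congr (_ *: _); ring.
apply: nneg_polyZ; first by rewrite invr_ge0.
by apply: nneg_polyM => //; apply: nneg_polyD; exact: riesz_poly_nneg.
Qed.

Lemma psd_exp n (C : 'M[R]_n.+1) k : psdmx C -> psdmx (C ^+ k).
Proof.
move=> pC; have [sC _] := pC.
elim/ltn_ind: k => -[|[|k]] ih; first by rewrite expr0; exact: psd1.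
  by rewrite expr1.
have -> : C ^+ k.+2 = C^T *m C ^+ k *m C by rewrite sC exprS exprSr mulrA.
by apply: psd_conj; exact: ih.
Qed.

Lemma psd_horner n (C : 'M[R]_n.+1) p : psdmx C -> nneg_poly p ->
  psdmx (horner_mx C p).
Proof.
move=> pC np; rewrite -[p]coefK poly_def rmorph_sum /=.
apply: big_ind => [||i _]; [exact: psd0|exact: psdD|].
rewrite linearZ /= rmorphXn /= horner_mx_X; apply: psdZ => //; exact: psd_exp.
Qed.

Lemma rieszE n (C : 'M[R]_n.+1) k : riesz C k = horner_mx C (riesz_poly k).
Proof.
elim: k => [|k ih] /=; first by rewrite rmorph0.
by rewrite linearZ /= rmorphD /= rmorphM /= horner_mx_X ih.
Qed.

Lemma riesz_psd n (C : 'M[R]_n.+1) k : psdmx C -> psdmx (riesz C k).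
Proof. by move=> pC; rewrite rieszE; apply: psd_horner => //; exact: riesz_poly_nneg. Qed.

Lemma riesz_nd n (C : 'M[R]_n.+1) k u : psdmx C -> quad (riesz C k) u <= quad (riesz C k.+1) u.
Proof.
move=> pC; rewrite -subr_ge0 -quadB !rieszE -raddfB.
by apply: (psd_horner pC _).2; exact: riesz_poly_nd.
Qed.

Lemma psd_sqr_le m (X : 'M[R]_m) u : psdmx X -> psdmx (1%:M - X) ->
  quad (X *m X) u <= quad X u.
Proof.
move=> pX pX1; rewrite -subr_ge0 -quadB.
have -> : X - X *m X = X^T *m (1%:M - X) *m X + (1%:M - X)^T *m X *m (1%:M - X).
  rewrite pX.1 pX1.1 !(mulmxBl, mulmxBr) !mul1mx !mulmx1.
  move: (X *m X *m X) (X *m X) => b a; apply/matrixP => i j; rewrite !mxE; ring.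
by apply: (psdD (psd_conj _ pX1) (psd_conj _ pX)).2.
Qed.

Lemma riesz_le1 m (C : 'M[R]_m) k : psdmx C -> psdmx (1%:M - C) ->
  psdmx (riesz C k) /\ psdmx (1%:M - riesz C k).
Proof.
move=> pC pC1; have pr l : psdmx (riesz C l).
  (* Size zero is treated apart because the polynomial calculus [horner_mx] requires a nonempty
     matrix. *)
  case: m C pC {pC1} => [|m] C pC; last exact: riesz_psd.
  have -> : riesz C l = 0 by apply/matrixP => -[].
  exact: psd0.
split=> //; elim: k => [|k ih]; first by rewrite subr0; exact: psd1.
split; first by rewrite trmx_sub trmx1 (pr k.+1).1.
move=> u; rewrite quadB /= quadZ quadD subr_ge0.
have := psd_sqr_le u (pr k) ih; have := ih.2 u; have := pC1.2 u.
by rewrite !quadB; lra.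
Qed.

(** The quadratic forms of the iterates increase and stay below that of the identity, hence
    converge; the entries follow by polarization. The limit satisfies [2 L = C + L^2], which is
    [(1 - L)^2 = 1 - C]. *)
Lemma riesz_cvg m (C : 'M[R]_m) : psdmx C -> psdmx (1%:M - C) ->
  exists L : 'M[R]_m, [/\ forall i j, riesz C k i j @[k --> \oo] --> L i j,
    psdmx (1%:M - L) & (1%:M - L) *m (1%:M - L) = 1%:M - C].
Proof.
move=> pC pC1; have rz k := riesz_le1 k pC pC1.
have rnd k u : quad (riesz C k) u <= quad (riesz C k.+1) u.
  case: m C pC pC1 u {rz} => [|m] C pC pC1 u; last exact: riesz_nd.
  by rewrite !quadE !big_ord0.
have rcv u : cvg (quad (riesz C k) u @[k --> \oo]).
  apply: nondecreasing_is_cvgn; first by apply/nondecreasing_seqP.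
  exists (quad 1%:M u) => _ [k _ <-]; rewrite -subr_ge0 -quadB.
  by have [_ [_ /(_ u)]] := rz k.
have rE k i j : riesz C k i j = 2^-1 * (quad (riesz C k) (delta_mx i 0 + delta_mx j 0)
    - riesz C k i i - riesz C k j j).
  rewrite quad_add ?(rz k).1.1// !quad_delta.
  rewrite delta_entry.
  by field.
have rcvE i j : cvg (riesz C k i j @[k --> \oo]).
  under eq_fun do rewrite rE -!quad_delta.
  by apply: is_cvgM; [exact: is_cvg_cst|apply: is_cvgB => //; exact: is_cvgB].
pose L : 'M[R]_m := \matrix_(i, j) lim (riesz C k i j @[k --> \oo]).
have cL i j : riesz C k i j @[k --> \oo] --> L i j by rewrite mxE; exact: rcvE.
have cq u : quad (riesz C k) u @[k --> \oo] --> quad L u.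
  rewrite quadE; under eq_fun do rewrite quadE.
  apply: cvg_sum => i; apply: cvg_sum => j; by apply: cvgM; [exact: cL|exact: cvg_cst].
have LT : L^T = L.
  apply/matrixP => i j; rewrite mxE; apply: (cvg_unique (@Rhausdorff R) (cL j i)).
  rewrite (_ : (fun k => _) = (fun k => riesz C k i j)); first exact: cL.
  by apply/funext => k; rewrite -[in RHS](rz k).1.1 mxE.
have LE : L = 2^-1 *: (C + L *m L).
  apply/matrixP => i j; apply: (cvg_unique (@Rhausdorff R) (cL i j)).
  rewrite /= -(cvg_shiftS (fun k => riesz C k i j)).
  have -> : (2^-1 *: (C + L *m L)) i j = 2^-1 * (C i j + \sum_s L i s * L s j) by rewrite !mxE.
  rewrite (_ : (fun k => _) = (fun k => 2^-1 * (C i j + \sum_s riesz C k i s * riesz C k s j))); last first.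
    by apply/funext => k; rewrite !mxE.
  apply: cvgM; first exact: cvg_cst.
  apply: cvgD; first exact: cvg_cst.
  by apply: cvg_sum => s; exact: cvgM.
exists L; split=> //.
- split; first by rewrite trmx_sub trmx1 LT.
  move=> u; rewrite quadB subr_ge0 -(cvg_lim _ (cq u))//.
  apply: limr_le; first by apply/cvg_ex; eexists; exact: cq.
  by apply: nearW => k; rewrite -subr_ge0 -quadB; exact: (rz k).2.2.
- have h : C + L *m L = L + L.
    have := congr1 (fun M : 'M[R]_m => 2 *: M) LE.
    by rewrite /= scalerA mulfV ?pnatr_eq0// scale1r scaler_nat mulr2n.
  have LL : L *m L = L + L - C by rewrite -h addrC addKr.
  rewrite mulmxBl !mulmxBr !mul1mx mulmx1 LL.
  by apply/matrixP => i j; rewrite !mxE; ring.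
Qed.

(** With [v = (B - S) u], commutation gives [(B + S) v = 0]. Both forms then vanish at [v], so
    [B v = S v = 0] and [|v|^2 = u^T (B - S) v = 0]. *)
Lemma psd_sqrt_unique m (B S : 'M[R]_m) : psdmx B -> psdmx S ->
  B *m B = S *m S -> B *m S = S *m B -> B = S.
Proof.
move=> pB pS BS cBS.
suff h (u : 'cV[R]_m) : (B - S) *m u = 0.
  apply/eqP; rewrite -subr_eq0; apply/eqP/matrixP => i j.
  have := h (delta_mx j 0) => /matrixP/(_ i 0); rewrite -colE !mxE => ->.
  by [].
set v := (B - S) *m u.
have Bv : quad B v + quad S v = 0.
  rewrite -quadD /quad -mulmxA.
  have -> : (B + S) *m v = 0.
    by rewrite /v mulmxA mulmxDl !mulmxBr BS cBS addrC addrA subrK subrr mul0mx.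
  by rewrite mulmx0 mxE.
have B0 : B *m v = 0 by apply: psd_quad0 => //; have := pB.2 v; have := pS.2 v; lra.
have S0 : S *m v = 0 by apply: psd_quad0 => //; have := pB.2 v; have := pS.2 v; lra.
apply: quad1_eq0; rewrite /quad mulmx1 {1}/v trmx_mul trmx_sub pB.1 pS.1 -mulmxA.
by rewrite mulmxBl B0 S0 subrr mulmx0 mxE.
Qed.

Lemma riesz_comm m (B C : 'M[R]_m) k : B *m C = C *m B -> B *m riesz C k = riesz C k *m B.
Proof.
move=> BC; elim: k => [|k ih] /=; first by rewrite mulmx0 mul0mx.
by rewrite -scalemxAr -scalemxAl mulmxDr mulmxDl BC mulmxA ih -!mulmxA ih.
Qed.

(** Dividing by any number above the largest eigenvalue brings [A] below the identity. This one is a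
    measurable function of the entries, and the [1] keeps it positive at [A = 0]. *)
Definition sqrt_scale m (A : 'M[R]_m) : R := 1 + m%:R * \sum_i \sum_j `|A i j|.

Lemma sqrt_scale_gt0 m (A : 'M[R]_m) : 0 < sqrt_scale A.
Proof. by rewrite ltr_pwDl// mulr_ge0// !sumr_ge0// => i _; rewrite sumr_ge0. Qed.

Lemma psd_scale m (A : 'M[R]_m) : psdmx A ->
  psdmx (1%:M - (sqrt_scale A)^-1 *: A).
Proof.
move=> pA; have g0 := sqrt_scale_gt0 A; split; first by rewrite trmx_sub trmx1 trmx_scale pA.1.
move=> u; rewrite quadB quadZ subr_ge0 mulrC ler_pdivrMr//.
pose K := \sum_i \sum_j `|A i j|.
have AK i j : `|A i j| <= K.
  rewrite /K (bigD1 i)//= (bigD1 j)//= -addrA lerDl addr_ge0 ?sumr_ge0// => k _.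
  by rewrite sumr_ge0.
apply: le_trans (ler_norm _) _; apply: le_trans (quad_bound u AK) _.
by rewrite mulrC ler_wpM2l ?quad1_ge0// /sqrt_scale -/K lerDr.
Qed.

(** A root of [A] commutes with [A], hence with the iterates and with their limit, so [sqrtmx A] is
    the Riesz root. The third clause writes its entries as limits of explicit functions of those of
    [A], from which [mx_meas_sqrt] obtains measurability. *)
Theorem sqrtmxP m (A : 'M[R]_m) : psdmx A ->
  [/\ psdmx (sqrtmx A), sqrtmx A *m sqrtmx A = A &
   forall i j, Num.sqrt (sqrt_scale A) * ((i == j)%:R -
     riesz (1%:M - (sqrt_scale A)^-1 *: A) k i j) @[k --> \oo] --> sqrtmx A i j].
Proof.
move=> pA; have g0 := sqrt_scale_gt0 A; set g := sqrt_scale A in g0 *.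
set C := 1%:M - g^-1 *: A.
have pC : psdmx C by exact: psd_scale.
have C1 : 1%:M - C = g^-1 *: A by rewrite /C opprB addrC subrK.
have pC1 : psdmx (1%:M - C) by rewrite C1; apply: psdZ => //; rewrite invr_ge0 ltW.
have [L [cL pL LL]] := riesz_cvg pC pC1.
pose S := Num.sqrt g *: (1%:M - L).
have pS : psdmx S by apply: psdZ => //; exact: sqrtr_ge0.
have SS : S *m S = A.
  rewrite /S -scalemxAl -scalemxAr scalerA -expr2 sqr_sqrtr ?ltW// LL C1 scalerA.
  by rewrite mulfV ?gt_eqF// scale1r.
have [pB BB] : [set B | psdmx B /\ B *m B = A] (sqrtmx A) by apply: (@xgetI _ _ _ S); split.
split=> // i j; have -> : sqrtmx A = S.
  apply: psd_sqrt_unique => //; first by rewrite BB.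
  have cA : sqrtmx A *m C = C *m sqrtmx A.
    have := mulmxA (sqrtmx A) (sqrtmx A) (sqrtmx A); rewrite BB => AA.
    by rewrite /C mulmxBr mulmxBl mulmx1 mul1mx -scalemxAr -scalemxAl AA.
  have cLc : sqrtmx A *m L = L *m sqrtmx A.
    apply/matrixP => k l; rewrite !mxE.
    apply: (@cvg_unique _ (@Rhausdorff R) (fmap (fun n => \sum_s sqrtmx A k s * riesz C n s l) \oo)).
      by apply: cvg_sum => s; apply: cvgM; [exact: cvg_cst|exact: cL].
    rewrite (_ : (fun n => _) = (fun n => \sum_s riesz C n k s * sqrtmx A s l)).
      by apply: cvg_sum => s; apply: cvgM; [exact: cL|exact: cvg_cst].
    by apply/funext => n; have /matrixP/(_ k l) := riesz_comm n cA; rewrite !mxE.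
  by rewrite /S -scalemxAr -scalemxAl mulmxBr mulmxBl mulmx1 mul1mx cLc.
rewrite /S !mxE; apply: cvgM; first exact: cvg_cst.
by apply: cvgB; [exact: cvg_cst|exact: cL].
Qed.

Lemma pd_unit m (A : 'M[R]_m) : pdmx A -> A \in unitmx.
Proof. by move=> /pd_ln_det[d0 _ _]; rewrite unitmxE unitfE gt_eqF. Qed.

Lemma pd_sqrt_unit m (A : 'M[R]_m) : pdmx A -> sqrtmx A \in unitmx.
Proof.
move=> pA; have [_ SS _] := sqrtmxP (pd_psd pA).
by have := pd_unit pA; rewrite -{1}SS unitmx_mul andbb.
Qed.

Lemma pd_inv m (A : 'M[R]_m) : pdmx A -> pdmx (invmx A).
Proof.
move=> pA; have uA := pd_unit pA; split; first by rewrite trmx_inv pA.1.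
move=> u un; have -> : invmx A = (invmx A)^T *m A *m invmx A.
  by rewrite trmx_inv pA.1 -mulmxA mulmxV// mulmx1.
rewrite quad_conj; apply: pA.2; apply: contra_neq un => h.
by rewrite -(mulKVmx uA u) h mulmx0.
Qed.

Lemma pd_conj m (A B : 'M[R]_m) : pdmx A -> B \in unitmx -> pdmx (B^T *m A *m B).
Proof.
move=> pA uB; split; first by rewrite !trmx_mul trmxK pA.1 mulmxA.
move=> u un; rewrite quad_conj; apply: pA.2; apply: contra_neq un => h.
by rewrite -(mulKmx uB u) h mulmx0.
Qed.

(* The difference of the two sides is twice the Kullback-Leibler divergence of N(0, S) from N(0, L). *)
Lemma gauss_divergence m (S L : 'M[R]_m) : pdmx S -> pdmx L ->
  let Q := sqrtmx S in
  m%:R + ln (\det S) <= \tr (Q *m invmx L *m Q) + ln (\det L) /\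
  (m%:R + ln (\det S) = \tr (Q *m invmx L *m Q) + ln (\det L) -> S = L).
Proof.
move=> pS pL Q; have [[sQ _] QQ _] := sqrtmxP (pd_psd pS).
have uQ := pd_sqrt_unit pS.
have pB : pdmx (Q *m invmx L *m Q).
  have -> : Q *m invmx L *m Q = Q^T *m invmx L *m Q by rewrite [Q^T]sQ.
  by apply: pd_conj => //; exact: pd_inv.
have [dS _ _] := pd_ln_det pS; have [dL _ _] := pd_ln_det pL.
have [dB lB eB] := pd_ln_det pB.
have dBE : ln (\det (Q *m invmx L *m Q)) = ln (\det S) - ln (\det L).
  rewrite !det_mulmx det_inv mulrAC -det_mulmx QQ lnM ?posrE ?invr_gt0//.
  by rewrite lnV ?posrE.
split; first by rewrite dBE in lB; lra.
move=> h; have B1 : Q *m invmx L *m Q = 1%:M by apply: eB; rewrite dBE; lra.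
have uL := pd_unit pL.
have : Q *m (Q *m invmx L *m Q) *m invmx Q = 1%:M by rewrite B1 mulmx1 mulmxV.
rewrite !mulmxA QQ -mulmxA mulmxV// mulmx1 => h1.
by rewrite -[LHS](mulmxKV uL) h1 mul1mx.
Qed.

End quadratic_forms.

(** * Separability, product metrics and Lipschitz constants of random maps *)

Lemma compact_finite_cover (U : topologicalType) (K : set U) (O : U -> set U) :
  compact K -> (forall x, K x -> nbhs x (O x)) ->
  exists2 s : seq U, (forall c, c \in s -> K c) &
    forall x, K x -> exists2 c, c \in s & O c x.
Proof.
move=> /compact_near_coveringP cK nO.
(* The filter of finite sequences of points of [K], directed by inclusion: a property holding near
   it, uniformly on [K], yields a finite subcover. *)
pose F : set_system (seq U) := fun A =>
  exists2 s0 : seq U, (forall c, c \in s0 -> K c) &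
    forall s, {subset s0 <= s} -> (forall c, c \in s -> K c) -> A s.
have FF : Filter F.
  split; first by exists [::].
    move=> A B [a aK aA] [b bK bB]; exists (a ++ b).
      by move=> c; rewrite mem_cat => /orP[/aK|/bK].
    move=> s abs sK; split; [apply: aA|apply: bB] => // c cs; apply: abs;
      by rewrite mem_cat cs ?orbT.
  by move=> A B AB [a aK aA]; exists a => // s /aA h /h /AB.
have := cK _ F (fun s x => exists2 c, c \in s & O c x) FF.
move=> /(_ _)[x Kx|s0 s0K /(_ s0 (fun _ h => h) s0K) h]; last by exists s0.
exists (O x, [set s : seq U | x \in s]).
  split => /=; first exact: nO.
  exists [:: x]; first by move=> c; rewrite inE => /eqP ->.
  by move=> s xs _; apply: xs; rewrite inE.
by move=> [y s] /= [Oy xs]; exists x.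
Qed.

(** The centres of a finite net of [K] may lie outside [V]. Each is replaced by a point of [V] in
    its ball when there is one, which doubles the radius. *)
Lemma compact_dense_seq (R : realType) (U : pseudoMetricType R) (K V : set U) :
  compact K -> V `<=` K -> V !=set0 ->
  exists2 e : nat -> U, (forall n, V (e n)) &
    forall x (r : R), V x -> 0 < r -> exists n, ball x r (e n).
Proof.
move=> cK VK [v0 Vv0].
have cov n : {s : seq U | forall x, K x -> exists2 c, c \in s & ball c n.+1%:R^-1 x}.
  apply: cid; have [|s _ sK] := @compact_finite_cover U K (fun c => ball c n.+1%:R^-1) cK.
    by move=> x _; apply: nbhsx_ballx; rewrite invr_gt0.
  by exists s.
pose pk (nk : nat * nat) := xget v0
  (V `&` ball (nth v0 (sval (cov nk.1)) nk.2) nk.1.+1%:R^-1).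
pose e k := pk (odflt (0, 0)%N (unpickle k)).
exists e; first by move=> k; rewrite /e /pk; case: xgetP => [x _ []|].
move=> x r Vx r0.
have [n nr] : exists n : nat, 2 * n.+1%:R^-1 <= r.
  exists (Num.truncn (2 * r^-1)).
  rewrite ler_pdivrMr// mulrC -ler_pdivrMr//.
  by apply: ltW; exact: truncnS_gt.
have [c cs cx] := svalP (cov n) x (VK x Vx).
exists (pickle (n, index c (sval (cov n)))); rewrite /e pickleK /=.
rewrite /pk /= nth_index//; apply: le_ball nr _ _.
rewrite mulr_natl mulr2n; apply: ball_triangle (ball_sym cx) _.
by have /(_ x)[] // := @xgetI _ v0 (V `&` ball c n.+1%:R^-1).
Qed.

Lemma countable_dense_seq (T : Type) (Q : set T) : countable Q -> Q !=set0 ->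
  exists2 q : nat -> T, (forall n, Q (q n)) & forall x, Q x -> exists n, q n = x.
Proof.
move=> /countable_injP[f fi] [x0 Qx0].
pose q n := if pselect (exists2 x, Q x & f x = n) is left h then sval (cid2 h) else x0.
exists q.
  by move=> n; rewrite /q; case: pselect => // h; case: (cid2 h).
move=> x Qx; exists (f x); rewrite /q; case: pselect => [h|[]]; last by exists x.
by case: (cid2 h) => /= y Qy fy; apply: fi; rewrite ?inE.
Qed.

Section real_measurability.
Context d (T : measurableType d) (R : realType).

Lemma measurable_of_lt (f : T -> R) :
  (forall c, measurable [set x | f x < c]) -> measurable_fun setT f.
Proof.
move=> mf; apply: (measurability _ (RGenInftyO.measurableE R)) => _ [_ [c ->] <-].
rewrite setTI (_ : _ @^-1` _ = [set x | f x < c])//.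
Qed.

Lemma measurable_sup_seq (f : nat -> T -> R) : (forall n, measurable_fun setT (f n)) ->
  (forall x, has_ubound (range (f ^~ x))) ->
  measurable_fun setT (fun x => sup (range (f ^~ x))).
Proof.
move=> mf uf; apply: (eq_measurable_fun (fun x => sups (f ^~ x) 0)).
  move=> x _; rewrite /sups /sdrop; congr sup.
  by apply/seteqP; split => _ [n _ <-]; exists n.
exact: measurable_fun_sups.
Qed.

(** A substitute for joint measurability: the value at [f w] is below [c] exactly when some dense
    point has value plus [K w * dist] below [c]. Only the distances from [f] to the dense points
    have to be measurable. *)
Lemma measurable_lipschitz_comp (X : Type) (dist : X -> X -> R) (E : set X)
    (q : nat -> X) (f : T -> X) (G : T -> X -> R) (K : T -> R) :
  (forall x y, dist x y = dist y x) ->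
  (forall n, E (q n)) -> (forall x e, E x -> 0 < e -> exists n, dist x (q n) < e) ->
  (forall w, E (f w)) -> (forall n, measurable_fun setT (fun w => dist (f w) (q n))) ->
  (forall n, measurable_fun setT (fun w => G w (q n))) ->
  measurable_fun setT K -> (forall w, 0 <= K w) ->
  (forall w x y, E x -> E y -> G w x <= G w y + K w * dist x y) ->
  measurable_fun setT (fun w => G w (f w)).
Proof.
move=> dC Eq dq Ef mf mG mK K0 LG; apply: measurable_of_lt => c.
rewrite (_ : [set _ | _] = \bigcup_n [set w | G w (q n) + K w * dist (f w) (q n) < c]).
  apply: bigcup_measurable => n _; apply: measurable_lt_set => //.
  by apply: measurable_funD => //; exact: measurable_funM.
apply/seteqP; split => w /= => [Gc|[n _ /=]]; last exact: le_lt_trans (LG _ _ _ _ _).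
(* The Lipschitz bound and the added term [K w * dist] cost at most [K w * e] each; the [1] covers
   [K w = 0]. *)
pose e := (c - G w (f w)) / (2 * K w + 1).
have k0 : 0 < 2 * K w + 1 by rewrite ltr_wpDl// mulr_ge0.
have e0 : 0 < e by rewrite divr_gt0// subr_gt0.
have [n dn] := dq _ _ (Ef w) e0; exists n => //=.
have := LG w (q n) (f w) (Eq n) (Ef w); rewrite dC => Gq.
have : e * (2 * K w + 1) = c - G w (f w) by rewrite divfK ?gt_eqF.
have := K0 w; nra.
Qed.

End real_measurability.

(** * Product metrics and their coordinates *)

Section product_distance.
Context (R : realType) (p : nat) (F : metricType R) (N : 'rV[R]_p -> R).
Hypothesis mN : monotone_norm N.
Local Notation dE := (@prod_dist R p F N).

Lemma norm0 : N 0 = 0.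
Proof. by have [_ _ /(_ 0 0) + _] := mN; rewrite scale0r normr0 mul0r. Qed.

Lemma norm_ge0 a : 0 <= N a.
Proof.
have [_ Nt NZ _] := mN; have := Nt a (-1 *: a).
by rewrite NZ normrN1 mul1r scaleN1r subrr norm0; lra.
Qed.

Lemma prod_dist_ge0 x y : 0 <= dE x y.
Proof. exact: norm_ge0. Qed.

Lemma prod_distC x y : dE x y = dE y x.
Proof. by congr N; apply/matrixP => i j; rewrite !mxE metric_sym. Qed.

Lemma prod_dist_triangle x y z : dE x z <= dE x y + dE y z.
Proof.
have [_ Nt _ Nm] := mN; apply: le_trans (Nt _ _); apply: Nm => j; rewrite !mxE.
by rewrite mdist_ge0 metric_triangle.
Qed.

Lemma prod_distxx x : dE x x = 0.
Proof.
rewrite /prod_dist (_ : \row__ _ = 0) ?norm0//.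
by apply/matrixP => i j; rewrite !mxE mdistxx.
Qed.

Lemma prod_dist_eq0 x y : dE x y = 0 -> x = y.
Proof.
have [N0 _ _ _] := mN; move=> /N0/matrixP xy; apply/funext => j.
by apply: mdist_positivity; have := xy 0 j; rewrite !mxE.
Qed.

Lemma prod_dist_gt0 x y : x <> y -> 0 < dE x y.
Proof.
by move=> xy; rewrite lt_neqAle prod_dist_ge0 andbT eq_sym; apply/negP => /eqP/prod_dist_eq0.
Qed.

Definition coord_const : R := \sum_j (N (delta_mx 0 j))^-1.
Definition norm_const : R := \sum_j N (delta_mx 0 j).

Lemma norm_const_ge0 : 0 <= norm_const.
Proof. by apply: sumr_ge0 => j _; exact: norm_ge0. Qed.

Lemma coord_const_ge0 : 0 <= coord_const.
Proof. by apply: sumr_ge0 => j _; rewrite invr_ge0 norm_ge0. Qed.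

Lemma coord_dist x y j : mdist (x j) (y j) <= coord_const * dE x y.
Proof.
have [N0 _ NZ Nm] := mN.
have dj : 0 < N (delta_mx 0 j).
  rewrite lt_neqAle norm_ge0 andbT eq_sym; apply/negP => /eqP/N0/matrixP/(_ 0 j)/eqP.
  by rewrite !mxE !eqxx oner_eq0.
apply: (@le_trans _ _ ((N (delta_mx 0 j))^-1 * dE x y)); last first.
  apply: ler_wpM2r; first exact: prod_dist_ge0.
  by rewrite /coord_const (bigD1 j)//= lerDl sumr_ge0// => k _; rewrite invr_ge0 norm_ge0.
rewrite ler_pdivlMl// mulrC -[mdist _ _]ger0_norm ?mdist_ge0// -NZ; apply: Nm => k.
rewrite !mxE eqxx /=; have [->|kj] := eqVneq k j; by rewrite ?mulr1 ?mulr0 ?mdist_ge0 ?lexx.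
Qed.

Lemma prod_dist_le x y : dE x y <= norm_const * \sum_j mdist (x j) (y j).
Proof.
have [_ Nt NZ _] := mN.
have Ns (I : Type) (s : seq I) (f : I -> 'rV[R]_p) : N (\sum_(i <- s) f i) <= \sum_(i <- s) N (f i).
  elim: s => [|i s ih]; first by rewrite !big_nil norm0.
  by rewrite !big_cons (le_trans (Nt _ _))// lerD2l.
rewrite /prod_dist [X in N X]row_sum_delta; apply: le_trans (Ns _ _ _) _.
rewrite /norm_const mulr_suml; apply: ler_sum => j _.
rewrite NZ !mxE ger0_norm ?mdist_ge0// mulrC ler_wpM2l ?norm_ge0//.
by rewrite (bigD1 j)//= lerDl sumr_ge0// => k _; exact: mdist_ge0.
Qed.

Lemma prod_dist_triangle4 x y x' y' : dE x y <= dE x x' + dE x' y' + dE y y'.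
Proof.
apply: le_trans (prod_dist_triangle x x' y) _; rewrite -addrA lerD2l.
by apply: le_trans (prod_dist_triangle x' y' y) _; rewrite [dE y' y]prod_distC.
Qed.

End product_distance.

(** * Continuous families of Lipschitz maps and their optimal constants *)

Section good_maps.
Context (R : realType) (p : nat) (F : metricType R) (N : 'rV[R]_p -> R).
Hypothesis mN : monotone_norm N.
Local Notation dE := (@prod_dist R p F N).
Local Notation block := ('I_p -> F).
Variables (E : set block) (q : nat -> block).
Hypotheses (Eq : forall n, E (q n))
  (dq : forall x e, E x -> 0 < e -> exists n, dE x (q n) < e).
Variables (U : pseudoMetricType R) (Theta : set U).

(** What almost every realization of the maps satisfies. The Lipschitz constant common to all
    parameters comes from the continuity of the random bound on the compact set. *)
Record good_map (k : block -> U -> block) : Prop := GoodMap {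
  good_stable : forall y th, E y -> Theta th -> E (k y th);
  good_cont : forall y th e, E y -> Theta th -> 0 < e ->
    \forall th' \near within Theta (nbhs th), dE (k y th') (k y th) < e;
  good_lip : exists2 L, 0 <= L & forall th x y, Theta th -> E x -> E y ->
    dE (k x th) (k y th) <= L * dE x y }.

Lemma good_id : good_map (fun y _ => y).
Proof.
split=> //; last by exists 1 => // th x y _ _ _; rewrite mul1r.
by move=> y th e Ey Tth e0; apply: nearW => th'; rewrite prod_distxx.
Qed.

Lemma good_comp k1 k2 : good_map k1 -> good_map k2 ->
  good_map (fun y th => k2 (k1 y th) th).
Proof.
move=> g1 g2; have [L1 L10 l1] := good_lip g1; have [L2 L20 l2] := good_lip g2; split.
- by move=> y th Ey Tth; apply: (good_stable g2) => //; exact: (good_stable g1).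
- move=> y th e Ey Tth e0.
  have e1 : 0 < e / 2 / (L2 + 1) by rewrite !divr_gt0// ltr_wpDl.
  have h1 := good_cont g1 Ey Tth e1.
  have h2 := good_cont g2 (good_stable g1 Ey Tth) Tth (divr_gt0 e0 (ltr0n R 2)).
  have h3 : \forall th' \near within Theta (nbhs th), Theta th' by exact: withinT.
  near=> th'.
  have T' : Theta th' by near: th'.
  apply: le_lt_trans (prod_dist_triangle mN _ (k2 (k1 y th) th') _) _.
  rewrite [ltRHS]splitr; apply: ler_ltD; last by near: th'.
  apply: le_trans (l2 _ _ _ T' (good_stable g1 Ey T') (good_stable g1 Ey Tth)) _.
  have : dE (k1 y th') (k1 y th) < e / 2 / (L2 + 1) by near: th'.
  rewrite ltr_pdivlMr ?ltr_wpDl//; have := prod_dist_ge0 mN (k1 y th') (k1 y th); nra.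
- exists (L2 * L1); first exact: mulr_ge0.
  move=> th x y Tth Ex Ey; apply: le_trans (l2 _ _ _ Tth _ _) _; try exact: (good_stable g1).
  by rewrite -mulrA ler_wpM2l// l1.
Unshelve. all: by end_near. Qed.

Section lipschitz_constant.
Variables (V : set U) (e : nat -> U).
Hypotheses (VT : V `<=` Theta) (eV : forall n, V (e n))
  (de : forall x (r : R), V x -> 0 < r -> exists n, ball x r (e n)).

(** Codes two dense states and one dense parameter. The Lipschitz constant is then a countable
    supremum, measurable in the random map, and [lip_constP] shows that it still bounds all states
    and all parameters of [V]. Equal states give the ratio 0. *)
Definition lip_index (n : nat) : nat * nat * nat := odflt (0, 0, 0)%N (unpickle n).

Definition lip_ratio (k : block -> U -> block) (n : nat) : R :=
  let: (i, j, l) := lip_index n in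
  dE (k (q i) (e l)) (k (q j) (e l)) / dE (q i) (q j).

Definition lip_const k : R := sup (range (lip_ratio k)).

Lemma lip_ratio_le k L : 0 <= L ->
  (forall th x y, V th -> E x -> E y -> dE (k x th) (k y th) <= L * dE x y) ->
  forall n, lip_ratio k n <= L.
Proof.
move=> L0 kL n; rewrite /lip_ratio; case: lip_index => -[i j] l.
have [->|ij] := pselect (q i = q j); first by rewrite !prod_distxx// mul0r.
by rewrite ler_pdivrMr ?prod_dist_gt0// kL.
Qed.

Lemma lip_ubound k : good_map k -> has_ubound (range (lip_ratio k)).
Proof.
move=> /good_lip[L L0 kL]; exists L => _ [n _ <-].
by apply: lip_ratio_le => // th x y /VT; exact: kL.
Qed.

Lemma lip_const_le k L : 0 <= L ->
  (forall th x y, V th -> E x -> E y -> dE (k x th) (k y th) <= L * dE x y) ->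
  lip_const k <= L.
Proof.
move=> L0 kL; apply: ge_sup; first by exists (lip_ratio k 0), 0%N.
by move=> _ [n _ <-]; exact: lip_ratio_le.
Qed.

Lemma lip_ratio_ge0 k n : 0 <= lip_ratio k n.
Proof.
by rewrite /lip_ratio; case: lip_index => -[i j] l; rewrite divr_ge0// prod_dist_ge0.
Qed.

Lemma lip_const_ge0 k : good_map k -> 0 <= lip_const k.
Proof.
move=> gk; apply: le_trans (lip_ratio_ge0 k 0) _.
by apply: ub_le_sup; [exact: lip_ubound|exists 0%N].
Qed.

(** Continuity in the parameter passes from the dense parameters to [th] while both states stay in
    the dense sequence. The passage to arbitrary states then uses the crude constant [L], which only
    multiplies the approximation error and disappears in the limit. *)
Lemma lip_constP k th x y : good_map k -> V th -> E x -> E y ->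
  dE (k x th) (k y th) <= lip_const k * dE x y.
Proof.
move=> gk Vth Ex Ey; have Tth := VT Vth; have [L L0 kL] := good_lip gk.
have c0 := lip_const_ge0 gk.
have step i j : dE (k (q i) th) (k (q j) th) <= lip_const k * dE (q i) (q j).
  apply/ler_addgt0Pr => r r0.
  have r2 : 0 < r / 2 by rewrite divr_gt0.
  have hi := good_cont gk (Eq i) Tth r2; have hj := good_cont gk (Eq j) Tth r2.
  have [r1 r10 hO] : exists2 r', 0 < r' & forall th', Theta th' -> ball th r' th' ->
      dE (k (q i) th') (k (q i) th) < r / 2 /\ dE (k (q j) th') (k (q j) th) < r / 2.
    have /nbhs_ballP[r' r'0 hr] : nbhs th [set th' | Theta th' ->
        dE (k (q i) th') (k (q i) th) < r / 2 /\ dE (k (q j) th') (k (q j) th) < r / 2].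
      by apply: filterS2 hi hj.
    by exists r' => // th' Tth' /hr; apply.
  have [l thl] := de Vth r10; have [h1 h2] := hO (e l) (VT (eV l)) thl.
  have : lip_ratio k (pickle (i, j, l)) <= lip_const k.
    by apply: ub_le_sup; [exact: lip_ubound|exists (pickle (i, j, l))].
  rewrite /lip_ratio /lip_index pickleK /=.
  have := prod_dist_triangle4 mN (k (q i) th) (k (q j) th) (k (q i) (e l)) (k (q j) (e l)).
  move=> h3; rewrite prod_distC in h1; rewrite prod_distC in h2.
  have [ij|ij] := pselect (q i = q j).
    by rewrite ij !prod_distxx// mulr0 add0r => _; exact: ltW.
  rewrite ler_pdivrMr ?prod_dist_gt0//; lra.
apply/ler_addgt0Pr => r r0.
(* Replacing each of the two states by a dense one costs [L] on the images and [lip_const k] on the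
   arguments. *)
pose r' := r / (2 * L + 2 * lip_const k + 1).
have dn0 : 0 < 2 * L + 2 * lip_const k + 1 by rewrite ltr_wpDl// addr_ge0// mulr_ge0.
have r'0 : 0 < r' by rewrite divr_gt0.
have r'E : r' * (2 * L + 2 * lip_const k + 1) = r by rewrite divfK// gt_eqF.
have [i xi] := dq Ex r'0; have [j yj] := dq Ey r'0.
have := prod_dist_triangle4 mN (k x th) (k y th) (k (q i) th) (k (q j) th).
have := kL _ _ _ Tth Ex (Eq i); have := kL _ _ _ Tth Ey (Eq j); have := step i j.
have := prod_dist_triangle4 mN (q i) (q j) x y.
rewrite [dE (q i) x]prod_distC [dE (q j) y]prod_distC.
move: xi yj; set a := dE x _; set b := dE y _; set c := dE x y => xi yj.
have := prod_dist_ge0 mN x (q i); have := prod_dist_ge0 mN y (q j); rewrite -/a -/b.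
nra.
Qed.

End lipschitz_constant.

Section random_maps.
Context d (T : measurableType d).
Local Notation meas f := (measurable_fun [set: T] f).

Definition block_meas (f : T -> block) := forall n, meas (fun w => dE (f w) (q n)).

Lemma meas_dist (f g : T -> block) : (forall w, E (f w)) -> (forall w, E (g w)) ->
  block_meas f -> block_meas g -> meas (fun w => dE (f w) (g w)).
Proof.
move=> Ef Eg mf mg.
apply: (@measurable_lipschitz_comp _ _ _ _ dE E q f (fun w x => dE x (g w)) (fun=> 1)) => //.
- exact: prod_distC.
- by move=> n; under eq_fun do rewrite prod_distC; exact: mg.
- by move=> w x y Ex Ey; rewrite mul1r addrC; exact: prod_dist_triangle.
Qed.

Variables (k : T -> block -> U -> block).
Hypothesis gk : forall w, good_map (k w).
Hypothesis mk : forall y th, E y -> Theta th -> block_meas (fun w => k w y th).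

Lemma meas_lip_const (V : set U) (e : nat -> U) :
  V `<=` Theta -> (forall n, V (e n)) -> meas (fun w => lip_const e (k w)).
Proof.
move=> VT eV; apply: measurable_sup_seq; last by move=> w; exact: (lip_ubound VT eV).
move=> n; rewrite /lip_ratio; case: lip_index => -[i j] l.
apply: measurable_funM => //; have Tel := VT _ (eV l).
apply: meas_dist; try exact: mk.
  by move=> w; exact: good_stable.
by move=> w; exact: good_stable.
Qed.

Lemma meas_comp (f : T -> block) (e : nat -> U) th : Theta th -> (forall n, e n = th) ->
  (forall w, E (f w)) -> block_meas f -> block_meas (fun w => k w (f w) th).
Proof.
move=> Tth eth Ef mf n.
have sT : [set th] `<=` Theta by move=> _ ->.
have es m : [set th] (e m) by exact: eth.
have de x (r : R) : [set th] x -> 0 < r -> exists m, ball x r (e m).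
  by move=> -> r0; exists 0%N; rewrite eth; exact: ballxx.
apply: (@measurable_lipschitz_comp _ _ _ _ dE E q f (fun w x => dE (k w x th) (q n))
  (fun w => lip_const e (k w))) => //.
- exact: prod_distC.
- by move=> m; exact: mk.
- exact: meas_lip_const es.
- by move=> w; exact: (lip_const_ge0 sT es).
- move=> w x y Ex Ey; rewrite addrC; apply: le_trans (prod_dist_triangle mN _ (k w y th) _) _.
  by rewrite lerD2r; apply: (lip_constP sT es de).
Qed.

End random_maps.

Section iterates.

Fixpoint iter_maps (u : int -> block -> U -> block) (r : nat) (t : int) (y : block) (th : U) :=
  if r is r'.+1 then u t (iter_maps u r' (t - 1) y th) th else y.

Definition good_path (u : int -> block -> U -> block) := forall t, good_map (u t).

Lemma good_path_shift (s : int) u : good_path u -> good_path (fun t => u (t + s)).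
Proof. by move=> gu t; exact: gu. Qed.

Lemma good_iter u r t : good_path u -> good_map (iter_maps u r t).
Proof.
move=> gu; elim: r t => [|r ih] t; first exact: good_id.
exact: good_comp (ih _) (gu t).
Qed.

Lemma iter_mapsD u k l t y th :
  iter_maps u (k + l) t y th = iter_maps u k t (iter_maps u l (t - k%:Z) y th) th.
Proof.
elim: k t => [|k ih] t; first by rewrite subr0.
by rewrite addSn /= ih intS opprD addrA.
Qed.

Lemma iter_maps_shift u r t s y th :
  iter_maps (fun t => u (t + s)) r t y th = iter_maps u r (t + s) y th.
Proof. by elim: r t => //= r ih t; rewrite ih addrAC. Qed.

Lemma iter_mapsS u r t y th : iter_maps u r.+1 t y th = u t (iter_maps u r (t - 1) y th) th.
Proof. by []. Qed.

Context d (T : measurableType d).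
Variables (u : int -> T -> block -> U -> block) (t0 : int).
Hypothesis gu : forall w, good_path (fun t => u t w).
Hypothesis mu : forall t y th, t <= t0 -> E y -> Theta th ->
  block_meas (fun w => u t w y th).

Lemma meas_iter r t y th : t <= t0 -> E y -> Theta th ->
  block_meas (fun w => iter_maps (fun t => u t w) r t y th).
Proof.
move=> tt0 Ey Tth; elim: r t tt0 => [|r ih] t tt0 /=; first by move=> n; exact: measurable_cst.
apply: (@meas_comp _ _ (fun w => u t w) (fun w => gu w t) _
  (fun w => iter_maps (fun t => u t w) r (t - 1) y th) (fun=> th)) => //.
- by move=> y' th' Ey' Tth'; exact: mu.
- by move=> w; apply: (good_stable (good_iter r (t - 1) (gu w))).
- by apply: ih; rewrite (le_trans _ tt0)// gerDl.
Qed.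

End iterates.
End good_maps.

(** * Contraction along windows of a path *)

Lemma eventually_le_cst (R : realType) (s t : nat -> R) :
  (\forall n \near \oo, s n <= t n) -> exists2 m, 0 <= m & forall n, s n <= t n + m.
Proof.
move=> [n0 _ h]; exists (\sum_(k < n0) `|s k - t k|); first by rewrite sumr_ge0.
move=> n; have [nn|nn] := leqP n0 n.
  by rewrite (le_trans (h n nn))// lerDl sumr_ge0.
rewrite -lerBlDl (bigD1 (Ordinal nn))//= (le_trans (ler_norm _))// lerDl sumr_ge0//.
Qed.

Lemma prodr_const_ord (R : comNzRingType) (r : nat) (a : R) : \prod_(j < r) a = a ^+ r.
Proof. by rewrite prodr_const card_ord. Qed.

(* The geometric mean of d over a window of length r is contracted by b^(1/r) at each step,
   and it bounds d at the good times; bad times are skipped r steps at a time. *)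
Lemma contraction_rate (R : realType) (r : nat) (b : nat -> R) (bad : nat -> bool) (K c : R) :
  (0 < r)%N -> 1 <= K -> 0 < c -> (forall k, 0 < b k) ->
  (\forall n \near \oo, \sum_(k < n) ln (b k) <= - (2 * c * r%:R) * n%:R) ->
  (\forall n \near \oo,
     \sum_(k < n) (bad k)%:R * (Num.max 0 (ln (b k)) + c * r%:R) <= c / 2 * n%:R) ->
  exists2 C, 0 <= C & forall (d : nat -> R) (D0 : R), (forall k, 0 <= d k) ->
    (forall k, d (k + r)%N <= b k * d k) ->
    (forall k, ~~ bad k -> forall i, (i < r)%N -> d (k + r - i)%N <= K * d (k + r - i.+1)%N) ->
    (forall i, (i < r)%N -> d i <= D0) ->
    forall k, d k <= C * D0 * expR (- (c / 2) * k%:R).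
Proof.
move=> r0 K1 c0 b0 /eventually_le_cst[m0 m00 hm] /eventually_le_cst[m2 m20 hw].
have rR : 0 < r%:R :> R by rewrite ltr0n.
pose m := m0 / r%:R; have mE : m0 = r%:R * m by rewrite /m mulrC divfK// gt_eqF.
have m_ge0 : 0 <= m by rewrite divr_ge0// ltW.
pose G := K ^+ r * expR (m + 2 * c * r%:R).
have Kr : 1 <= K ^+ r by exact: exprn_ege1.
have G0 : 0 <= G by rewrite mulr_ge0 ?expR_ge0// (le_trans _ Kr).
exists (G * expR m2); first by rewrite mulr_ge0// expR_ge0.
move=> d D0 d0 db dg di.
have D00 : 0 <= D0 by apply: le_trans (d0 0%N) (di _ r0).
(* Jumping over [r] steps at a bad time costs the factor [b k] and forgoes the gain
   [expR (- c * r)]. The weight records both in the exponent. *)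
pose w k := (bad k)%:R * (Num.max 0 (ln (b k)) + c * r%:R).
have w0 k : 0 <= w k.
  by rewrite mulr_ge0// addr_ge0 ?le_max ?lexx// mulr_ge0// ltW.
pose Pr k := \prod_(j < r) d (k + j)%N.
have Pr_step k : Pr k.+1 <= b k * Pr k.
  rewrite /Pr; case: r r0 db {rR mE G Kr G0 dg di hm hw m m_ge0 w w0 Pr} => // r _ db.
  rewrite big_ord_recr [in leRHS]big_ord_recl /= addn0 mulrA mulrC.
  apply: ler_pM => //; first by rewrite prodr_ge0.
    by rewrite addSnnS; exact: db.
  by rewrite le_eqVlt; apply/orP; left; apply/eqP; apply: eq_bigr => i _; rewrite /bump /= addnA addn1.
have Pr_le k : Pr k <= (D0 * expR (m - 2 * c * k%:R)) ^+ r.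
  have h : Pr k <= D0 ^+ r * expR (\sum_(i < k) ln (b i)).
    elim: k => [|k ih].
      rewrite big_ord0 expR0 mulr1 /Pr -prodr_const_ord.
      by apply: ler_prod => j _; rewrite d0 add0n di.
    rewrite big_ord_recr /= expRD lnK ?posrE// mulrA mulrC.
    by apply: le_trans (Pr_step k) _; rewrite ler_wpM2l// ltW.
  apply: le_trans h _; rewrite exprMn ler_wpM2l ?exprn_ge0//.
  rewrite -expRM_natl ler_expR (le_trans (hm k))// mE.
  by rewrite le_eqVlt; apply/orP; left; apply/eqP; ring.
(* After a good time, [d (k + r)] is at most [K ^+ r] times every term of the window that ends
   there, hence at most that factor times their geometric mean. *)
have d_good k : ~~ bad k -> d (k + r)%N <= G * D0 * expR (- c * (k + r)%:R).
  move=> gk.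
  have dj j : (j < r)%N -> d (k + r)%N <= K ^+ j * d (k + r - j)%N.
    elim: j => [|j ih] jr; first by rewrite expr0 mul1r subn0.
    apply: le_trans (ih (ltnW jr)) _; rewrite exprSr -mulrA ler_wpM2l ?exprn_ge0//.
      by rewrite (le_trans _ K1).
    by apply: dg => //; exact: ltnW.
  have dr : d (k + r)%N ^+ r <= (K ^+ r) ^+ r * Pr k.+1.
    rewrite -(prodr_const_ord r (d _)) -(prodr_const_ord r (K ^+ r)) /Pr -big_split /=.
    apply: ler_prod => j _; rewrite d0 /=.
    have jr : (r.-1 - j < r)%N by rewrite (leq_ltn_trans (leq_subr _ _))// prednK.
    apply: le_trans (dj _ jr) _; apply: ler_pM => //.
    - by rewrite exprn_ge0// (le_trans _ K1).
    - by rewrite ler_weXn2l// ltnW.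
    - rewrite (_ : (k + r - (r.-1 - j))%N = (k.+1 + j)%N)//.
      by move: (ltn_ord j) {jr}; move: (nat_of_ord j) => j'; clear -r0; lia.
  have : d (k + r)%N <= K ^+ r * (D0 * expR (m - 2 * c * k.+1%:R)).
    rewrite -(@ler_pXn2r _ r)//; last 2 first.
    - by rewrite nnegrE.
    - by rewrite nnegrE !mulr_ge0 ?expR_ge0// (le_trans _ Kr).
    apply: le_trans dr _; rewrite exprMn; apply: ler_wpM2l; last exact: Pr_le.
    by rewrite exprn_ge0// (le_trans _ Kr).
  move=> /le_trans; apply.
  rewrite /G -!mulrA; apply: ler_wpM2l; first by rewrite (le_trans _ Kr).
  rewrite [leRHS]mulrCA; apply: ler_wpM2l => //.
  rewrite -expRD ler_expR natrD -natr1; have := ler0n R k; nra.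
(* The sum stops at [n.+1 - r] so that for [n = k + r] it contains the weight of [k]. If [k] is bad,
   the induction hypothesis is used at [k]; if it is good, the bound restarts from the window. *)
have key n : d n <= G * D0 * expR (- c * n%:R + \sum_(i < n.+1 - r) w i).
  elim/ltn_ind: n => n ih; have [nr|nr] := ltnP n r.
    rewrite (_ : (n.+1 - r)%N = 0%N); last by apply/eqP; rewrite subn_eq0.
    rewrite big_ord0 addr0; apply: le_trans (di _ nr) _.
    rewrite -mulrA mulrCA -[leLHS]mulr1; apply: ler_wpM2l => //.
    rewrite /G -[leRHS]mulrA -expRD -[leLHS]mulr1; apply: ler_pM => //.
    rewrite -[leLHS]expR0 ler_expR; have : n%:R <= r%:R :> R by rewrite ler_nat ltnW.
    nra.
  have [k nE] : exists k, n = (k + r)%N by exists (n - r)%N; rewrite subnK.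
  have -> : (n.+1 - r)%N = k.+1 by rewrite nE -addSn addnK.
  rewrite nE; have [bk|gk] := boolP (bad k).
    apply: le_trans (db k) _; have kn : (k < n)%N by rewrite nE -[ltnLHS]addn0 ltn_add2l.
    apply: (@le_trans _ _ (b k * (G * D0 * expR (- c * k%:R + \sum_(i < k.+1 - r) w i)))).
      by apply: ler_wpM2l; [exact: ltW|exact: ih].
    rewrite mulrCA; apply: ler_wpM2l; first exact: mulr_ge0.
    have wk : w k = Num.max 0 (ln (b k)) + c * r%:R by rewrite /w bk mul1r.
    rewrite -{1}[b k]lnK ?posrE// -expRD ler_expR big_ord_recr /= wk natrD.
    have : \sum_(i < k.+1 - r) w i <= \sum_(i < k) w i.
      rewrite -!(big_mkord xpredT w) [leRHS](@big_cat_nat _ _ _ (k.+1 - r)%N)//=.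
        by rewrite lerDl sumr_ge0.
      by rewrite leq_subLR -add1n leq_add2r.
    have : ln (b k) <= Num.max 0 (ln (b k)) by rewrite le_max lexx orbT.
    lra.
  apply: le_trans (d_good _ gk) _; apply: ler_wpM2l; first exact: mulr_ge0.
  by rewrite ler_expR lerDl sumr_ge0.
move=> n; apply: le_trans (key n) _.
have -> : G * expR m2 * D0 * expR (- (c / 2) * n%:R) = G * D0 * expR (m2 + - (c / 2) * n%:R).
  by rewrite expRD; ring.
apply: ler_wpM2l; first exact: mulr_ge0.
rewrite ler_expR.
have := hw (n.+1 - r)%N; rewrite -/w.
have : (n.+1 - r)%:R <= n%:R :> R by rewrite ler_nat leq_subLR -add1n leq_add2r.
nra.
Qed.

(** * Almost sure contraction of random maps *)

Lemma time_shift_sub (s : int) (r k : nat) : s + (r + k)%N%:Z - r%:Z = s + k%:Z.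
Proof. lia. Qed.

Lemma time_window_fwd (s : int) (k r i : nat) : (i < r)%N ->
  `|s + (1 + (k + r - i.+1))%N%:Z - (s + r%:Z + k%:Z)| <= r%:Z.
Proof. lia. Qed.

Lemma time_window_bwd (s : int) (k r i : nat) : (i < r)%N ->
  `|s - (k + r - i.+1)%N%:Z - (s - k%:Z)| <= r%:Z.
Proof. lia. Qed.

Lemma sub_succ_add (k r i : nat) : (i < r)%N -> (k + r - i)%N = (1 + (k + r - i.+1))%N.
Proof. lia. Qed.

Lemma ae_forall_seq d (T : measurableType d) (R : realType) (P : probability T R)
    (I : eqType) (s : seq I) (Q : I -> T -> Prop) :
  (forall i, i \in s -> {ae P, forall w, Q i w}) ->
  {ae P, forall w, forall i, i \in s -> Q i w}.
Proof.
elim: s => [|i s ih] h; first exact: aeW.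
have hi := h i (mem_head _ _).
have {}ih := ih (fun j js => h j (mem_behead (s := i :: s) js)).
by apply: filterS2 hi ih => w Qi Qs j; rewrite inE => /predU1P[->|/Qs].
Qed.

Section contracting_paths.
Context (R : realType) (p : nat) (F : metricType R) (N : 'rV[R]_p -> R).
Local Notation dE := (@prod_dist R p F N).
Local Notation block := ('I_p -> F).
Context (E : set block) (U : pseudoMetricType R) (Theta : set U) (y0 : block).

(** The constants may depend on the path and on [s], but not on the parameter nor on the number of
    steps. The first bound fixes the starting time and serves to compare [ghat] with the limit; the
    other two fix the final time and give existence and uniqueness of the limit. *)
Definition contracting_path (u : int -> block -> U -> block) := forall s : int,
  exists C c, [/\ 0 <= C, 0 < c,
    (forall th x y k, Theta th -> E x -> E y ->
      dE (iter_maps u k (s + k%:Z) x th) (iter_maps u k (s + k%:Z) y th) <=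
        C * expR (- c * k%:R) * dE x y),
    (forall th x y k, Theta th -> E x -> E y ->
      dE (iter_maps u k s x th) (iter_maps u k s y th) <=
        C * expR (- c * k%:R) * dE x y) &
    (forall th k, Theta th ->
      dE (iter_maps u k s y0 th) (iter_maps u k.+1 s y0 th) <= C * expR (- c * k%:R))].

Lemma contracting_path_shift v u : contracting_path u ->
  contracting_path (fun t => u (t + v)).
Proof.
move=> cu s; have [C [c [C0 c0 h1 h2 h3]]] := cu (s + v); exists C, c; split=> //.
- by move=> th x y k Tth Ex Ey; rewrite !iter_maps_shift addrAC; exact: h1.
- by move=> th x y k Tth Ex Ey; rewrite !iter_maps_shift; exact: h2.
- by move=> th k Tth; rewrite !iter_maps_shift; exact: h3.
Qed.

End contracting_paths.

Section random_contraction.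
Context d (T : measurableType d) (R : realType) (P : probability T R).
Context (p : nat) (F : metricType R) (N : 'rV[R]_p -> R).
Hypothesis mN : monotone_norm N.
Local Notation dE := (@prod_dist R p F N).
Local Notation block := ('I_p -> F).
Variables (E : set block) (q : nat -> block).
Hypotheses (Eq : forall n, E (q n))
  (dq : forall x e, E x -> 0 < e -> exists n, dE x (q n) < e).
Variables (U : pseudoMetricType R) (Theta : set U) (eT : nat -> U).
Hypotheses (eTT : forall n, Theta (eT n))
  (dT : forall x (r : R), Theta x -> 0 < r -> exists n, ball x r (eT n)).
Local Notation maps := (block -> U -> block).
Variables (SS : set_system maps) (phi phi' : int -> T -> maps) (Good : set (int -> maps)).
Hypothesis SS_dist : forall y th n c, E y -> Theta th ->
  exists2 A, SS A & forall k, good_map N E Theta k -> (A k <-> dE (k y th) (q n) < c).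
Hypothesis Good_shift : forall (s : int) u, Good u -> Good (fun t => u (t + s)).
Hypothesis Good_path : forall u, Good u -> good_path N E Theta u.
Hypothesis phi_stat : stationary P SS phi.
Hypothesis phi_erg : ergodic P SS phi.
Hypothesis phi'good : forall w, Good (phi' ^~ w).
Hypothesis phi'meas : forall t B, SS B -> measurable (phi' t @^-1` B).
Hypothesis phi'ae : {ae P, forall w, forall t, phi' t w = phi t w}.

Let pt : {u | Good u} := exist _ (phi' ^~ point) (phi'good point).
Local Notation Om := (path_space SS pt).
Local Notation Phi := (process_path SS phi'good).
Local Notation shift := (@path_shift _ SS _ pt Good_shift).
Local Notation meas f := (measurable_fun [set: Om] f).
Local Notation integr f := (P.-integrable setT (EFin \o f)).
Local Notation Ex f := (Rintegral P setT f).

Lemma path_good (u : Om) : good_path N E Theta (sval u).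
Proof. exact: Good_path (svalP u). Qed.

Lemma path_block_meas t y th : E y -> Theta th ->
  block_meas N q (fun u : Om => sval u t y th).
Proof.
move=> Ey Tth n; apply: measurable_of_lt => c.
have [A SA Ak] := SS_dist n c Ey Tth.
rewrite (_ : [set _ | _] = [set u : Om | A (sval u t)]); first exact: measurable_coordinate.
by apply/seteqP; split => u /= /(Ak _ (path_good u t)).
Qed.

Lemma path_iter_meas r t y th : E y -> Theta th ->
  block_meas N q (fun u : Om => iter_maps (sval u) r t y th).
Proof.
move=> Ey Tth; apply: (@meas_iter _ _ _ _ mN E q Eq dq U Theta _ _ (fun t (u : Om) => sval u t) t) => //.
- exact: path_good.
- by move=> t' y' th' _; exact: path_block_meas.
Qed.

Lemma path_lip_meas e r t : (forall n, Theta (e n)) ->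
  meas (fun u : Om => lip_const N q e (iter_maps (sval u) r t)).
Proof.
move=> eT'; apply: (@meas_lip_const _ _ _ _ mN E q Eq dq U Theta _ _
  (fun u : Om => iter_maps (sval u) r t) _ _ Theta) => //.
- by move=> u; apply: good_iter => //; exact: path_good.
- by move=> y th Ey Tth; exact: path_iter_meas.
Qed.

Section local_contraction.
Variables (r : nat) (V : set U) (e : nat -> U) (delta : R).
Hypotheses (r0 : (0 < r)%N) (VT : V `<=` Theta) (eV : forall n, V (e n))
  (de : forall x (r : R), V x -> 0 < r -> exists n, ball x r (e n)) (delta0 : 0 < delta).

(* The bounds Lam are stationary but not assumed ergodic; the ergodic theorem is applied to the
   optimal Lipschitz constant, which is a function of the ergodic maps. *)
Definition path_lip (u : Om) : R := Num.max (lip_const N q e (iter_maps (sval u) r 0)) delta.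

Hypothesis lip_integr : integr (fun w => ln (path_lip (Phi w))).
Hypothesis lip_neg : Ex (fun w => ln (path_lip (Phi w))) < 0.

Let B := path_lip.

Lemma path_lip_gt0 u : 0 < B u.
Proof. by rewrite /B /path_lip lt_max delta0 orbT. Qed.

Lemma meas_ln_path_lip : meas (fun u => ln (B u)).
Proof.
apply: measurableT_comp; first exact: measurable_ln.
apply: measurable_maxr; last exact: measurable_cst.
by apply: path_lip_meas => n; exact: VT.
Qed.

(** One variable bounds the one-step constants at all times within distance [r], before and after,
    so the same event serves the forward and the backward windows. *)
Definition step_lip (u : Om) : R :=
  \sum_(i < (2 * r).+1) lip_const N q eT (sval u (i%:Z - r%:Z)).

Let lipT_ge0 (u : Om) t : 0 <= lip_const N q eT (sval u t).
Proof. exact: (lip_const_ge0 mN Eq (fun _ h => h) eTT (path_good u t)). Qed.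

Lemma step_lipP (u : Om) (t : int) : `|t| <= r%:Z -> lip_const N q eT (sval u t) <= step_lip u.
Proof.
move=> tr; have [i [ir iE]] : exists i : nat, (i < (2 * r).+1)%N /\ t = i%:Z - r%:Z.
  by exists (absz (t + r%:Z)); lia.
rewrite /step_lip (bigD1 (Ordinal ir))//= -iE lerDl; exact: sumr_ge0.
Qed.

Lemma meas_step_lip : meas step_lip.
Proof.
apply: measurable_sum => i.
have := @path_lip_meas eT 1 (i%:Z - r%:Z) eTT; exact.
Qed.

(** The logarithmic moment concerns the [r]-fold composition; the one-step constants are only known
    to be finite. They are large on a rare event when [K] is large, and the weight on it is
    integrable because it involves [B] alone. *)
Definition bad_weight (K c : R) (u : Om) : R :=
  ((K < step_lip u)%R : nat)%:R * (Num.max 0 (ln (B u)) + c * r%:R).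

Lemma meas_bad_weight K c : meas (bad_weight K c).
Proof.
apply: measurable_funM.
  rewrite (_ : (fun u => _) = \1_[set u : Om | K < step_lip u]).
    by apply: measurable_indic; apply: measurable_lt_set => //; exact: meas_step_lip.
  apply/funext => u; rewrite indicE; congr ((nat_of_bool _)%:R).
  by apply/idP/idP; rewrite inE.
apply: measurable_funD => //; apply: measurable_maxr => //; exact: meas_ln_path_lip.
Qed.

Lemma bad_weight_small c e' : 0 < c -> 0 < e' -> exists2 K, 1 <= K &
  integr (bad_weight K c \o Phi) /\ Ex (bad_weight K c \o Phi) < e'.
Proof.
move=> c0 e0; pose g w := Num.max 0 (ln (B (Phi w))) + c * r%:R.
have mPhi : measurable_fun setT Phi by exact: measurable_process_path.
have gi : integr g.
  apply: integrD; last exact: integr_cst.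
  by apply: integr_max => //; exact: integr_cst.
have g0 w : 0 <= g w by rewrite addr_ge0 ?le_max ?lexx// mulr_ge0// ltW.
have bg K w : `|(bad_weight K c \o Phi) w| <= g w.
  rewrite /= /bad_weight -/(g w) normrM (ger0_norm (g0 w)) ler_piMl//.
  by case: ltP; rewrite ?normr1 ?normr0.
have mb K : measurable_fun setT (bad_weight K c \o Phi).
  by apply: measurableT_comp => //; exact: meas_bad_weight.
have cv : Ex (bad_weight n.+1%:R c \o Phi) @[n --> \oo] --> Ex (fun=> 0 : R).
  apply: (@Ex_dominated _ _ _ P _ _ g) => //.
  apply: aeW => w; apply: cvg_near_cst; near=> n.
  rewrite /= /bad_weight ltNge (_ : _ <= _) ?mul0r//.
  rewrite (le_trans (ltW (truncnS_gt _)))// ler_nat ltnS.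
  by near: n; exists (Num.truncn (step_lip (Phi w))).
move: cv; rewrite Ex_cst => /cvgr_lt/(_ e' e0)[n _ /(_ n (leqnn n))/= h].
exists n.+1%:R; first by rewrite ler1n.
by split=> //; exact: integr_le (mb _) (bg _) gi.
Unshelve. all: by end_near. Qed.

Let lipV_ge0 (u : Om) k t : 0 <= lip_const N q e (iter_maps (sval u) k t).
Proof.
apply: (lip_const_ge0 mN Eq VT eV).
by apply: good_iter => //; exact: path_good.
Qed.

Let lipVP (u : Om) k t th x y : V th -> E x -> E y ->
  dE (iter_maps (sval u) k t x th) (iter_maps (sval u) k t y th) <=
  lip_const N q e (iter_maps (sval u) k t) * dE x y.
Proof.
move=> Vth Exx Eyy; apply: (lip_constP mN Eq dq VT) => //.
by apply: good_iter => //; exact: path_good.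
Qed.

Lemma lip_iterD (u : Om) k l t :
  lip_const N q e (iter_maps (sval u) (k + l) t) <=
  lip_const N q e (iter_maps (sval u) k t) * lip_const N q e (iter_maps (sval u) l (t - k%:Z)).
Proof.
apply: (lip_const_le mN Eq eV) => //; first exact: mulr_ge0.
move=> th x y Vth Exx Eyy; rewrite !iter_mapsD.
have gl := good_iter mN l (t - k%:Z) (path_good u).
apply: le_trans (lipVP _ _ _ Vth _ _) _; try exact: (good_stable gl) (VT Vth).
by rewrite -mulrA; apply: ler_wpM2l => //; exact: lipVP.
Qed.

Lemma lip_step_le (u : Om) t : lip_const N q e (iter_maps (sval u) 1 t) <= lip_const N q eT (sval u t).
Proof.
apply: (lip_const_le mN Eq eV) => //.
move=> th x y /VT Tth Exx Eyy /=.
exact: (@lip_constP _ _ _ _ mN E q Eq dq _ Theta Theta eT (fun _ h => h) eTT dT _ _ _ _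
  (path_good u t)).
Qed.

Lemma lip_iter_shift (u : Om) k s t :
  iter_maps (sval (shift s u)) k t = iter_maps (sval u) k (t + s).
Proof. by apply/funext => y; apply/funext => th; rewrite iter_maps_shift. Qed.

Lemma local_contraction : {ae P, forall w, forall s, exists C c, [/\ 0 <= C, 0 < c,
  (forall th x y k, V th -> E x -> E y ->
    dE (iter_maps (phi' ^~ w) k (s + k%:Z) x th) (iter_maps (phi' ^~ w) k (s + k%:Z) y th) <=
      C * expR (- c * k%:R) * dE x y) &
  (forall th x y k, V th -> E x -> E y ->
    dE (iter_maps (phi' ^~ w) k s x th) (iter_maps (phi' ^~ w) k s y th) <=
      C * expR (- c * k%:R) * dE x y)]}.
Proof.
pose a := Ex (fun w => ln (B (Phi w))).
have rR : 0 < r%:R :> R by rewrite ltr0n.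
(* With this choice the rate [- 2 c r = a / 2] requested by [contraction_rate] lies strictly above
   the mean [a]. *)
pose c := - a / (4 * r%:R).
have c0 : 0 < c by rewrite divr_gt0 ?mulr_gt0// oppr_gt0.
have ac : a < - (2 * c * r%:R).
  have -> : - (2 * c * r%:R) = a / 2 by rewrite /c; field; rewrite gt_eqF.
  by move: lip_neg; rewrite -/a => h; lra.
have c20 : 0 < c / 2 by rewrite divr_gt0.
have [K K1 [bi bl]] := bad_weight_small c0 c20.
have hf := process_upper Good_shift phi_stat phi_erg phi'meas phi'ae meas_ln_path_lip lip_integr ac.
have hb := process_upperN Good_shift phi_stat phi_erg phi'meas phi'ae meas_ln_path_lip lip_integr ac.
have wf := process_upper Good_shift phi_stat phi_erg phi'meas phi'ae (meas_bad_weight K c) bi bl.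
have wb := process_upperN Good_shift phi_stat phi_erg phi'meas phi'ae (meas_bad_weight K c) bi bl.
apply: filterS2 (filterI hf hb) (filterI wf wb) => w [{}hf {}hb] [{}wf {}wb] s.
set u := Phi w in hf hb wf wb.
have Bge v : lip_const N q e (iter_maps (sval u) r v) <= B (shift v u).
  by rewrite /B /path_lip lip_iter_shift add0r le_max lexx.
have step_good v t : step_lip (shift v u) <= K -> `|t - v| <= r%:Z ->
    lip_const N q e (iter_maps (sval u) 1 t) <= K.
  move=> sK tv; apply: le_trans (lip_step_le u t) _; apply: le_trans sK.
  by have := step_lipP (shift v u) tv; rewrite /= subrK.
(* Forward, the new block of [r] maps is applied last and ends at [s + r + k]; backward, it is
   applied first and ends at [s - k]. This explains the shifts at which [B] is evaluated. *)
pose df k := lip_const N q e (iter_maps (sval u) k (s + k%:Z)).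
pose db k := lip_const N q e (iter_maps (sval u) k s).
have [Cf Cf0 hCf] := @contraction_rate R r (fun k => B (shift (s + r%:Z + k%:Z) u))
  (fun k => K < step_lip (shift (s + r%:Z + k%:Z) u)) K c r0 K1 c0
  (fun k => path_lip_gt0 _) (hf (s + r%:Z)) (wf (s + r%:Z)).
have [Cb Cb0 hCb] := @contraction_rate R r (fun k => B (shift (s - k%:Z) u))
  (fun k => K < step_lip (shift (s - k%:Z) u)) K c r0 K1 c0
  (fun k => path_lip_gt0 _) (hb s) (wb s).
have initP (dd : nat -> R) : (forall k, 0 <= dd k) -> forall i, (i < r)%N -> dd i <= \sum_(i < r) dd i.
  by move=> d0 i ir; rewrite (bigD1 (Ordinal ir))//= lerDl sumr_ge0.
have df0 k : 0 <= df k by exact: lipV_ge0.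
have db0 k : 0 <= db k by exact: lipV_ge0.
have {hCf} Hf := hCf df _ df0 _ _ (initP _ df0).
have {hCb} Hb := hCb db _ db0 _ _ (initP _ db0).
exists (Cf * (\sum_(i < r) df i) + Cb * (\sum_(i < r) db i)), (c / 2).
have Sf0 : 0 <= Cf * (\sum_(i < r) df i) by rewrite mulr_ge0// sumr_ge0.
have Sb0 : 0 <= Cb * (\sum_(i < r) db i) by rewrite mulr_ge0// sumr_ge0.
split; rewrite ?addr_ge0//.
- move=> th x y k Vth Exx Eyy; apply: le_trans (@lipVP u k _ _ _ _ Vth Exx Eyy) _.
  apply: ler_wpM2r; first exact: prod_dist_ge0.
  apply: le_trans (Hf _ _ k) _.
  + move=> {}k; rewrite /df addnC; apply: le_trans (lip_iterD _ _ _ _) _.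
    rewrite time_shift_sub PoszD addrA.
    by apply: ler_wpM2r => //; exact: Bge.
  + move=> {}k; rewrite -leNgt => gk i ir; rewrite /df (sub_succ_add k ir).
    apply: le_trans (lip_iterD _ _ _ _) _; rewrite time_shift_sub.
    by apply: ler_wpM2r; [exact: lipV_ge0|];
      exact: (step_good _ (s + (1 + (k + r - i.+1))%N%:Z) gk (time_window_fwd s k ir)).
  + by apply: ler_wpM2r; [exact: expR_ge0|rewrite lerDl].
- move=> th x y k Vth Exx Eyy; apply: le_trans (@lipVP u k _ _ _ _ Vth Exx Eyy) _.
  apply: ler_wpM2r; first exact: prod_dist_ge0.
  apply: le_trans (Hb _ _ k) _.
  + move=> {}k; rewrite /db; apply: le_trans (lip_iterD _ _ _ _) _.
    by rewrite mulrC; apply: ler_wpM2r => //; exact: Bge.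
  + move=> {}k; rewrite -leNgt => gk i ir; rewrite /db.
    rewrite (sub_succ_add k ir) addnC.
    apply: le_trans (lip_iterD _ _ _ _) _; rewrite mulrC.
    by apply: ler_wpM2r; [exact: lipV_ge0|];
      exact: (step_good _ (s - (k + r - i.+1)%N%:Z) gk (time_window_bwd s k ir)).
  + by apply: ler_wpM2r; [exact: expR_ge0|rewrite lerDr].
Qed.

End local_contraction.

Section global_contraction.
Variables (r : nat) (y0 : block).
Hypotheses (r0 : (0 < r)%N) (cTheta : compact Theta) (Ey0 : E y0).
Hypothesis local_neg : forall th, Theta th -> exists O e delta,
  [/\ nbhs th O, forall n, (Theta `&` O) (e n),
      forall x (r : R), (Theta `&` O) x -> 0 < r -> exists n, ball x r (e n),
      0 < delta & integr (fun w => ln (path_lip r e delta (Phi w))) /\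
        Ex (fun w => ln (path_lip r e delta (Phi w))) < 0].

Definition path_jump (u : Om) : R := sup (range (fun n => dE (sval u 0 y0 (eT n)) y0)).

Hypothesis jump_bounded : forall (u : Om) t,
  has_ubound (range (fun n => dE (sval u t y0 (eT n)) y0)).
Hypothesis jump_integr : integr (fun w => log_plus (path_jump (Phi w))).

Lemma meas_log_plus : measurable_fun setT (@log_plus R).
Proof. by apply: measurable_maxr => //; exact: measurable_ln. Qed.

Lemma meas_path_jump : meas path_jump.
Proof.
apply: measurable_sup_seq => [n|u]; last exact: jump_bounded.
apply: (meas_dist mN Eq dq) => //.
- by move=> u; apply: (good_stable (path_good u 0)).
- exact: path_block_meas.
Qed.

Lemma log_plusP (x e : R) : 0 <= e -> log_plus x <= e -> x <= expR e.
Proof.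
move=> e0 xe; have [x0|x0] := leP x 0; first by rewrite (le_trans x0)// expR_ge0.
by rewrite -[x]lnK// ler_expR (le_trans _ xe)// le_max lexx orbT.
Qed.

Lemma global_contraction : {ae P, forall w, contracting_path N E Theta y0 (phi' ^~ w)}.
Proof.
have hD0 th : exists D : set U * (nat -> U) * R, Theta th ->
    [/\ nbhs th D.1.1, forall n, (Theta `&` D.1.1) (D.1.2 n),
      forall x (r : R), (Theta `&` D.1.1) x -> 0 < r -> exists n, ball x r (D.1.2 n),
      0 < D.2 & integr (fun w => ln (path_lip r D.1.2 D.2 (Phi w))) /\
        Ex (fun w => ln (path_lip r D.1.2 D.2 (Phi w))) < 0].
  have [Tth|nT] := pselect (Theta th); last by exists (setT, eT, 0) => /nT.
  by have [W [e [de hO]]] := local_neg Tth; exists (W, e, de).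
have [D hD] := boolp.choice hD0.
have nD th : Theta th -> nbhs th (D th).1.1 by move=> /hD[].
have [sc scT cov] := compact_finite_cover cTheta nD.
pose Q c w := forall s, exists C c', [/\ 0 <= C, 0 < c',
  (forall th x y k, (Theta `&` (D c).1.1) th -> E x -> E y ->
    dE (iter_maps (phi' ^~ w) k (s + k%:Z) x th) (iter_maps (phi' ^~ w) k (s + k%:Z) y th) <=
      C * expR (- c' * k%:R) * dE x y) &
  (forall th x y k, (Theta `&` (D c).1.1) th -> E x -> E y ->
    dE (iter_maps (phi' ^~ w) k s x th) (iter_maps (phi' ^~ w) k s y th) <=
      C * expR (- c' * k%:R) * dE x y)].
have aeQ : {ae P, forall w, forall c, c \in sc -> Q c w}.
  apply: ae_forall_seq => c csc; have [_ De Dd D0 [Di Dn]] := hD c (scT c csc).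
  exact: (local_contraction r0 (@subIsetl _ _ _) De Dd D0 Di Dn).
have mlj : meas (fun u => log_plus (path_jump u)).
  by apply: measurableT_comp; [exact: meas_log_plus|exact: meas_path_jump].
have lj0 u : 0 <= log_plus (path_jump u) by rewrite le_max lexx.
have aej := process_smallN Good_shift phi_stat phi_erg phi'meas phi'ae mlj jump_integr lj0.
apply: filterS2 aeQ aej => w Qw jw s.
have [C [c [C0 c0 hf hb]]] : exists C c, [/\ 0 <= C, 0 < c,
  (forall th x y k, Theta th -> E x -> E y ->
    dE (iter_maps (phi' ^~ w) k (s + k%:Z) x th) (iter_maps (phi' ^~ w) k (s + k%:Z) y th) <=
      C * expR (- c * k%:R) * dE x y) &
  (forall th x y k, Theta th -> E x -> E y ->
    dE (iter_maps (phi' ^~ w) k s x th) (iter_maps (phi' ^~ w) k s y th) <=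
      C * expR (- c * k%:R) * dE x y)].
  suff [C [c [C0 c0 hf hb]]] : exists C c, [/\ 0 <= C, 0 < c,
    (forall d th x y k, d \in sc -> Theta th -> (D d).1.1 th -> E x -> E y ->
      dE (iter_maps (phi' ^~ w) k (s + k%:Z) x th) (iter_maps (phi' ^~ w) k (s + k%:Z) y th) <=
        C * expR (- c * k%:R) * dE x y) &
    (forall d th x y k, d \in sc -> Theta th -> (D d).1.1 th -> E x -> E y ->
      dE (iter_maps (phi' ^~ w) k s x th) (iter_maps (phi' ^~ w) k s y th) <=
        C * expR (- c * k%:R) * dE x y)].
    exists C, c; split=> // th x y k Tth; have [z zsc Dth] := cov th Tth.
      by move=> hx hy; exact: (hf z _ _ _ k zsc Tth Dth hx hy).
    by move=> hx hy; exact: (hb z _ _ _ k zsc Tth Dth hx hy).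
  elim: (sc) Qw => [|z zs ih] Qw; first by exists 0, 1; split.
  have [|C1 [c1 [C10 c10 hf1 hb1]]] := ih; first by move=> c cs; apply: Qw; rewrite inE cs orbT.
  have [C2 [c2 [C20 c20 hf2 hb2]]] := Qw z (mem_head _ _) s.
  have bnd C' c' k a : 0 <= a -> 0 <= C' -> C' <= C1 + C2 -> Num.min c1 c2 <= c' ->
      C' * expR (- c' * k%:R) * a <= (C1 + C2) * expR (- Num.min c1 c2 * k%:R) * a.
    move=> a0 C'0 CC cc; apply: ler_wpM2r => //; apply: ler_pM => //.
    by rewrite ler_expR !mulNr lerN2 ler_wpM2r.
  exists (C1 + C2), (Num.min c1 c2); split; rewrite ?addr_ge0// ?lt_min ?c10//.
    move=> d' th x y k; rewrite inE => /predU1P[->|d'd] Tth Dth hx hy.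
      apply: le_trans (hf2 _ _ _ k (conj Tth Dth) hx hy) _; apply: bnd; rewrite ?prod_dist_ge0//.
        by rewrite lerDr. by rewrite ge_min lexx orbT.
    apply: le_trans (hf1 d' _ _ _ k d'd Tth Dth hx hy) _; apply: bnd; rewrite ?prod_dist_ge0//.
      by rewrite lerDl. by rewrite ge_min lexx.
  move=> d' th x y k; rewrite inE => /predU1P[->|d'd] Tth Dth hx hy.
    apply: le_trans (hb2 _ _ _ k (conj Tth Dth) hx hy) _; apply: bnd; rewrite ?prod_dist_ge0//.
      by rewrite lerDr. by rewrite ge_min lexx orbT.
  apply: le_trans (hb1 d' _ _ _ k d'd Tth Dth hx hy) _; apply: bnd; rewrite ?prod_dist_ge0//.
    by rewrite lerDl. by rewrite ge_min lexx.
(* Half of the rate is given up to absorb the jump at [y0], whose logarithm is [o(k)] along the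
   path. *)
have c20 : 0 < c / 2 by rewrite divr_gt0.
have [m m0 hm] := eventually_le_cst (jw s (c / 2) c20).
exists (C * expR m + C), (c / 2); split=> //.
- by rewrite addr_ge0// mulr_ge0// expR_ge0.
- move=> th x y k Tth hx hy; apply: le_trans (hf _ _ _ k Tth hx hy) _.
  apply: ler_wpM2r; first exact: prod_dist_ge0.
  apply: ler_pM; rewrite ?expR_ge0// ?lerDr ?mulr_ge0 ?expR_ge0//.
  by rewrite ler_expR; have := ler0n R k; nra.
- move=> th x y k Tth hx hy; apply: le_trans (hb _ _ _ k Tth hx hy) _.
  apply: ler_wpM2r; first exact: prod_dist_ge0.
  apply: ler_pM; rewrite ?expR_ge0// ?lerDr ?mulr_ge0 ?expR_ge0//.
  by rewrite ler_expR; have := ler0n R k; nra.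
(* The iterate of length [k + 1] is the iterate of length [k] started from the image of [y0] at time
   [s - k]. Consecutive iterates thus differ by a contracted jump. *)
- move=> th k Tth; rewrite -addn1 iter_mapsD /=.
  have gu := path_good (Phi w) (s - k%:Z).
  have jle : dE y0 (phi' (s - k%:Z) w y0 th) <= expR (c / 2 * k%:R + m).
    have jP := log_plusP _ (hm k).
    have e'0 : 0 <= c / 2 * k%:R + m by rewrite addr_ge0// mulr_ge0// ltW.
    have {}jP := jP e'0; rewrite prod_distC.
    apply/ler_addgt0Pr => e e0.
    have := good_cont gu Ey0 Tth e0.
    move=> /nbhs_ballP[rho rho0 hrho].
    have [n nb] := dT Tth rho0.
    have := hrho _ nb (eTT n); rewrite /= => hd.
    apply: le_trans (prod_dist_triangle mN _ (phi' (s - k%:Z) w y0 (eT n)) _) _.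
    rewrite addrC lerD//; last by rewrite prod_distC ltW.
    apply: le_trans jP; rewrite /path_jump /= add0r.
    apply: ub_le_sup; last by exists n.
    exact: (jump_bounded (Phi w) (s - k%:Z)).
  apply: le_trans (hb th y0 _ k Tth Ey0 _) _; first exact: (good_stable gu).
  apply: (@le_trans _ _ (C * expR (- c * k%:R) * expR (c / 2 * k%:R + m))).
    by apply: ler_wpM2l => //; rewrite mulr_ge0// expR_ge0.
  rewrite -mulrA -expRD mulrDl [leLHS](_ : _ = C * expR m * expR (- (c / 2) * k%:R)).
    by rewrite lerDl mulr_ge0// expR_ge0.
  by rewrite -[RHS]mulrA -expRD; congr (_ * expR _); field.
Qed.

End global_contraction.
End random_contraction.

(** * The limit solution *)

Lemma expR_geometric_cvg0 (R : realType) (c : R) : 0 < c ->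
  expR (- c * n%:R) @[n --> \oo] --> (0 : R).
Proof.
move=> c0; have e1 : `|expR (- c)| < 1 by rewrite ger0_norm ?expR_ge0// expR_lt1 oppr_lt0.
rewrite (_ : (fun n => _) = (fun n => expR (- c) ^+ n)); first exact: cvg_expr.
by apply/funext => n; rewrite -expRM_natl mulrC.
Qed.

(** The bound is asked only for arbitrarily large [n], since tightness will provide it only along a
    random sequence of times. *)
Lemma le_cvg0_eq0 (R : realType) (x : R) (s : nat -> R) : 0 <= x ->
  s n @[n --> \oo] --> (0 : R) -> (forall N, exists2 n, (N <= n)%N & x <= s n) -> x = 0.
Proof.
move=> x0 /cvgr_lt s0 h; apply/eqP; rewrite eq_le x0 andbT leNgt; apply/negP => xp.
have [N _ hN] := s0 _ xp; have [n Nn] := h N.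
by rewrite leNgt hN.
Qed.

Section limit_solution.
Context (R : realType) (p : nat) (F : metricType R) (N : 'rV[R]_p -> R).
Hypothesis mN : monotone_norm N.
Local Notation dE := (@prod_dist R p F N).
Local Notation block := ('I_p -> F).
Variables (E : set block) (U : pseudoMetricType R) (Theta : set U) (y0 : block).
Hypotheses (Ecomp : complete dE E) (Ey0 : E y0).

(** The value at time [s] of the recursion started from [y0] in the infinite past. It depends on the
    path alone and is defined for all parameters at once. *)
Definition limit_block (u : int -> block -> U -> block) (s : int) (th : U) : block :=
  xget y0 [set l | E l /\ dE (iter_maps u n s y0 th) l @[n --> \oo] --> (0 : R)].

Lemma limit_block_shift u v s th :
  limit_block (fun t => u (t + v)) s th = limit_block u (s + v) th.
Proof.
rewrite /limit_block; congr (xget _ _); apply/seteqP; split => l [El cl]; split=> //.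
  by under eq_fun do rewrite -iter_maps_shift.
by under eq_fun do rewrite iter_maps_shift.
Qed.

Section path.
Variable u : int -> block -> U -> block.
Hypotheses (gu : good_path N E Theta u) (cu : contracting_path N E Theta y0 u).

Let Eit k s th y : Theta th -> E y -> E (iter_maps u k s y th).
Proof. by move=> Tth Ey; apply: (good_stable (good_iter mN k s gu)). Qed.

Lemma limit_block_rate s : exists C c, [/\ 0 <= C, 0 < c & forall th, Theta th ->
  E (limit_block u s th) /\
  forall k, dE (iter_maps u k s y0 th) (limit_block u s th) <= C * expR (- c * k%:R)].
Proof.
have [C [c [C0 c0 _ _ hj]]] := cu s.
have e1 : expR (- c) < 1 by rewrite expR_lt1 oppr_lt0.
(* The sum of the geometric series of consecutive distances. The induction below keeps the exact
   partial sum, with its negative last term, so that it closes. *)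
pose C' := C / (1 - expR (- c)).
have C'0 : 0 <= C' by rewrite divr_ge0// subr_ge0 ltW.
have C'E : C' * (1 - expR (- c)) = C by rewrite divfK// gt_eqF// subr_gt0.
exists C', c; split=> // th Tth.
have dk k n : dE (iter_maps u k s y0 th) (iter_maps u (k + n) s y0 th) <=
    C' * (expR (- c * k%:R) - expR (- c * (k + n)%:R)).
  elim: n => [|n ih]; first by rewrite addn0 subrr mulr0 prod_distxx.
  apply: le_trans (prod_dist_triangle mN _ (iter_maps u (k + n) s y0 th) _) _.
  rewrite addnS; apply: le_trans (lerD ih (hj th (k + n)%N Tth)) _.
  have -> : expR (- c * (k + n).+1%:R) = expR (- c * (k + n)%:R) * expR (- c).
    by rewrite -natr1 mulrDr mulr1 expRD.
  by rewrite -C'E le_eqVlt; apply/orP; left; apply/eqP; ring.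
have dk' k n : dE (iter_maps u k s y0 th) (iter_maps u (k + n) s y0 th) <= C' * expR (- c * k%:R).
  by apply: le_trans (dk k n) _; apply: ler_wpM2l => //; rewrite gerBl expR_ge0.
have cv0 : C' * expR (- c * n%:R) @[n --> \oo] --> (0 : R).
  rewrite -(mulr0 C'); apply: cvgM; first exact: cvg_cst.
  exact: expR_geometric_cvg0.
have [|l El cl] := Ecomp (u := fun n => iter_maps u n s y0 th) (fun n => Eit n s Tth Ey0).
  move=> e e0; have /cvgr_lt/(_ _ e0)[n0 _ hn] := cv0.
  exists n0 => i j ni nj; have [ij|/ltnW ji] := leqP i j.
    by rewrite -(subnKC ij); apply: le_lt_trans (dk' _ _) _; exact: hn.
  by rewrite prod_distC -(subnKC ji); apply: le_lt_trans (dk' _ _) _; exact: hn.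
have [El' cl'] : [set l | E l /\ dE (iter_maps u n s y0 th) l @[n --> \oo] --> (0 : R)]
    (limit_block u s th) by apply: xgetPex; exists l.
split=> // k.
have : dE (iter_maps u k s y0 th) (limit_block u s th) - C' * expR (- c * k%:R) <= 0.
  have cl'' : dE (iter_maps u (n + k)%N s y0 th) (limit_block u s th) @[n --> \oo] --> (0 : R).
    by rewrite (cvg_shiftn k (fun n => dE (iter_maps u n s y0 th) (limit_block u s th))); exact: cl'.
  rewrite -(cvg_lim _ cl'')//; apply: limr_ge; first by apply/cvg_ex; exists 0.
  apply: nearW => n; rewrite lerBlDl.
  apply: le_trans (prod_dist_triangle mN _ (iter_maps u (n + k) s y0 th) _) _.
  by rewrite lerD2r addnC.
by rewrite subr_le0.
Qed.

Lemma limit_block_in s th : Theta th -> E (limit_block u s th).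
Proof. by move=> Tth; have [C [c [_ _ /(_ th Tth)[]]]] := limit_block_rate s. Qed.

Lemma limit_block_cvg s th : Theta th ->
  dE (iter_maps u n s y0 th) (limit_block u s th) @[n --> \oo] --> (0 : R).
Proof.
move=> Tth; have [C [c [C0 c0 /(_ th Tth)[_ h]]]] := limit_block_rate s.
apply: (@squeeze_cvgr _ _ _ _ (fun=> 0) (fun n => C * expR (- c * n%:R))).
- by apply: nearW => n; rewrite prod_dist_ge0//=; exact: h.
- exact: cvg_cst.
- by rewrite -(mulr0 C); apply: cvgM; [exact: cvg_cst|exact: expR_geometric_cvg0].
Qed.

Lemma limit_block_unique s th l : Theta th ->
  dE (iter_maps u n s y0 th) l @[n --> \oo] --> (0 : R) -> limit_block u s th = l.
Proof.
move=> Tth cl; apply: (prod_dist_eq0 mN).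
apply: (@le_cvg0_eq0 _ _ (fun n => dE (iter_maps u n s y0 th) (limit_block u s th) +
  dE (iter_maps u n s y0 th) l)); first exact: prod_dist_ge0.
  by rewrite -(addr0 0); apply: cvgD => //; exact: limit_block_cvg.
move=> n; exists n => //.
by rewrite [dE _ (limit_block _ _ _)]prod_distC; exact: prod_dist_triangle.
Qed.

Lemma limit_block_step s th : Theta th ->
  limit_block u s th = u s (limit_block u (s - 1) th) th.
Proof.
move=> Tth; apply: limit_block_unique => //; rewrite -cvg_shiftS /=.
have [L L0 hL] := good_lip (gu s).
apply: (@squeeze_cvgr _ _ _ _ (fun=> 0)
  (fun n => L * dE (iter_maps u n (s - 1) y0 th) (limit_block u (s - 1) th))).
- apply: nearW => n; rewrite prod_dist_ge0//=; apply: hL => //; first exact: Eit.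
  exact: limit_block_in.
- exact: cvg_cst.
- by rewrite -(mulr0 L); apply: cvgM; [exact: cvg_cst|exact: limit_block_cvg].
Qed.

Lemma limit_block_iter k s th : Theta th ->
  limit_block u s th = iter_maps u k s (limit_block u (s - k%:Z) th) th.
Proof.
move=> Tth; elim: k s => [|k ih] s; first by rewrite subr0.
by rewrite /= limit_block_step// {1}ih intS opprD addrA.
Qed.

Lemma limit_block_cont s th e : Theta th -> 0 < e ->
  \forall th' \near within Theta (nbhs th),
    dE (limit_block u s th') (limit_block u s th) < e.
Proof.
move=> Tth e0; have [C [c [C0 c0 h]]] := limit_block_rate s.
have e3 : 0 < e / 3 by rewrite divr_gt0.
have cv0 : C * expR (- c * n%:R) @[n --> \oo] --> (0 : R).
  by rewrite -(mulr0 C); apply: cvgM; [exact: cvg_cst|exact: expR_geometric_cvg0].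
have /cvgr_lt/(_ _ e3)[n _ /(_ n (leqnn n))/= hn] := cv0.
have hc := good_cont (good_iter mN n s gu) Ey0 Tth e3.
have h3 : \forall th' \near within Theta (nbhs th), Theta th' by exact: withinT.
apply: filterS2 hc h3 => th' hc Tth'.
have := prod_dist_triangle4 mN (limit_block u s th') (limit_block u s th)
  (iter_maps u n s y0 th') (iter_maps u n s y0 th).
rewrite [dE (limit_block u s th') (iter_maps _ _ _ _ _)]prod_distC.
rewrite [dE (limit_block u s th) (iter_maps _ _ _ _ _)]prod_distC.
have := (h th' Tth').2 n; have := (h th Tth).2 n; lra.
Qed.

Lemma limit_block_forward s : exists C c, [/\ 0 <= C, 0 < c & forall th x k, Theta th -> E x ->
  dE (iter_maps u k (s + k%:Z) x th) (limit_block u (s + k%:Z) th) <=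
    C * expR (- c * k%:R) * dE x (limit_block u s th)].
Proof.
have [C [c [C0 c0 h _ _]]] := cu s; exists C, c; split=> // th x k Tth Ex.
rewrite (limit_block_iter k _ Tth) addrK; apply: h => //; exact: limit_block_in.
Qed.

Lemma limit_block_backward s : exists C c, [/\ 0 <= C, 0 < c & forall th x k, Theta th -> E x ->
  dE (iter_maps u k s x th) (limit_block u s th) <=
    C * expR (- c * k%:R) * (dE x y0 + 1)].
Proof.
have [C1 [c1 [C10 c10 _ h _]]] := cu s.
have [C2 [c2 [C20 c20 h2]]] := limit_block_rate s.
exists (C1 + C2), (Num.min c1 c2); split; rewrite ?addr_ge0// ?lt_min ?c10//.
move=> th x k Tth Ex; apply: le_trans (prod_dist_triangle mN _ (iter_maps u k s y0 th) _) _.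
apply: le_trans (lerD (h th x y0 k Tth Ex Ey0) ((h2 th Tth).2 k)) _.
have m1 : expR (- c1 * k%:R) <= expR (- Num.min c1 c2 * k%:R).
  by rewrite ler_expR !mulNr lerN2 ler_wpM2r// ge_min lexx.
have m2 : expR (- c2 * k%:R) <= expR (- Num.min c1 c2 * k%:R).
  by rewrite ler_expR !mulNr lerN2 ler_wpM2r// ge_min lexx orbT.
have d0 := prod_dist_ge0 mN x y0; set e := expR (- Num.min c1 c2 * k%:R) in m1 m2 *.
have e0 : 0 <= e by exact: expR_ge0.
have -> : (C1 + C2) * e * (dE x y0 + 1) = C1 * e * dE x y0 + C2 * e + (C1 * e + C2 * e * dE x y0).
  by ring.
apply: (@le_trans _ _ (C1 * e * dE x y0 + C2 * e)); last by rewrite lerDl addr_ge0// !mulr_ge0.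
by apply: lerD; [apply: ler_wpM2r => //|]; exact: ler_wpM2l.
Qed.

End path.

(** Only the maps up to time [t0] enter, and [T] is arbitrary. The same lemma therefore gives
    measurability with respect to the past of the innovations. *)
Lemma limit_block_meas d (T : measurableType d) (q : nat -> block)
    (u : int -> T -> block -> U -> block) (t0 s : int) th :
  (forall n, E (q n)) -> (forall x e, E x -> 0 < e -> exists n, dE x (q n) < e) ->
  (forall w, good_path N E Theta (u ^~ w)) -> (forall w, contracting_path N E Theta y0 (u ^~ w)) ->
  (forall t y th, t <= t0 -> E y -> Theta th -> block_meas N q (fun w => u t w y th)) ->
  s <= t0 -> Theta th -> block_meas N q (fun w => limit_block (u ^~ w) s th).
Proof.
move=> Eq dq gu cu mu st Tth m.
apply: (@measurable_fun_cvg _ _ _ setT (fun n w => dE (iter_maps (u ^~ w) n s y0 th) (q m))).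
  by move=> n; apply: (meas_iter mN Eq dq gu mu n st Ey0 Tth).
move=> w _; apply/cvgrPdist_le => e e0.
have /cvgr_lt/(_ e e0) := limit_block_cvg (gu w) (cu w) s Tth.
apply: filterS => n hn; rewrite ler_distl.
have := prod_dist_triangle mN (limit_block (u ^~ w) s th) (iter_maps (u ^~ w) n s y0 th) (q m).
have := prod_dist_triangle mN (iter_maps (u ^~ w) n s y0 th) (limit_block (u ^~ w) s th) (q m).
rewrite [dE (limit_block _ _ _) (iter_maps _ _ _ _ _)]prod_distC => h1 h2.
by apply/andP; split; lra.
Qed.

End limit_solution.

Lemma time_back (t : int) (n k : nat) : (n + absz t <= k)%N ->
  exists2 l : nat, (n <= l)%N & t - l%:Z = - k%:Z.
Proof. by move=> h; exists (absz (t + k%:Z)); lia. Qed.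

(** * Uniqueness of stationary solutions by tightness *)

Section stationary_uniqueness.
Context d (T : measurableType d) (R : realType) (P : probability T R).

(** A uniformly tight sequence cannot tend to infinity with positive probability: the event that it
    stays above [K] from some rank on is an increasing union of events no more probable than a
    single exceedance. *)
Lemma bounded_infinitely_often (s : nat -> T -> R) :
  (forall k, measurable_fun setT (s k)) ->
  (forall e : R, 0 < e -> exists K : R, forall k, (P [set w | (K < s k w)%R] <= e%:E)%E) ->
  {ae P, forall w, exists K : R, forall n, exists2 k, (n <= k)%N & s k w <= K}.
Proof.
move=> ms hs.
pose A (K : nat) n := \bigcap_k [set w | K%:R < s (n + k)%N w].
have mA K n : measurable (A K n).
  by apply: bigcap_measurableType => k _; apply: measurable_lt_set => //; exact: measurable_cst.
pose B K := \bigcup_n A K n.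
have mB K : measurable (B K) by exact: bigcup_measurable.
have PB e : 0 < e -> exists K, (P (B K) <= e%:E)%E.
  move=> e0; have [K hK] := hs e e0; exists (Num.truncn `|K|).+1.
  have KK : K < (Num.truncn `|K|).+1%:R by rewrite (le_lt_trans (ler_norm K))// truncnS_gt.
  have ndA : nondecreasing_seq (A (Num.truncn `|K|).+1).
    apply/nondecreasing_seqP => n; apply/subsetPset => w h k _.
    by have := h k.+1 Logic.I; rewrite addnS addSn.
  have := nondecreasing_cvg_mu (mu := P) (mA _) (mB _) ndA.
  move=> /cvg_lim <- //; apply: lime_le.
    by apply: ereal_nondecreasing_is_cvgn => i j ij; apply: le_measure; rewrite ?inE//; apply/subsetPset/ndA.
  apply: nearW => n; apply: le_trans (hK n); apply: le_measure; rewrite ?inE//.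
    by apply: measurable_lt_set => //; exact: measurable_cst.
  by move=> w /(_ 0%N Logic.I)/=; rewrite addn0; exact: lt_trans.
exists (\bigcap_K B K); split; first exact: bigcap_measurableType.
  apply/eqP; rewrite eq_le measure_ge0 andbT; apply/lee_addgt0Pr => e e0; rewrite add0e.
  have [K hK] := PB e e0; apply: le_trans hK; apply: le_measure; rewrite ?inE//.
    exact: bigcap_measurableType.
  by move=> w /(_ K Logic.I).
move=> w; apply: contraPP => /= nB; rewrite -forallNP in nB * => h.
have /existsNP[K /not_implyP[_ nBK]] : ~ forall K, True -> B K w by exact: nB.
apply: (h K%:R) => n; apply: contrapT => hk; apply: nBK; exists n => // k _ /=.
by rewrite ltNge; apply/negP => sk; apply: hk; exists (n + k)%N => //; exact: leq_addr.
Qed.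

Context (p : nat) (F : metricType R) (N : 'rV[R]_p -> R).
Hypothesis mN : monotone_norm N.
Local Notation dE := (@prod_dist R p F N).
Local Notation block := ('I_p -> F).

Lemma mdist_continuous (y : F) : continuous (fun x : F => mdist x y).
Proof.
move=> x; apply/cvgrPdist_lt => e e0; near=> z.
have xz : mdist x z < e by near: z; apply/nbhs_ballP; exists e => //= z; rewrite ballEmdist.
have := metric_triangle x z y; have := metric_triangle z x y.
rewrite [mdist z x]metric_sym => h1 h2.
by rewrite ltr_norml; apply/andP; split; lra.
Unshelve. all: by end_near. Qed.

Lemma borel_mdist (y : F) (B : set R) : open B -> borel [set x : F | B (mdist x y)].
Proof.
move=> oB; apply: sub_sigma_algebra => /=.
by apply: open_comp => // x _; exact: mdist_continuous.
Qed.

Lemma measurable_mdist (v : T -> F) (y : F) :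
  (forall B, borel B -> measurable (v @^-1` B)) ->
  measurable_fun setT (fun w => mdist (v w) y).
Proof.
move=> mv; apply: measurable_of_lt => c.
exact: (mv _ (borel_mdist y (open_lt (y := c)))).
Qed.

Lemma measure_union_le (I : eqType) (s : seq I) (A : I -> set T) (B : set T) :
  (forall i, measurable (A i)) -> measurable B ->
  (forall w, B w -> exists2 i, i \in s & A i w) -> (P B <= \sum_(i <- s) P (A i))%E.
Proof.
move=> mA; elim: s B => [|i s ih] B mB h.
  by rewrite big_nil (_ : B = set0) ?measure0//; apply/seteqP; split=> // w /h[].
have -> : B = (B `&` A i) `|` (B `\` A i) by rewrite setDE -setIUr setUv setIT.
rewrite big_cons; apply: le_trans (measureU2 _ _ _) _.
- exact: measurableI.
- exact: measurableD.
- apply: leeD; first by apply: le_measure; rewrite ?inE//; exact: measurableI.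
  apply: ih; first exact: measurableD.
  by move=> w [/h[j]]; rewrite inE => /predU1P[->//|js Aj _]; exists j.
Qed.

Lemma tail_small (f : T -> R) (e : R) : measurable_fun setT f -> 0 < e ->
  exists L : R, (P [set w | (L < f w)%R] <= e%:E)%E.
Proof.
move=> mf e0; pose A (n : nat) := [set w | n%:R < f w].
have mA n : measurable (A n) by apply: measurable_lt_set => //; exact: measurable_cst.
have A0 : \bigcap_n A n = set0.
  apply/seteqP; split=> // w /(_ (Num.truncn `|f w|).+1 Logic.I); rewrite /A /=.
  by rewrite ltNge (le_trans (ler_norm _))// ltW// truncnS_gt.
have := @nonincreasing_cvg_mu _ _ _ P A; rewrite A0 measure0 => /(_ _ mA _ _)/fine_cvgP[].
- by rewrite (le_lt_trans (probability_le1 _ _)) ?ltry.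
- by [].
- by move=> i j ij; apply/subsetPset => w /=; apply: le_lt_trans; rewrite ler_nat.
move=> _ /cvgr_lt/(_ _ e0)[n _ /(_ n (leqnn n))/= hn]; exists n%:R.
rewrite -[leLHS]fineK; first by rewrite lee_fin ltW.
by apply: fin_num_measure; exact: mA.
Qed.

Lemma stationary_tight (v : int -> T -> F) (y : block) :
  (forall t B, borel B -> measurable (v t @^-1` B)) ->
  (forall t B, borel B -> P (v t @^-1` B) = P (v 0 @^-1` B)) ->
  forall e : R, 0 < e -> exists K : R, forall t,
    (P [set w | (K < \sum_(j < p) mdist (v (t - (j : nat)%:Z) w) (y j))%R] <= e%:E)%E.
Proof.
move=> mv sv e e0; have md t j := measurable_mdist (y j) (mv t).
have ep : 0 < e / p.+1%:R by rewrite divr_gt0.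
have [L hL] := boolp.choice (fun j => tail_small (md 0 j) ep); exists (\sum_j L j) => t.
have mA j t' : measurable [set w | L j < mdist (v t' w) (y j)].
  by apply: measurable_lt_set => //; exact: measurable_cst.
apply: le_trans (@measure_union_le _ (index_enum 'I_p)
  (fun j => [set w | L j < mdist (v (t - (j : nat)%:Z) w) (y j)]) _ _ _ _) _ => //.
- by apply: measurable_lt_set; [exact: measurable_cst|exact: measurable_sum].
- move=> w /= h; apply: contrapT => /forall2NP H; move: h; apply/negP; rewrite -leNgt.
  by apply: ler_sum => j _; rewrite leNgt; apply/negP; have [/negP|//] := H j; rewrite mem_index_enum.
apply: (@le_trans _ _ (\sum_(j < p) (e / p.+1%:R)%:E)%E).
  apply: lee_sum => j _; apply: le_trans (hL j).
  by have := sv (t - (j : nat)%:Z) _ (borel_mdist (y j) (open_gt (y := L j))) => /= ->.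
rewrite sumEFin lee_fin sumr_const card_ord -mulrnAr -mulr_natr mulrA.
rewrite -[leRHS]mulr1 -mulrA ler_pM2l// mulrC ler_pdivrMr// mul1r ler_nat.
exact: leqnSn.
Qed.

Variables (E : set block) (U : pseudoMetricType R) (Theta : set U) (y0 : block).
Hypotheses (Ecomp : complete dE E) (Ey0 : E y0).

(** No moment of the solution is available, so its growth toward the past is not controlled at every
    time. Equal marginals make it tight, hence bounded at infinitely many past times, and the
    backward contraction from those times identifies it with the limit. *)
Lemma stationary_solution_limit (u : int -> T -> block -> U -> block) (v : int -> T -> F) th :
  (forall w, good_path N E Theta (u ^~ w)) -> (forall w, contracting_path N E Theta y0 (u ^~ w)) ->
  Theta th -> (forall t w, E (lags p (v ^~ w) t)) ->
  (forall t B, borel B -> measurable (v t @^-1` B)) ->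
  (forall t B, borel B -> P (v t @^-1` B) = P (v 0 @^-1` B)) ->
  {ae P, forall w, forall t, lags p (v ^~ w) t = u t w (lags p (v ^~ w) (t - 1)) th} ->
  {ae P, forall w, forall t, lags p (v ^~ w) t = limit_block N E y0 (u ^~ w) t th}.
Proof.
move=> gu cu Tth Ev mv sv hv.
pose s (k : nat) w := \sum_(j < p) mdist (v (- k%:Z - (j : nat)%:Z) w) (y0 j).
have ms k : measurable_fun setT (s k).
  rewrite /s; apply: measurable_sum => j; apply: measurable_mdist; exact: mv.
have io := bounded_infinitely_often ms (fun e e0 =>
  let: ex_intro K hK := stationary_tight y0 mv sv e0 in ex_intro _ K (fun k => hK (- k%:Z))).
apply: filterS2 hv io => w step [K hK] t; apply/esym/(prod_dist_eq0 mN).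
have iter k t' : lags p (v ^~ w) t' = iter_maps (u ^~ w) k t' (lags p (v ^~ w) (t' - k%:Z)) th.
  elim: k t' => [|k ih] t'; first by rewrite subr0.
  by rewrite /= {1}step {1}ih intS opprD addrA.
have [C [c [C0 c0 hb]]] := limit_block_backward mN Ecomp Ey0 (gu w) (cu w) t.
have nc0 := norm_const_ge0 mN.
pose K' := norm_const N * K + 1.
rewrite prod_distC; apply: (@le_cvg0_eq0 _ _ (fun k => C * expR (- c * k%:R) * K')).
- exact: prod_dist_ge0.
- rewrite -[0](mul0r K') -[0 in X in X * _](mulr0 C).
  by apply: cvgM; [apply: cvgM; [exact: cvg_cst|exact: expR_geometric_cvg0]|exact: cvg_cst].
move=> n; have [k nk sk] := hK (n + `|t|)%N.
have [l nl tl] := time_back nk; exists l => //.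
rewrite {1}(iter l t) tl.
apply: le_trans (hb th _ _ Tth (Ev _ _)) _.
apply: ler_wpM2l; first by rewrite mulr_ge0 ?expR_ge0.
rewrite lerD2r; apply: le_trans (prod_dist_le mN _ _) _.
by apply: ler_wpM2l.
Qed.

End stationary_uniqueness.

(** * Contraction of the maps of the model *)

Section expectation_bounds.
Context d (T : measurableType d) (R : realType) (P : probability T R).
Local Notation integr f := (P.-integrable setT (EFin \o f)).
Local Notation Ex f := (Rintegral P setT f).

(* The majorant need not be measurable: the integral of a nonnegative function is a supremum over
   the simple functions below it. *)
Lemma integr_le_integral (f : T -> R) (g : T -> \bar R) : measurable_fun setT f ->
  (forall w, 0 <= f w) -> {ae P, forall w, ((f w)%:E <= g w)%E} -> (forall w, (0 <= g w)%E) ->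
  (\int[P]_w g w < +oo)%E -> integr f.
Proof.
move=> mf f0 [N0 [mN N00 fg]] g0 gi.
have fE : integr (fun w => f w * \1_(~` N0) w).
  have m1 : measurable_fun setT (fun w => f w * \1_(~` N0) w).
    by apply: measurable_funM => //; apply: measurable_indic; exact: measurableC.
  apply/integrableP; split; first exact/measurable_EFinP.
  apply: le_lt_trans gi.
  have h0 w : (0 <= (f w * \1_(~` N0) w)%:E)%E by rewrite lee_fin mulr_ge0// indicE.
  have -> : (\int[P]_w `|(EFin \o (fun w => (f w * \1_(~` N0) w)%R)) w|)%E = (\int[P]_w (f w * \1_(~` N0) w)%:E)%E.
    by apply: eq_integral => w _; rewrite /= ger0_norm// -lee_fin.
  rewrite !ge0_integralTE//; apply: le_ereal_sup => _ [h hf <-]; exists h => // w.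
  apply: le_trans (hf w) _; rewrite indicE in_setC; case: (boolP (w \in N0)) => wN /=.
    by rewrite mulr0.
  by rewrite mulr1; apply: contrapT => /fg Nw; move: wN; rewrite mem_set.
apply: integr_ae fE => //; exists N0; split=> // w /= h; apply: contrapT => nw; apply: h.
by rewrite indicE in_setC memNset// mulr1.
Qed.

Lemma log_plus_ge0 (x : R) : 0 <= log_plus x.
Proof. by rewrite /log_plus le_max lexx. Qed.

Lemma le_log_plus (x y : R) : x <= y -> log_plus x <= log_plus y.
Proof.
move=> xy; have [x0|x0] := leP x 0.
  by rewrite /log_plus ln0// maxxx log_plus_ge0.
by rewrite /log_plus le_max2// ler_ln// posrE (lt_le_trans x0).
Qed.

Lemma log_plus_expR (x : R) : 0 <= x -> log_plus (expR x) = x.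
Proof. by move=> x0; rewrite /log_plus expRK; apply/max_idPr. Qed.

Lemma log_plus_sup_le (f : nat -> R) (g : \bar R) : (forall n, (log_plus (f n))%:E <= g)%E ->
  ((log_plus (sup (range f)))%:E <= g)%E.
Proof.
case: g => [g| |] h; last 2 first.
- by rewrite leey.
- by have := h 0%N; rewrite leeNy_eq.
have g0 : 0 <= g by have := h 0%N; rewrite lee_fin; apply: le_trans; exact: log_plus_ge0.
rewrite lee_fin -(log_plus_expR g0); apply: le_log_plus.
apply: ge_sup; first by exists (f 0%N), 0%N.
by move=> _ [n _ <-]; apply: log_plusP => //; have := h n; rewrite lee_fin.
Qed.

Lemma ln_max_bound (x delta : R) : 0 < delta ->
  `|ln (Num.max x delta)| <= `|ln delta| + log_plus x.
Proof.
move=> d0; have l0 := log_plus_ge0 x; have [xd|dx] := leP x delta.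
  by rewrite lerDl.
have x0 : 0 < x by exact: lt_trans dx.
have : ln delta <= ln x by rewrite ler_ln ?posrE// ltW.
have : ln x <= log_plus x by rewrite /log_plus le_max lexx orbT.
have := ler_norm (ln delta); have := ler_norm (- ln delta); rewrite normrN.
by rewrite ler_norml => *; apply/andP; split; lra.
Qed.

Lemma ln_max_add (x delta e : R) : 0 <= x -> 0 < delta -> 0 <= e ->
  ln (Num.max (x + e * delta) delta) <= ln (Num.max x delta) + e.
Proof.
move=> x0 d0 e0; have m0 : 0 < Num.max x delta by rewrite lt_max d0 orbT.
have m1 : 0 < Num.max (x + e * delta) delta by rewrite lt_max d0 orbT.
rewrite -[X in _ <= _ + X](expRK e) -lnM ?posrE ?expR_gt0// ler_ln ?posrE ?mulr_gt0 ?expR_gt0//.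
apply: (@le_trans _ _ (Num.max x delta * (1 + e))); last first.
  by apply: ler_wpM2l; [exact: ltW|exact: expR_ge1Dx].
have xm : x <= Num.max x delta by rewrite le_max lexx.
have dm : delta <= Num.max x delta by rewrite le_max lexx orbT.
have := ler_wpM2r e0 dm; have := mulr_ge0 (ltW m0) e0.
by rewrite ge_max mulrDr mulr1 [e * delta]mulrC => *; apply/andP; split; lra.
Qed.

(** The mean of the logarithm may be [-oo]. Truncating the argument at [expR (- n)] cuts the
    negative part of the logarithm at [n], and monotone convergence keeps the mean negative for some
    [n]. *)
Lemma log_negative_truncation (L : T -> R) : measurable_fun setT L ->
  integr (fun w => log_plus (L w)) -> (\int[P]_w lne (L w)%:E < 0)%E ->
  exists delta, [/\ 0 < delta, integr (fun w => ln (Num.max (L w) delta)) &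
    Ex (fun w => ln (Num.max (L w) delta)) < 0].
Proof.
move=> mL Li neg.
have mlm del : measurable_fun setT (fun w => ln (Num.max (L w) del)).
  by apply: (measurableT_comp (f := @ln R)); [exact: measurable_ln|exact: measurable_maxr].
have im del : 0 < del -> integr (fun w => ln (Num.max (L w) del)).
  move=> d0; apply: (integr_le (mlm del) (fun w => ln_max_bound (L w) d0)).
  by apply: integrD => //; exact: integr_cst.
pose g (n : nat) w := log_plus (L w) - ln (Num.max (L w) (expR (- n%:R))).
pose neg_part w := ((fun w => lne (L w)%:E)^\- w)%E.
have lE w : ((fun w => lne (L w)%:E)^\+ w = (log_plus (L w))%:E)%E.
  rewrite funeposE /lne /log_plus; case: leP => [L0|L0]; last by rewrite -EFin_max maxC.
  by rewrite ln0// maxxx; apply/max_idPr; rewrite leNye.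
have gE n w : (g n w)%:E = (mine n%:R%:E (neg_part w))%E.
  rewrite /neg_part funenegE /lne /g /log_plus; case: leP => [L0|L0].
    rewrite ln0// maxxx add0r maxye ?miney.
    by rewrite (max_idPr _) ?expRK ?opprK// (le_trans L0)// expR_ge0.
  rewrite -EFin_max -EFin_min; congr EFin; have n0 : (0 : R) <= n%:R by [].
  have [x0|x0] := leP (L w) (expR (- n%:R)).
    have : ln (L w) <= - n%:R by rewrite -[leRHS]expRK ler_ln ?posrE ?expR_gt0.
    by rewrite expRK; move=> h; case: (leP 0 (ln (L w))) => l0; case: leP => h1; case: leP => h2; lra.
  have : - n%:R <= ln (L w) by rewrite -[leLHS]expRK ler_ln ?posrE ?expR_gt0// ltW.
  by move=> h; case: (leP 0 (ln (L w))) => l0; case: leP => h1; case: leP => h2; lra.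
have np0 w : (0 <= neg_part w)%E by exact: funeneg_ge0.
have g0 n w : 0 <= g n w by rewrite -lee_fin gE le_min np0 lee_fin ler0n.
have gi n : integr (g n) by apply: integrB => //; apply: im; exact: expR_gt0.
have limg w : limn (fun n => (g n w)%:E) = neg_part w.
  apply: cvg_lim => //; under eq_fun do rewrite gE.
  case: (neg_part w) (np0 w) => [x| |] // x0.
    apply: cvg_near_cst; exists (Num.truncn x).+1 => // n /= hn.
    apply/min_idPr; rewrite lee_fin ltW//.
    by apply: lt_le_trans (truncnS_gt _) _; rewrite ler_nat.
  under eq_fun do rewrite miney; apply/cvgeyPge => A; exists (Num.truncn `|A|).+1 => // n /= hn.
  rewrite lee_fin (le_trans (ler_norm A))// ltW//.
  by apply: lt_le_trans (truncnS_gt _) _; rewrite ler_nat.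
have cvgg : (\int[P]_w (g n w)%:E @[n --> \oo] --> \int[P]_w neg_part w)%E.
  under [X in _ --> X]eq_integral do rewrite -limg.
  apply: cvg_monotone_convergence => //.
  - by move=> n; apply/measurable_EFinP; exact: integr_meas.
  - by move=> n w _; rewrite lee_fin.
  - move=> w _ a b ab; rewrite !gE le_min ge_min ge_min lexx orbT andbT.
    by rewrite lee_fin ler_nat ab.
have ltn : ((Ex (fun w => log_plus (L w)))%:E < \int[P]_w neg_part w)%E.
  move: neg; rewrite integralE; under eq_integral do rewrite lE.
  rewrite -[X in (X - _)%E]fineK; last exact: integrable_fin_num.
  rewrite -/(Rintegral P setT (fun w => log_plus (L w))) -/neg_part.
  by case: (\int[P]_w neg_part w)%E => [x| |]//; rewrite ?ltry// -EFinB !lte_fin subr_lt0.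
have [n hn] : exists n, Ex (fun w => log_plus (L w)) < Ex (g n).
  apply: contrapT => /forallNP h; move: ltn; apply/negP; rewrite -leNgt -(cvg_lim _ cvgg)//.
  apply: lime_le; first by apply/cvg_ex; eexists; exact: cvgg.
  apply: nearW => n; rewrite -[leLHS]fineK; last exact: (integrable_fin_num measurableT (gi n)).
  by rewrite lee_fin leNgt; apply/negP; exact: h.
exists (expR (- n%:R)); split; [exact: expR_gt0|apply: im; exact: expR_gt0|].
move: hn; rewrite ExB//; last by apply: im; exact: expR_gt0.
lra.
Qed.

End expectation_bounds.

(** * Measurability of distances under the sigma-algebra of maps *)

Section map_sigma_algebra.
Context (R : realType) (p : nat) (F : metricType R) (N : 'rV[R]_p -> R).
Hypothesis mN : monotone_norm N.
Local Notation dE := (@prod_dist R p F N).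
Local Notation block := ('I_p -> F).
Variables (I : set F) (q : nat -> block).
Local Notation E := (@prod_set R p F I).
Hypotheses (Eq : forall n, E (q n))
  (dq : forall x e, E x -> 0 < e -> exists n, dE x (q n) < e).

Lemma sigma_eval_box (a : block) (c : R) :
  sigma_eval [set: 'I_p] (@borel F) [set x | forall j, mdist (x j) (a j) < c].
Proof.
rewrite (_ : [set _ | _] = \bigcap_k (if insub k is Some j then [set x : block | mdist (x j) (a j) < c] else setT)).
  apply: sigma_bigcap => k; case: insubP => [j _ _|_].
    apply: sub_sigma_algebra; exists j, [set y | mdist y (a j) < c]; split=> //.
    exact: (borel_mdist (a j) (open_lt (y := c))).
  have := sigma_setC (sigma_algebra0 (G := [set A : set block |
     exists i B, [/\ [set: 'I_p] i, borel B & A = [set f | B (f i)]]])).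
  by rewrite setC0.
apply/seteqP; split => [x h k _|x h j]; first by case: insub => //= j; exact: h.
by have := h (j : nat) Logic.I; rewrite valK.
Qed.

(** The product sigma-algebra is generated by coordinates. By separability, a ball of [dE] agrees on
    [E] with a countable union of boxes around dense points, where the comparison of [dE] with the
    coordinate distances says which boxes fit inside. *)
Lemma sigma_eval_ball (n : nat) (c : R) : exists2 B,
  sigma_eval [set: 'I_p] (@borel F) B & forall x, E x -> (B x <-> dE x (q n) < c).
Proof.
pose B m l : set block := if dE (q m) (q n) + norm_const N * (p%:R * l.+1%:R^-1) < c
  then [set x | forall j, mdist (x j) (q m j) < l.+1%:R^-1] else set0.
exists (\bigcup_m \bigcup_l B m l).
  apply: sigma_algebra_bigcup => m; apply: sigma_algebra_bigcup => l.
  by rewrite /B; case: ifP => _; [exact: sigma_eval_box|exact: sigma_algebra0].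
have nc0 := norm_const_ge0 mN; have cc0 := coord_const_ge0 mN.
move=> x Ex; split => [[m _ [l _]]|xc].
  rewrite /B; case: ifP => // hc hx; apply: le_lt_trans hc.
  apply: le_trans (prod_dist_triangle mN _ (q m) _) _; rewrite addrC lerD2l.
  apply: le_trans (prod_dist_le mN _ _) _; apply: ler_wpM2l => //.
  apply: (@le_trans _ _ (\sum_(j < p) l.+1%:R^-1)); first by apply: ler_sum => j _; exact: ltW.
  by rewrite sumr_const card_ord mulr_natl.
pose eta := c - dE x (q n); have eta0 : 0 < eta by rewrite subr_gt0.
have [l hl] : exists l : nat, norm_const N * (p%:R * l.+1%:R^-1) < eta / 2.
  exists (Num.truncn (norm_const N * p%:R * 2 / eta)).
  rewrite mulrA ltr_pdivrMr// -ltr_pdivrMl ?divr_gt0// invf_div mulrC mulrA mulrAC.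
  by rewrite truncnS_gt.
have l0 : (0 : R) < l.+1%:R^-1 by rewrite invr_gt0.
(* The first bound keeps the box around [q m] inside the ball, the second puts [x] into that box. *)
have e0 : 0 < Num.min (eta / 2) (l.+1%:R^-1 / (coord_const N + 1)).
  by rewrite lt_min !divr_gt0// ltr_wpDl.
have [m] := dq Ex e0; rewrite lt_min => /andP[m1 m2].
exists m => //; exists l => //; rewrite /B ifT => [j|].
  apply: le_lt_trans (coord_dist mN _ _ _) _.
  move: m2; rewrite ltr_pdivlMr ?ltr_wpDl// => m2; apply: le_lt_trans m2.
  by rewrite mulrC; apply: ler_wpM2l; [exact: prod_dist_ge0|rewrite lerDl].
have := prod_dist_triangle mN (q m) x (q n); rewrite [dE (q m) x]prod_distC => h.
apply: le_lt_trans (lerD h (ltW hl)) _; move: m1; rewrite /eta; lra.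
Qed.

Context (U : pseudoMetricType R) (Theta : set U).
Lemma sigma_maps_dist (y : block) (th : U) (n : nat) (c : R) : E y -> Theta th ->
  exists2 A : set (block -> U -> block),
    sigma_eval E (sigma_eval Theta (sigma_eval [set: 'I_p] (@borel F))) A &
    forall k, good_map N E Theta k -> (A k <-> dE (k y th) (q n) < c).
Proof.
move=> Ey Tth; have [B SB BE] := sigma_eval_ball n c.
exists [set k | B (k y th)].
  apply: sub_sigma_algebra; exists y, [set f | B (f th)]; split=> //.
  by apply: sub_sigma_algebra; exists th, B.
by move=> k gk; apply: BE; apply: (good_stable gk).
Qed.

Lemma maps_block_meas d (T : measurableType d) (f : T -> block -> U -> block) y th :
  (forall B, sigma_eval E (sigma_eval Theta (sigma_eval [set: 'I_p] (@borel F))) B ->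
    measurable (f @^-1` B)) ->
  (forall w, good_map N E Theta (f w)) -> E y -> Theta th ->
  block_meas N q (fun w => f w y th).
Proof.
move=> mf gf Ey Tth n; apply: measurable_of_lt => c.
have [A SA Ak] := sigma_maps_dist n c Ey Tth.
rewrite (_ : [set _ | _] = f @^-1` A); first exact: mf.
by apply/seteqP; split => w /= /(Ak _ (gf w)).
Qed.

End map_sigma_algebra.

(** On a null event the path is replaced by that of one fixed good outcome [w0]. Properties of paths
    then hold for every [w], without loss of measurability. *)
Lemma good_modification d (T : measurableType d) (R : realType) (P : probability T R)
    (S : Type) (SS : set_system S) (Y : int -> T -> S) (Good : set (int -> S)) :
  (forall t, measurable_wrt setT (@measurable d T) SS (Y t)) ->
  {ae P, forall w, Good (Y ^~ w)} ->
  exists Y' : int -> T -> S, [/\ forall w, Good (Y' ^~ w),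
    forall t B, SS B -> measurable (Y' t @^-1` B) &
    {ae P, forall w, forall t, Y' t w = Y t w}].
Proof.
move=> mY aeg; have [Om0 [w0 [mOm POm Ow0 gOm]]] := modification aeg.
exists (fun t w => if pselect (Om0 w) then Y t w else Y t w0); split.
- by move=> w; case: (pselect (Om0 w)) => Ow; exact: gOm.
- move=> t B SB; rewrite (_ : _ @^-1` _ = (Om0 `&` Y t @^-1` B) `|`
      (~` Om0 `&` [set _ | B (Y t w0)])).
    apply: measurableU; apply: measurableI => //; [|exact: measurableC|].
      by have := mY t B SB; rewrite setTI.
    have [b|nb] := pselect (B (Y t w0)).
      by rewrite (_ : [set _ | _] = setT)//; apply/seteqP; split.
    by rewrite (_ : [set _ | _] = set0)//; apply/seteqP; split.
  apply/seteqP; split => w /=; case: pselect => Ow.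
  + by left.
  + by right.
  + by case=> -[].
  + by case=> -[].
- exists (~` Om0); split=> //; first exact: measurableC.
  by move=> w /= nw; apply: contra_not nw => Ow t; case: pselect.
Qed.

(** * Contraction of the maps of the model under (CI) *)

Section model_contraction.
Context (R : realType) (p : nat) (F : metricType R) (N : 'rV[R]_p -> R).
Hypothesis mN : monotone_norm N.
Local Notation dE := (@prod_dist R p F N).
Local Notation block := ('I_p -> F).
Context (U : pseudoMetricType R) (Theta : set U).

Lemma compact_local_bound (f : U -> R) : compact Theta ->
  (forall th, Theta th -> exists b, \forall th' \near within Theta (nbhs th), f th' <= b) ->
  exists2 B, 0 <= B & forall th, Theta th -> f th <= B.
Proof.
move=> cT loc.
have h th : exists Ob : set U * R, Theta th ->
    nbhs th Ob.1 /\ forall th', Theta th' -> Ob.1 th' -> f th' <= Ob.2.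
  have [Tth|nT] := pselect (Theta th); last by exists (setT, 0) => /nT.
  have [b hb] := loc th Tth; exists ([set th' | Theta th' -> f th' <= b], b) => _; split=> //=.
  by move=> th' Tth' /(_ Tth').
have {h}[Ob hOb] := boolp.choice h.
have [|s sT cov] := @compact_finite_cover U Theta (fun th => (Ob th).1) cT.
  by move=> x /hOb[].
exists (\sum_(c <- s) `|(Ob c).2|); first exact: sumr_ge0.
move=> th Tth; have [c cs Oc] := cov th Tth.
apply: le_trans ((hOb c (sT c cs)).2 th Tth Oc) _; apply: le_trans (ler_norm _) _.
by rewrite (big_rem c)//= lerDl sumr_ge0.
Qed.

Lemma within_continuous_near (S : pseudoMetricType R) (f : U -> S) th (e : R) :
  {within Theta, continuous f} -> Theta th -> 0 < e ->
  \forall th' \near within Theta (nbhs th), ball (f th) e (f th').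
Proof.
move=> /subspace_continuousP/(_ th) h /h{}h e0.
by have := h _ (nbhsx_ballx (f th) e e0).
Qed.

Lemma prod_dist_near (u : U -> block) th (e : R) : (forall j, {within Theta, continuous (u ^~ j)}) ->
  Theta th -> 0 < e -> \forall th' \near within Theta (nbhs th), dE (u th) (u th') < e.
Proof.
move=> cu Tth e0; have nc0 := norm_const_ge0 mN.
pose e' := e / (norm_const N * p%:R + 1).
have K0 : 0 < norm_const N * p%:R + 1 by rewrite ltr_wpDl// mulr_ge0.
have e'0 : 0 < e' by rewrite divr_gt0.
have : \forall th' \near within Theta (nbhs th), forall j, mdist (u th j) (u th' j) < e'.
  apply: filter_forall => j; have := within_continuous_near (cu j) Tth e'0.
  by apply: filterS => th'; rewrite ballEmdist.
apply: filterS => th' hj; apply: le_lt_trans (prod_dist_le mN _ _) _.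
apply: (@le_lt_trans _ _ (norm_const N * (p%:R * e'))).
  apply: ler_wpM2l => //; apply: (@le_trans _ _ (\sum_(j < p) e')).
    by apply: ler_sum => j _; exact: ltW.
  by rewrite sumr_const card_ord mulr_natl.
by rewrite mulrA /e' mulrA ltr_pdivrMr// mulrC ltr_pM2l// ltrDl.
Qed.

Lemma lipschitz_coefP (E : set block) (f : block -> block) (L : R) x y : 0 <= L ->
  (lipschitz_coef dE E f <= L%:E)%E -> E x -> E y -> dE (f x) (f y) <= L * dE x y.
Proof.
move=> L0 fL Ex Ey; have [->|xy] := pselect (x = y).
  by rewrite !prod_distxx// mulr0.
rewrite -ler_pdivrMr ?prod_dist_gt0// -lee_fin; apply: le_trans fL.
by apply: ereal_sup_ubound; exists x, y.
Qed.

Lemma phi_iterE d (T : measurableType d) (phi : int -> T -> block -> U -> block) r t w th y :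
  phi_iter phi r t w th y = iter_maps (phi ^~ w) r t y th.
Proof. by elim: r t y => //= r ih t y; rewrite ih. Qed.

Lemma good_map_jump_bounded (E : set block) (k : block -> U -> block) y : compact Theta ->
  good_map N E Theta k -> E y -> exists2 B, 0 <= B & forall th, Theta th -> dE (k y th) y <= B.
Proof.
move=> cT gk Ey; apply: compact_local_bound => // th Tth.
exists (1 + dE (k y th) y); apply: filterS (good_cont gk Ey Tth (ltr01 : (0 : R) < 1)) => th' h.
by apply: le_trans (prod_dist_triangle mN _ (k y th) _) _; rewrite lerD2r ltW.
Qed.

Context d (T : measurableType d) (P : probability T R) (m q0 : nat).
Variables (M : set 'M[R]_m) (h : 'M[R]_m -> F) (X : int -> T -> 'cV[R]_m).
Variables (phi : int -> T -> block -> U -> block) (Lam : nat -> int -> T -> U -> R).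
Local Notation E := (@prod_set R p F (h @` M)).
Local Notation integr f := (P.-integrable setT (EFin \o f)).
Local Notation Ex f := (Rintegral P setT f).

Hypothesis cT : compact Theta.
Hypothesis obs : observable_maps P Theta M h X phi q0.
Hypothesis lip : lipschitz_bounds P Theta M h N phi Lam.

Lemma ae_good_path : {ae P, forall w, good_path N E Theta (phi ^~ w)}.
Proof.
have [st ct _ _ _] := obs; have [_ cL hL] := lip (ltn0Sn 0).
apply: filterS3 ct cL hL => w ct cL hL t; split.
- by move=> y th Ey Tth; exact: st.
- move=> y th e Ey Tth e0.
  apply: filterS (prod_dist_near (fun j => ct t y j Ey) Tth e0) => th'.
  by rewrite prod_distC.
- have [B B0 hB] : exists2 B, 0 <= B & forall th, Theta th -> Lam 1 t w th <= B.
    apply: compact_local_bound => // th Tth; exists (Lam 1 t w th + 1).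
    apply: filterS (within_continuous_near (cL t) Tth (ltr01 : (0 : R) < 1)) => th'.
    by rewrite /ball/= distrC ltr_distl => /andP[_ /ltW].
  exists B => // th x y Tth Ex Ey; have [L0 hl] := hL t th Tth.
  apply: le_trans (lipschitz_coefP L0 hl Ex Ey) _.
  by apply: ler_wpM2r; [exact: prod_dist_ge0|exact: hB].
Qed.

Hypothesis sep : separable dE E.
Variable theta0 : U.
Hypothesis Ttheta0 : Theta theta0.
Variables (r : nat) (y0 : block).
Hypotheses (r0 : (0 < r)%N) (Ey0 : E y0).
Hypothesis neg : forall th, Theta th -> (\int[P]_w lne (Lam r 0 w th)%:E < 0)%E.
Hypothesis mom : (\int[P]_w ereal_sup [set (log_plus (Lam r 0 w th))%:E | th in Theta] < +oo)%E.
Hypothesis jump : (\int[P]_w ereal_sup [set (log_plus (dE (phi 0 w y0 th) y0))%:E | th in Theta] < +oo)%E.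

(** The negative mean at [th] has to persist on a ball around it. By continuity of the bound in the
    parameter, the optimal constant on balls shrinking to [th] is asymptotically at most
    [Lam r 0 w th]; its logarithm, truncated below, is dominated through the moment of the
    supremum. *)
Lemma ae_contracting_path : {ae P, forall w, contracting_path N E Theta y0 (phi ^~ w)}.
Proof.
have [Q QE [cQ dQ]] := sep.
have Q0 : Q !=set0 by have [y Qy _] := dQ y0 1 Ey0 ltr01; exists y.
have [q Qq qQ] := countable_dense_seq cQ Q0.
have Eq n : E (q n) by exact: QE.
have dq x e : E x -> 0 < e -> exists n, dE x (q n) < e.
  by move=> Ex e0; have [y Qy xy] := dQ x e Ex e0; have [n qn] := qQ y Qy; exists n; rewrite qn.
have [|eT eTT dT] := compact_dense_seq cT (fun x => id) _; first by exists theta0.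
have [_ _ _ fs fe] := obs.
have [phi' [phi'good phi'meas phi'ae]] := good_modification fs.1 ae_good_path.
suff : {ae P, forall w, contracting_path N E Theta y0 (phi' ^~ w)}.
  apply: filterS2 phi'ae => w e; suff -> : phi ^~ w = phi' ^~ w by [].
  by apply/funext => t; rewrite e.
have SSd := sigma_maps_dist mN dq (Theta := Theta).
have gs := @good_path_shift R p F N E U Theta.
have gg (u : int -> block -> U -> block) : good_path N E Theta u -> good_path N E Theta u by [].
have mlc (V : set U) (e : nat -> U) : V `<=` Theta -> (forall n, V (e n)) ->
    measurable_fun setT (fun w => lip_const N q e (iter_maps (phi' ^~ w) r 0)).
  move=> VT eV; apply: (meas_lip_const mN Eq dq _ _ VT eV) => [w|y th Ey Tth].
    exact: good_iter.
  apply: (meas_iter mN Eq dq phi'good (t0 := 0)) => // t y' th' _ Ey' Tth'.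
  exact: (maps_block_meas mN dq (phi'meas t) (fun w => phi'good w t) Ey' Tth').
apply: (@global_contraction _ _ _ P _ _ _ mN E q Eq dq U Theta eT eTT dT (sigma_maps Theta M h) phi phi'
  (good_path N E Theta) SSd gs gg fs fe phi'good phi'meas phi'ae r) => //.
- move=> th Tth; have [Ls Lc Lb] := lip r0.
  have mL : measurable_fun setT (fun w => Lam r 0 w th).
    apply: measurable_of_lt => c.
    have := Ls.1 0 [set f | f th < c]; rewrite setTI; apply.
    apply: sub_sigma_algebra; exists th, [set x | x < c]; split=> //.
    by apply: sub_sigma_algebra; exact: open_lt.
  have g0 w : (0 <= ereal_sup [set (log_plus (Lam r 0 w th))%:E | th in Theta])%E.
    apply: le_trans (ereal_sup_ubound _); last by exists th.
    by rewrite lee_fin log_plus_ge0.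
  have mlp (f : T -> R) : measurable_fun setT f -> measurable_fun setT (fun w : T => log_plus (f w)).
    by move=> mf; apply: measurable_maxr => //; apply: measurableT_comp => //; exact: measurable_ln.
  have Li : integr (fun w => log_plus (Lam r 0 w th)).
    apply: (integr_le_integral (mlp _ mL) (fun w => log_plus_ge0 _) _ g0 mom).
    by apply: aeW => w; apply: ereal_sup_ubound; exists th.
  have [delta [delta0 bi bneg]] := log_negative_truncation mL Li (neg Tth).
  pose G w := lip_const N q eT (iter_maps (phi' ^~ w) r 0).
  have mG : measurable_fun setT G by exact: (mlc Theta).
  have Gi : integr (fun w => log_plus (G w)).
    apply: (integr_le_integral (mlp _ mG) (fun w => log_plus_ge0 _) _ g0 mom).
    apply: filterS2 Lb phi'ae => w Lb e.
    have := g0 w; case E1 : (ereal_sup _) => [s| |] //; last by move=> _; rewrite leey.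
    rewrite !lee_fin => s0; rewrite -(log_plus_expR s0); apply: le_log_plus.
    apply: (lip_const_le mN Eq eTT); first exact: expR_ge0.
    move=> th' x y Tth' Ex Ey; have [L0 hl] := Lb 0 th' Tth'.
    have := lipschitz_coefP L0 hl Ex Ey; rewrite !phi_iterE.
    have -> : phi ^~ w = phi' ^~ w by apply/funext => t; rewrite e.
    move=> /le_trans; apply; apply: ler_wpM2r; first exact: prod_dist_ge0.
    apply: log_plusP => //; rewrite -lee_fin -E1; apply: ereal_sup_ubound.
    by exists th'.
  have de j : exists e : nat -> U, (forall n, (Theta `&` ball th j.+1%:R^-1) (e n)) /\
      forall x (r : R), (Theta `&` ball th j.+1%:R^-1) x -> 0 < r -> exists n, ball x r (e n).
    have [|e e1 e2] := compact_dense_seq cT (V := Theta `&` ball th j.+1%:R^-1) (@subIsetl _ _ _).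
      by exists th; split=> //; apply: ballxx; rewrite invr_gt0.
    by exists e.
  have [e /all_and2[eV ed]] := boolp.choice de.
  pose c j w := ln (Num.max (lip_const N q (e j) (iter_maps (phi' ^~ w) r 0)) delta).
  pose b w := ln (Num.max (Lam r 0 w th) delta).
  have mc j : measurable_fun setT (c j).
    apply: measurableT_comp; first exact: measurable_ln.
    apply: measurable_maxr; last exact: measurable_cst.
    exact: (mlc (Theta `&` ball th j.+1%:R^-1)).
  have mb : measurable_fun setT b by exact: integr_meas bi.
  pose g w := `|ln delta| + log_plus (G w) + log_plus (Lam r 0 w th).
  have gi : integr g by apply: integrD => //; apply: integrD => //; exact: integr_cst.
  have ceT j w : lip_const N q (e j) (iter_maps (phi' ^~ w) r 0) <= G w.
    have git := good_iter mN r 0 (phi'good w).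
    apply: (lip_const_le mN Eq (eV j)); first exact: (lip_const_ge0 mN Eq (fun x => id) eTT git).
    by move=> th' x y [Tth' _] Ex Ey; exact: (lip_constP mN Eq dq (fun x => id) eTT dT git).
  have cg j w : `|c j w| <= g w.
    apply: le_trans (ln_max_bound _ delta0) _; rewrite /g -addrA lerD2l.
    by rewrite (le_trans (le_log_plus (ceT j w)))// lerDl log_plus_ge0.
  have bg w : `|b w| <= g w.
    apply: le_trans (ln_max_bound _ delta0) _; rewrite /g -addrA lerD2l.
    by rewrite lerDr log_plus_ge0.
  have ci j : integr (c j) by exact: integr_le (cg j) gi.
  (* Only an upper bound for [c j] is available in the limit; the maximum with [b] turns it into a
     convergence to which dominated convergence applies. *)
  have cvc : Ex (fun w => Num.max (c j w) (b w)) @[j --> \oo] --> Ex b.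
    apply: Ex_dominated gi _ _ => //; first by move=> j; exact: measurable_maxr.
      apply: filterS3 Lb Lc phi'ae => w Lb Lc e'.
      (* An increment [eps * delta] of the constant raises its logarithm, truncated at [delta], by
         at most [eps]: this is [ln_max_add]. *)
      apply/cvgrPdist_le => eps eps0; have eta0 : 0 < eps * delta by exact: mulr_gt0.
      have := within_continuous_near (Lc 0) Tth eta0.
      move=> /nbhs_ballP[rho /= rho0 hrho].
      exists (Num.truncn rho^-1) => // j /= rj.
      have jr : j.+1%:R^-1 < rho.
        rewrite -[rho]invrK ltf_pV2 ?posrE ?invr_gt0//.
        by apply: lt_le_trans (truncnS_gt _) _; rewrite ler_nat.
      have Lth := (Lb 0 th Tth).1; have ph : phi ^~ w = phi' ^~ w by apply/funext => t; rewrite e'.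
      have lj : lip_const N q (e j) (iter_maps (phi' ^~ w) r 0) <= Lam r 0 w th + eps * delta.
        apply: (lip_const_le mN Eq (eV j)); first by rewrite addr_ge0// ltW.
        move=> th' x y [Tth' bth'] Ex Ey; have [L0 hl] := Lb 0 th' Tth'.
        have := lipschitz_coefP L0 hl Ex Ey; rewrite !phi_iterE ph.
        move=> /le_trans; apply; apply: ler_wpM2r; first exact: prod_dist_ge0.
        have := hrho th' (le_ball (ltW jr) bth') Tth'.
        by rewrite /ball/= distrC ltr_distl => /andP[_ /ltW].
      rewrite distrC ger0_norm ?subr_ge0 ?le_max ?lexx ?orbT// lerBlDl ge_max lerDl (ltW eps0) andbT.
      apply: le_trans (ln_max_add Lth delta0 (ltW eps0)).
      rewrite ler_ln ?posrE ?lt_max ?delta0 ?orbT// ge_max !le_max lj/= lexx orbT.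
      by [].
    by move=> j w; have [_|_] := leP (c j w) (b w); [exact: bg|exact: cg].
  move: cvc => /cvgr_lt/(_ _ bneg)[j _ /(_ j (leqnn j))/= hj].
  exists (ball th j.+1%:R^-1), (e j), delta; split.
  - by apply: nbhsx_ballx; rewrite invr_gt0.
  - exact: eV.
  - exact: ed.
  - exact: delta0.
  - split; first exact: ci.
    by apply: le_lt_trans hj; apply: (Ex_le (ci j) (integr_max (ci j) bi)) => w; rewrite le_max lexx.
- move=> u t; have [B B0 hB] := good_map_jump_bounded cT (svalP u t) Ey0.
  by exists B => _ [n _ <-]; exact: hB.
- have j0 w : (0 <= ereal_sup [set (log_plus (dE (phi 0 w y0 th) y0))%:E | th in Theta])%E.
    apply: le_trans (ereal_sup_ubound _); last by exists theta0.
    by rewrite lee_fin log_plus_ge0.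
  apply: (integr_le_integral _ (fun w => log_plus_ge0 _) _ j0 jump).
    apply: measurable_maxr => //; apply: (measurableT_comp (f := @ln R)); first exact: measurable_ln.
    apply: measurable_sup_seq => [n|w].
      apply: (meas_dist mN Eq dq) => //; first by move=> w; apply: (good_stable (phi'good w 0)).
      exact: (maps_block_meas mN dq (phi'meas 0) (fun w => phi'good w 0) Ey0 (eTT n)).
    have [B B0 hB] := good_map_jump_bounded cT (phi'good w 0) Ey0.
    by exists B => _ [n _ <-]; exact: hB.
  apply: filterS phi'ae => w e; apply: log_plus_sup_le => n.
  by apply: ereal_sup_ubound; exists (eT n) => //=; rewrite e.
Qed.

End model_contraction.

(** * Orthogonal sums and independence of the past *)

Section orthogonal_averages.
Context d (T : measurableType d) (R : realType) (P : probability T R).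
Local Notation integr f := (P.-integrable setT (EFin \o f)).
Local Notation Ex f := (Rintegral P setT f).

(** The sum of the series has finite mean, so the series converges almost surely and its terms
    vanish in the limit. *)
Lemma bounded_Ex_partial_sums (f : nat -> T -> R) (C : R) :
  (forall k, integr (f k)) -> (forall k w, 0 <= f k w) ->
  (forall n, \sum_(k < n) Ex (f k) <= C) ->
  {ae P, forall w, f n w @[n --> \oo] --> (0 : R)}.
Proof.
move=> fi f0 fC; pose g (n : nat) w := \sum_(k < n) f k w.
have gi n : integr (g n) by apply: integr_sum.
have gnd w : {homo g^~ w : n k / (n <= k)%N >-> n <= k}.
  apply: homo_leq => [//|x y z|n]; first exact: le_trans.
  by rewrite /g big_ord_recr /= lerDl.
have g0 n w : 0 <= g n w by exact: sumr_ge0.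
pose G w := limn (fun n => (g n w)%:E).
have cvg_g w : (g n w)%:E @[n --> \oo] --> G w.
  by apply: ereal_nondecreasing_is_cvgn => i j ij; rewrite lee_fin gnd.
have mG : measurable_fun setT G.
  apply: (@emeasurable_fun_cvg _ _ _ setT (fun n w => (g n w)%:E)) => [n|w _]; last exact: cvg_g.
  by apply/measurable_EFinP; exact: integr_meas.
have G0 w : (0 <= G w)%E by apply: lime_ge; [exact/cvgP/cvg_g|apply: nearW => n; rewrite lee_fin].
have GC : (\int[P]_w G w <= C%:E)%E.
  have cv : (\int[P]_w (g n w)%:E @[n --> \oo] --> \int[P]_w G w)%E.
    apply: cvg_monotone_convergence => //.
    - by move=> n; apply/measurable_EFinP; exact: integr_meas.
    - by move=> n w _; rewrite lee_fin.
    - by move=> w _ a b ab; rewrite lee_fin gnd.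
  rewrite -(cvg_lim _ cv)//; apply: lime_le; first exact/cvgP/cv.
  apply: nearW => n; rewrite -[leLHS]fineK; last exact: (integrable_fin_num measurableT (gi n)).
  by rewrite lee_fin; have := fC n; rewrite -Ex_sum.
have Gi : P.-integrable setT G.
  apply/integrableP; split=> //; under eq_integral do rewrite gee0_abs//.
  by apply: le_lt_trans GC _; rewrite ltry.
have := integrable_ae measurableT Gi; apply: filterS => w /(_ Logic.I) finG.
have cs : cvgn (series (f ^~ w)).
  apply: nondecreasing_is_cvgn.
    by move=> i j ij; rewrite /series /= !big_mkord; exact: gnd.
  exists (fine (G w)) => _ [n _ <-]; rewrite -lee_fin fineK// /series /= big_mkord.
  rewrite /G (cvg_lim _ (ereal_nondecreasing_cvgn _))//.
    by apply: ereal_sup_ubound; exists n.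
  by move=> i j ij; rewrite lee_fin gnd.
exact: cvg_series_cvg_0.
Qed.

Lemma sum_inv_sqr (n : nat) : \sum_(k < n) (k.+2%:R ^- 2 : R) <= 1 - n.+1%:R^-1.
Proof.
elim: n => [|n ih]; first by rewrite big_ord0 invr1 subrr.
rewrite big_ord_recr /=; apply: le_trans (lerD ih (lexx _)) _.
have h : (n.+2%:R ^- 2 : R) <= n.+1%:R^-1 - n.+2%:R^-1.
  have a0 : (0 : R) < n.+1%:R by []. have b0 : (0 : R) < n.+2%:R by [].
  have -> : (n.+1%:R^-1 - n.+2%:R^-1 : R) = (n.+1%:R * n.+2%:R)^-1.
    have -> : n.+2%:R = n.+1%:R + 1 :> R by rewrite natr1.
    by field; apply/andP; split; rewrite gt_eqF// addr_gt0.
  rewrite lef_pV2 ?posrE ?mulr_gt0// ?exprn_gt0// expr2; apply: ler_wpM2r; first exact: ltW.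
  by rewrite ler_nat.
by rewrite -addrA lerD2l -lerBrDl opprK addrC.
Qed.

Lemma sqrt_bracket (n : nat) : exists a : nat, (a ^ 2 <= n < a.+1 ^ 2)%N.
Proof.
elim: n => [|n [a /andP[h1 h2]]]; first by exists 0%N.
have [h|h] := ltnP n.+1 (a.+1 ^ 2); first by exists a; rewrite h (leq_trans h1).
exists a.+1; rewrite h /=; apply: leq_ltn_trans h2 _; by rewrite ltn_exp2r.
Qed.

Variables (D : nat -> T -> R) (K : R).
Hypotheses (mD : forall n, measurable_fun setT (D n)) (DK : forall n w, `|D n w| <= K).
Hypothesis orth : forall i j, (i < j)%N -> Ex (fun w => D i w * D j w) = 0.

Lemma orthogonal_sum_sqr n : Ex (fun w => (\sum_(k < n) D k w) ^+ 2) <= K ^+ 2 * n%:R.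
Proof.
have K0 : 0 <= K by exact: le_trans (normr_ge0 _) (DK 0%N point).
have Dii i j : integr (fun w => D i w * D j w).
  apply: (@integr_bounded _ _ _ P _ (K * K)); first exact: measurable_funM.
  by move=> w; rewrite normrM ler_pM.
elim: n => [|n ih].
  rewrite mulr0; under eq_Rintegral do rewrite big_ord0 expr0n /=.
  by rewrite Ex_cst.
have -> : (fun w => (\sum_(k < n.+1) D k w) ^+ 2) =
    (fun w => (\sum_(k < n) D k w) ^+ 2 + (2 * (\sum_(k < n) D k w * D n w) + D n w * D n w)).
  by apply/funext => w; rewrite big_ord_recr /= -mulr_suml; ring.
have iS : integr (fun w => (\sum_(k < n) D k w) ^+ 2).
  have -> : (fun w => (\sum_(k < n) D k w) ^+ 2) = (fun w => \sum_(k < n) \sum_(l < n) D k w * D l w).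
    by apply/funext => w; rewrite expr2 mulr_suml; apply: eq_bigr => k _; rewrite mulr_sumr.
  by apply: integr_sum => k; apply: integr_sum => l.
have iX : integr (fun w => \sum_(k < n) D k w * D n w) by apply: integr_sum.
rewrite ExD//; last by apply: integrD => //; exact: integrZ.
rewrite ExD//; last exact: integrZ.
rewrite ExZ// Ex_sum// big1 => [|k _]; last by rewrite orth.
rewrite mulr0 add0r -natr1 mulrDr mulr1; apply: lerD => //.
rewrite -[leRHS](Ex_cst P); apply: Ex_le => //; first exact: integr_cst.
by move=> w; rewrite -expr2 -[leLHS]real_normK ?num_real// ler_sqr ?nnegrE.
Qed.

(** Along the squares [a^2] the normalized sums have second moments of order [1 / a^2], which are
    summable. Between consecutive squares there are at most about [2 a] bounded terms, negligible
    against [a^2]. *)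
Lemma orthogonal_lln : {ae P, forall w, forall e, 0 < e ->
  \forall n \near \oo, `|\sum_(k < n) D k w| <= e * n%:R}.
Proof.
have K0 : 0 <= K by exact: le_trans (normr_ge0 _) (DK 0%N point).
pose S n w := \sum_(k < n) D k w.
have mS n : measurable_fun setT (S n) by apply: measurable_sum.
have SK n w : `|S n w| <= K * n%:R.
  apply: le_trans (ler_norm_sum _ _ _) _; rewrite mulr_natr -[n in leRHS]card_ord -sumr_const.
  by apply: ler_sum.
pose f k w := (S (k.+2 ^ 2)%N w / (k.+2 ^ 2)%:R) ^+ 2.
have fi k : integr (f k).
  apply: (@integr_bounded _ _ _ P _ (K ^+ 2)).
    by apply: measurable_funX; apply: measurable_funM.
  move=> w; rewrite normrX ler_sqr ?nnegrE// normrM normfV normr_nat.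
  by rewrite ler_pdivrMr ?ltr0n ?expn_gt0.
have fE k : Ex (f k) <= K ^+ 2 * k.+2%:R ^- 2.
  have -> : f k = fun w => (k.+2 ^ 2)%:R ^- 2 * S (k.+2 ^ 2)%N w ^+ 2.
    by apply/funext => w; rewrite /f expr_div_n mulrC.
  rewrite ExZ; last first.
    have h := integrZ ((k.+2 ^ 2)%:R ^+ 2) (fi k).
    rewrite (_ : (fun w => _) = (fun w => (k.+2 ^ 2)%:R ^+ 2 * f k w))//.
    by apply/funext => w; rewrite /f expr_div_n mulrCA divff ?mulr1// expf_neq0// pnatr_eq0 expn_eq0.
  rewrite mulrC ler_pdivrMr ?exprn_gt0 ?ltr0n ?expn_gt0//.
  apply: le_trans (orthogonal_sum_sqr _) _; rewrite natrX le_eqVlt; apply/orP; left; apply/eqP.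
  have : k.+2%:R != 0 :> R by rewrite pnatr_eq0.
  by set x := k.+2%:R => x0; field.
have aef : {ae P, forall w, f n w @[n --> \oo] --> (0 : R)}.
  apply: (@bounded_Ex_partial_sums f (K ^+ 2)) => //; first by move=> k w; exact: sqr_ge0.
  move=> n; apply: (@le_trans _ _ (\sum_(k < n) K ^+ 2 * k.+2%:R ^- 2)); first by apply: ler_sum.
  rewrite -mulr_sumr -[leRHS]mulr1.
  apply: ler_wpM2l; first exact: sqr_ge0.
  by apply: le_trans (sum_inv_sqr n) _; rewrite gerBl invr_ge0.
apply: filterS aef => w cf e e0.
have e2 : 0 < e / 2 by rewrite divr_gt0.
have e22 : 0 < (e / 2) ^+ 2 by exact: exprn_gt0.
move/cvgr_lt: cf => /(_ _ e22)[n0 _ hn].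
pose n1 := (Num.truncn (6 * K / e)).+1.
exists ((maxn n0.+2 n1) ^ 2)%N => // n /= nn.
have [a /andP[an na]] := sqrt_bracket n.
have ma : (maxn n0.+2 n1 <= a)%N.
  by rewrite -ltnS -(ltn_exp2r _ _ (isT : (0 < 2)%N)); exact: leq_ltn_trans na.
move: ma; rewrite geq_max => /andP[n0a n1a].
case: a an na n0a n1a => [|[|a]] // an na n0a n1a.
have Sa : `|S (a.+2 ^ 2)%N w| <= e / 2 * (a.+2 ^ 2)%:R.
  have /= := hn a n0a; rewrite /f -[X in X < _]real_normK ?num_real// ltr_sqr ?nnegrE ?(ltW e2)//.
  by rewrite normrM normfV normr_nat ltr_pdivrMr ?ltr0n ?expn_gt0// => /ltW.
have Sij i j : `|S (i + j)%N w - S i w| <= K * j%:R.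
  elim: j => [|j ih]; first by rewrite addn0 subrr normr0 mulr0.
  rewrite addnS {1}/S big_ord_recr /= -/(S _ w) addrAC -natr1 mulrDr mulr1.
  by apply: le_trans (ler_normD _ _) (lerD ih (DK _ _)).
have := Sij (a.+2 ^ 2)%N (n - a.+2 ^ 2)%N; rewrite subnKC// => Sn.
have nb : (n - a.+2 ^ 2 <= 2 * a.+2)%N by rewrite leq_subLR; move: na; rewrite -[a.+3]addn1 sqrnD; lia.
have Kb : K * 2 <= e / 2 * a.+2%:R.
  have : 6 * K / e < a.+2%:R by apply: lt_le_trans (truncnS_gt _) _; rewrite ler_nat.
  rewrite ltr_pdivrMr//; lra.
have Kn : K * (n - a.+2 ^ 2)%:R <= e / 2 * (a.+2 ^ 2)%:R.
  apply: (@le_trans _ _ (K * (2 * a.+2%:R))).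
    by apply: ler_wpM2l => //; rewrite -natrM ler_nat.
  by rewrite mulrA natrX expr2 [leRHS]mulrA; apply: ler_wpM2r.
rewrite -[\sum_(k < n) _]/(S n w) -[S n w](subrK (S (a.+2 ^ 2)%N w)).
apply: le_trans (ler_normD _ _) _; apply: le_trans (lerD Sn Sa) _.
have : e * (a.+2 ^ 2)%:R <= e * n%:R by apply: ler_wpM2l; [exact: ltW|rewrite ler_nat].
move: Kn; lra.
Qed.

End orthogonal_averages.

(** * Expectations of independent products, and independence of the past *)

Section independent_products.
Context d (T : measurableType d) (R : realType) (P : probability T R).
Local Notation integr f := (P.-integrable setT (EFin \o f)).
Local Notation Ex f := (Rintegral P setT f).

(** Independence on rectangles identifies the law of the pair with the product law; with absolute
    values Tonelli's theorem applies without integrability. *)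
Lemma independent_integral (f g : T -> R) : measurable_fun setT f -> measurable_fun setT g ->
  (forall A B : set R, measurable A -> measurable B ->
    P (f @^-1` A `&` g @^-1` B) = (P (f @^-1` A) * P (g @^-1` B))%E) ->
  (\int[P]_w (`|f w| * `|g w|)%:E = \int[P]_w `|f w|%:E * \int[P]_w `|g w|%:E)%E.
Proof.
move=> mf mg ind.
pose h w := (f w, g w).
have mh : measurable_fun setT h by apply/measurable_fun_pairP.
pose F : {mfun T >-> R} := mfun_Sub (mem_set mf).
pose G : {mfun T >-> R} := mfun_Sub (mem_set mg).
pose H : {mfun T >-> (R * R)%type} := mfun_Sub (mem_set mh).
pose k (z : R * R) := (`|z.1| * `|z.2|)%:E.
have mk : measurable_fun setT k.
  apply/measurable_EFinP; apply: measurable_funM; apply: measurableT_comp => //.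
have k0 z : (0 <= k z)%E by rewrite lee_fin mulr_ge0.
have mabs : measurable_fun setT (fun x : R => `|x|%:E).
  by apply/measurable_EFinP; exact: normr_measurable.
have -> : (\int[P]_w (`|f w| * `|g w|)%:E = \int[distribution P H]_z k z)%E.
  by rewrite ge0_integral_distribution.
have -> : (\int[distribution P H]_z k z = \int[distribution P F \x distribution P G]_z k z)%E.
  apply: eq_measure_integral => A mA _; apply/esym/product_measure_unique => // B C mB mC.
rewrite fubini_tonelli1//.
transitivity (\int[distribution P F]_x (`|x|%:E * \int[P]_w `|g w|%:E))%E.
  apply: eq_integral => x _; rewrite /fubini_F /k /=.
  under eq_integral do rewrite EFinM.
  rewrite ge0_integralZl//.
  by congr (_ * _)%E; rewrite ge0_integral_distribution.
rewrite ge0_integralZr//.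
- by rewrite ge0_integral_distribution.
- by apply: integral_ge0 => w _; rewrite lee_fin.
Qed.

(** Adding the bound [K] to both factors makes them nonnegative; expanding the product then returns
    the signed identity. *)
Lemma independent_Ex (f g : T -> R) (K : R) :
  measurable_fun setT f -> measurable_fun setT g ->
  (forall A B : set R, measurable A -> measurable B ->
    P (f @^-1` A `&` g @^-1` B) = (P (f @^-1` A) * P (g @^-1` B))%E) ->
  (forall w, `|f w| <= K) -> (forall w, `|g w| <= K) ->
  Ex (fun w => f w * g w) = Ex f * Ex g.
Proof.
move=> mf mg ind fK gK.
have fi := @integr_bounded _ _ _ P f K mf fK; have gi := @integr_bounded _ _ _ P g K mg gK.
have fgi : integr (fun w => f w * g w).
  apply: (@integr_bounded _ _ _ P _ (K * K)); first exact: measurable_funM.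
  by move=> w; rewrite normrM ler_pM.
have mD (u : T -> R) : measurable_fun setT u -> measurable_fun setT (fun w => u w + K).
  by move=> mu; apply: measurable_funD.
have mS : measurable_fun setT (fun x : R => x + K) by apply: measurable_funD.
have indK (A B : set R) : measurable A -> measurable B ->
    P ((fun w => (f w + K)%R) @^-1` A `&` (fun w => (g w + K)%R) @^-1` B) =
    (P ((fun w => (f w + K)%R) @^-1` A) * P ((fun w => (g w + K)%R) @^-1` B))%E.
  move=> mA mB; apply: (ind ((fun x => x + K) @^-1` A) ((fun x => x + K) @^-1` B)).
    by rewrite -[X in measurable X]setTI; exact: mS.
  by rewrite -[X in measurable X]setTI; exact: mS.
have := independent_integral (mD _ mf) (mD _ mg) indK.
have pos (u : T -> R) w : (forall w, `|u w| <= K) -> `|u w + K| = u w + K.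
  move=> uK; apply: ger0_norm; have := uK w; rewrite ler_norml => /andP[h _].
  by rewrite -lerBlDr sub0r.
under eq_integral do rewrite !pos//.
under [X in (_ = X * _)%E -> _]eq_integral do rewrite pos//.
under [X in (_ = _ * X)%E -> _]eq_integral do rewrite pos//.
have fiK : integr (fun w => f w + K) by apply: integrD => //; exact: integr_cst.
have giK : integr (fun w => g w + K) by apply: integrD => //; exact: integr_cst.
have pE : (fun w => (f w + K) * (g w + K)) = (fun w => f w * g w + (K * f w + (K * g w + K * K))).
  by apply/funext => w; ring.
have iZf := integrZ K fi; have iZg := integrZ K gi; have iKK := integr_cst P (K * K).
have pi : integr (fun w => (f w + K) * (g w + K)).
  by rewrite pE; apply: integrD => //; apply: integrD => //; apply: integrD.
rewrite -[LHS]fineK; last exact: (integrable_fin_num measurableT pi).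
rewrite -[X in (X * _)%E]fineK; last exact: (integrable_fin_num measurableT fiK).
rewrite -[X in (_ * X)%E]fineK; last exact: (integrable_fin_num measurableT giK).
rewrite -EFinM => -[].
rewrite -/(Rintegral P setT _) -/(Rintegral P setT (fun w => f w + K)) -/(Rintegral P setT (fun w => g w + K)).
have i3 := integrD iZg iKK; have i2 := integrD iZf i3; have iK := integr_cst P K.
rewrite pE (ExD fgi i2) (ExD iZf i3) (ExD iZg iKK) (ExD fi iK) (ExD gi iK) !ExZ// !Ex_cst.
lra.
Qed.

Lemma ae_null_setP (Q : T -> Prop) : {ae P, forall w, Q w} ->
  exists2 A, measurable A /\ P A = 0%E & forall w, ~ A w -> Q w.
Proof.
by move=> [A [mA A0 QA]]; exists A => // w nA; apply: contrapT => nQ; apply: nA; exact: QA.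
Qed.

Context (S : topologicalType) (Z : int -> T -> S).
Hypothesis Ziid : iid P Z.

(* The null events are adjoined because the maps are replaced by an almost surely equal
   modification, which need not be measurable with respect to the past itself. *)
Definition past_events (t : int) : set_system T :=
  [set A | sigma_gen [set s | s <= t - 1] Z A \/ measurable A /\ P A = 0%E].

Definition past_space (t : int) := g_sigma_algebraType (past_events t).

(** A family stable under intersection: conditions at the times [t - 1], [t - 2], ..., trivial from
    some rank on, together with the null events. *)
Let cylinder (t : int) : set_system T := [set A | (measurable A /\ P A = 0%E) \/
  exists n (B : nat -> set S), [/\ forall k, borel (B k), forall k, (n <= k)%N -> B k = setT &
    A = \bigcap_k Z (t - k.+1%:Z) @^-1` B k]].

Lemma iid_measurable t B : borel B -> measurable (Z t @^-1` B).
Proof. by move=> bB; have [mZ _ _] := Ziid; have := mZ t B bB; rewrite setTI. Qed.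

Lemma borelT : borel [set: S].
Proof. by rewrite -setC0; apply: sigma_setC; exact: sigma_algebra0. Qed.

Lemma cylinder_setI t : setI_closed (cylinder t).
Proof.
have null A B : measurable A -> P A = 0%E -> measurable B -> measurable (A `&` B) /\ P (A `&` B) = 0%E.
  move=> mA A0 mB; have mAB := measurableI _ _ mA mB; split=> //; apply/eqP.
  by rewrite eq_le measure_ge0 andbT -A0 le_measure ?inE.
have mcyl B : (forall k, borel (B k)) -> measurable (\bigcap_k Z (t - k.+1%:Z) @^-1` B k).
  by move=> bB; apply: bigcap_measurableType => k _; exact: iid_measurable.
move=> A B [[mA A0]|[n [C [bC nC ->]]]] [[mB B0]|[n' [C' [bC' nC' ->]]]].
- by left; exact: null.
- by left; apply: null => //; exact: mcyl.
- by left; rewrite setIC; apply: null => //; exact: mcyl.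
right; exists (maxn n n'), (fun k => C k `&` C' k); split.
- by move=> k; rewrite -bigcap2E; apply: sigma_bigcap => -[|[|i]] /=; [exact: bC|exact: bC'|exact: borelT].
- by move=> k; rewrite geq_max => /andP[nk nk']; rewrite nC// nC'// setIT.
- by rewrite -bigcapI.
Qed.

Lemma past_events_cylinder t : <<s past_events t >> `<=` <<s cylinder t >>.
Proof.
apply: smallest_sub; first exact: smallest_sigma_algebra.
move=> A [|[mA A0]]; last by apply: sub_sigma_algebra; left.
apply: smallest_sub; first exact: smallest_sigma_algebra.
move=> _ [s [B [/= st bB ->]]]; apply: sub_sigma_algebra; right.
pose k := absz (t - 1 - s)%R; have ks : t - k.+1%:Z = s by rewrite /k; lia.
exists k.+1, (fun i => if i == k then B else setT); split.
- by move=> i; case: eqP => // _; exact: borelT.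
- by move=> i ki; case: eqP => // e; rewrite e ltnn in ki.
- apply/seteqP; split => [w Bw i _|w /(_ k Logic.I)]; last by rewrite /= eqxx ks.
  by rewrite /=; case: eqP => // ->; rewrite ks.
Qed.

(** Dynkin's lemma over the cylinders, where the product formula of [iid] is used with and without
    the time [t]. Measurability for [T] is carried along the induction, since the formulas for
    complements and unions use it. *)
Lemma past_independent (t : int) (A : set T) (B : set S) : <<s past_events t >> A -> borel B ->
  P (A `&` Z t @^-1` B) = (P A * P (Z t @^-1` B))%E.
Proof.
move=> /past_events_cylinder cA bB; have mC := iid_measurable t bB.
set C := Z t @^-1` B in mC *.
have fC : P C \is a fin_num by exact: fin_num_measure.
suff [] : measurable A /\ P (A `&` C) = (P A * P C)%E by [].
have compl (D : set T) : measurable D -> P (D `&` C) = (P D * P C)%E ->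
    measurable (~` D) /\ P (~` D `&` C) = (P (~` D) * P C)%E.
  move=> mD DC; split; first exact: measurableC.
  have -> : ~` D `&` C = C `\` D by rewrite setDE setIC.
  rewrite measureD//; last by rewrite ltey_eq fC.
  rewrite [X in (_ - X)%E](_ : _ = (P D * P C)%E); last by rewrite setIC; exact: DC.
  have PC : P C = (fine (P C))%:E by rewrite fineK.
  have PD : P D = (fine (P D))%:E by rewrite fineK// fin_num_measure.
  rewrite probability_setC// [X in (X - _)%E](_ : _ = (fine (P C))%:E)//.
  rewrite PD PC /= -EFinM -EFinB.
  by apply: (congr1 EFin (_ : _ = (1 - fine (P D)) * fine (P C))); rewrite mulrBl mul1r.
have union (D : nat -> set T) : trivIset setT D ->
    (forall k, measurable (D k) /\ P (D k `&` C) = (P (D k) * P C)%E) ->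
    measurable (\bigcup_k D k) /\ P ((\bigcup_k D k) `&` C) = (P (\bigcup_k D k) * P C)%E.
  move=> tD DC; have mD k : measurable (D k) := (DC k).1.
  split; first exact: bigcup_measurable.
  rewrite setI_bigcupl !measure_bigcup//; last 2 first.
  + by move=> k _; exact: measurableI.
  + exact: trivIset_setIr.
  rewrite muleC -[P C]fineK// -nneseriesZl//; apply: eq_eseriesr => k _.
  by rewrite muleC fineK//; exact: (DC k).2.
pose Tc := g_sigma_algebraType (cylinder t).
apply: (@dynkin_induction _ Tc (cylinder t) (fun A => @measurable _ T A /\ P (A `&` C) = (P A * P C)%E)) => //.
- exact: cylinder_setI.
- by split; [exact: measurableT|rewrite setTI probability_setT mul1e].
- move=> D [[mD D0]|[n [E [bE nE ->]]]].
    split=> //; rewrite D0 mul0e; apply/eqP; rewrite eq_le measure_ge0 andbT -D0.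
    by apply: le_measure; rewrite ?inE//; exact: measurableI.
  split; first by apply: bigcap_measurableType => k _; exact: iid_measurable.
  have [_ _ iidE] := Ziid.
  pose s := [seq t - k.+1%:Z | k <- iota 0 n].
  have us : uniq s by rewrite map_inj_uniq ?iota_uniq// => i j /addrI/oppr_inj[].
  have sE k : (k < n)%N -> t - k.+1%:Z \in s by move=> kn; apply: map_f; rewrite mem_iota.
  have sP u : u \in s -> exists2 k, (k < n)%N & u = t - k.+1%:Z.
    by move=> /mapP[k]; rewrite mem_iota => kn ->; exists k.
  pose F (u : int) := E (absz (t - u)).-1.
  have FE k : F (t - k.+1%:Z) = E k by rewrite /F; congr E; lia.
  have cE : \bigcap_k Z (t - k.+1%:Z) @^-1` E k = \bigcap_(u in [set` s]) Z u @^-1` F u.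
    apply/seteqP; split => w Ew.
      by move=> u /sP[k kn ->]; rewrite /preimage /= FE; exact: Ew.
    move=> k _; have [kn|kn] := ltnP k n; last by rewrite nE.
    by have := Ew _ (sE _ kn); rewrite /preimage /= FE.
  have bF u : borel (F u) by exact: bE.
  rewrite cE (iidE s F us bF).
  pose F' u := if u == t then B else F u.
  have tns : t \notin s.
    by apply/negP => /sP[k _] /eqP; rewrite -subr_eq0 opprB addrC subrK.
  have us' : uniq (t :: s) by rewrite /= tns.
  have bF' u : borel (F' u) by rewrite /F'; case: eqP.
  have F'E u : u \in s -> F' u = F u.
    by rewrite /F'; case: eqP => // -> ts; rewrite ts in tns.
  have F't : F' t = B by rewrite /F' eqxx.
  have prodE : (\prod_(u <- s) P (Z u @^-1` F' u) = \prod_(u <- s) P (Z u @^-1` F u))%E.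
    by apply: eq_big_seq => u us1; rewrite F'E.
  have := iidE (t :: s) F' us' bF'; rewrite big_cons prodE F't muleC => <-; congr (P _).
  apply/seteqP; split => [w [Fw Cw] u|w Fw].
    by rewrite /= inE => /predU1P[->|us1]; rewrite /preimage /= ?F't// F'E//; exact: Fw.
  split; last by have := Fw t (mem_head _ _); rewrite /preimage /= F't.
  by move=> u us1; have := Fw u (mem_behead (s := t :: s) us1); rewrite /preimage /= F'E.
- by move=> D _ [mD DC]; exact: compl.
- by move=> D _ tD DC; exact: union.
Qed.

End independent_products.

(** * Measurability of matrix functions *)

Section matrix_measurability.
Context d (T : measurableType d) (R : realType).
Local Notation meas f := (measurable_fun [set: T] f).

Lemma measurable_invr (f : T -> R) : meas f -> meas (fun w => (f w)^-1).
Proof.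
move=> mf; have m0 : meas (fun=> 0 : R) by exact: measurable_cst.
rewrite (_ : (fun w => _) = fun w => if 0 < f w then expR (- ln (f w)) else
    if f w < 0 then - expR (- ln (- f w)) else 0).
  apply: measurable_fun_ifT; first exact: measurable_fun_ltr.
    by apply: (measurableT_comp (f := @expR R)) => //; apply: measurableT_comp => //;
      apply: measurableT_comp => //; exact: measurable_ln.
  apply: measurable_fun_ifT => //; first exact: measurable_fun_ltr.
  apply: measurableT_comp => //; apply: (measurableT_comp (f := @expR R)) => //; apply: measurableT_comp => //.
  by apply: measurableT_comp; [exact: measurable_ln|exact: measurableT_comp].
apply/funext => w; have [f0|f0|f0] := ltgtP 0 (f w).
- by rewrite expRN lnK.
- by rewrite expRN lnK ?posrE ?oppr_gt0// invrN opprK.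
- by rewrite -f0 invr0.
Qed.

Definition mx_meas m n (A : T -> 'M[R]_(m, n)) := forall i j, meas (fun w => A w i j).

Lemma mx_meas_cst m n (A : 'M[R]_(m, n)) : mx_meas (fun=> A).
Proof. by move=> i j; exact: measurable_cst. Qed.

Lemma mx_measD m n (A B : T -> 'M[R]_(m, n)) : mx_meas A -> mx_meas B ->
  mx_meas (fun w => A w + B w).
Proof. by move=> mA mB i j; under eq_fun do rewrite mxE; exact: measurable_funD. Qed.

Lemma mx_measZ m n (a : T -> R) (B : T -> 'M[R]_(m, n)) : meas a -> mx_meas B ->
  mx_meas (fun w => a w *: B w).
Proof. by move=> ma mB i j; under eq_fun do rewrite mxE; exact: measurable_funM. Qed.

Lemma mx_measB m n (A B : T -> 'M[R]_(m, n)) : mx_meas A -> mx_meas B ->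
  mx_meas (fun w => A w - B w).
Proof. by move=> mA mB i j; under eq_fun do rewrite !mxE; exact: measurable_funB. Qed.

Lemma mx_measM m n l (A : T -> 'M[R]_(m, n)) (B : T -> 'M[R]_(n, l)) :
  mx_meas A -> mx_meas B -> mx_meas (fun w => A w *m B w).
Proof.
move=> mA mB i j; under eq_fun do rewrite mxE.
by apply: measurable_sum => k; exact: measurable_funM.
Qed.

Lemma meas_det m (A : T -> 'M[R]_m) : mx_meas A -> meas (fun w => \det (A w)).
Proof.
move=> mA; apply: measurable_sum => s; apply: measurable_funM => //.
by apply: measurable_prod => i _; exact: mA.
Qed.

Lemma meas_trace m (A : T -> 'M[R]_m) : mx_meas A -> meas (fun w => \tr (A w)).
Proof. by move=> mA; apply: measurable_sum => s; exact: mA. Qed.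

Lemma meas_quad m (A : T -> 'M[R]_m) (x : T -> 'cV[R]_m) : mx_meas A -> mx_meas x ->
  meas (fun w => quad (A w) (x w)).
Proof.
move=> mA mx; under eq_fun do rewrite quadE.
apply: measurable_sum => i; apply: measurable_sum => j.
by apply: measurable_funM => //; exact: measurable_funM.
Qed.

Lemma meas_mx_norm m n (A : T -> 'M[R]_(m, n)) : mx_meas A -> meas (fun w => `|A w|).
Proof.
move=> mA; rewrite (_ : (fun w => _) = fun w => \big[Num.max/0]_ij `|A w ij.1 ij.2|).
  elim: (index_enum _) => [|ij s ih].
    by under eq_fun do rewrite big_nil; exact: measurable_cst.
  under eq_fun do rewrite big_cons; apply: measurable_maxr => //.
  by apply: measurableT_comp => //; exact: mA.
by apply/funext => w; rewrite [LHS]mx_normrE.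
Qed.

Lemma mx_meas_inv m (A : T -> 'M[R]_m) : (forall w, A w \in unitmx) -> mx_meas A ->
  mx_meas (fun w => invmx (A w)).
Proof.
move=> uA mA i j; under eq_fun do rewrite /invmx uA mxE.
apply: measurable_funM; first by apply: measurable_invr; exact: meas_det.
under eq_fun do rewrite mxE /cofactor; apply: measurable_funM => //.
by apply: meas_det => k l; under eq_fun do rewrite !mxE; exact: mA.
Qed.

Lemma mx_meas_sqrt m (A : T -> 'M[R]_m) : (forall w, psdmx (A w)) -> mx_meas A ->
  mx_meas (fun w => sqrtmx (A w)).
Proof.
move=> pA mA i j; have ms : meas (fun w => sqrt_scale (A w)).
  apply: measurable_funD => //; apply: measurable_funM => //.
  apply: measurable_sum => k; apply: measurable_sum => l; apply: measurableT_comp => //.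
apply: (@measurable_fun_cvg _ _ _ setT (fun k w => Num.sqrt (sqrt_scale (A w)) * ((i == j)%:R -
     riesz (1%:M - (sqrt_scale (A w))^-1 *: A w) k i j))) => [k|w _]; last first.
  by have [_ _ cv] := sqrtmxP (pA w); exact: cv.
apply: measurable_funM.
  by apply: measurableT_comp => //; apply: continuous_measurable_fun; exact: sqrt_continuous.
apply: measurable_funB => //.
have mC : mx_meas (fun w => 1%:M - (sqrt_scale (A w))^-1 *: A w).
  by apply: mx_measB; [exact: mx_meas_cst|apply: mx_measZ => //; exact: measurable_invr].
suff : mx_meas (fun w => riesz (1%:M - (sqrt_scale (A w))^-1 *: A w) k) by [].
elim: k => [|k ih] /=; first exact: mx_meas_cst.
by apply: mx_measZ => //; apply: mx_measD => //; exact: mx_measM.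
Qed.

End matrix_measurability.

Lemma mx_entry_le (R : realType) m n (A : 'M[R]_(m, n)) i j : `|A i j| <= `|A|.
Proof.
rewrite [leRHS]mx_normrE; exact: (le_bigmax _ (fun ij : 'I_m * 'I_n => `|A ij.1 ij.2|) (i, j)).
Qed.

Lemma quad1_le_norm (R : realType) m (x : 'cV[R]_m) : quad 1%:M x <= m%:R * `|x| ^+ 2.
Proof.
rewrite quad1E; apply: (@le_trans _ _ (\sum_(i < m) `|x| ^+ 2)); last by rewrite sumr_const card_ord mulr_natl.
apply: ler_sum => i _.
by rewrite -[leLHS]real_normK ?num_real// ler_sqr ?nnegrE// mx_entry_le.
Qed.

Lemma psd_entry_trace (R : realType) m (A : 'M[R]_m) i j : psdmx A -> `|A i j| <= \tr A.
Proof.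
move=> pA; have dA k : 0 <= A k k by rewrite -quad_delta; exact: pA.2.
have h k : A k k <= \tr A by rewrite /mxtrace (bigD1 k)//= lerDl sumr_ge0.
by apply: le_trans (psd_entry i j pA) _; have := h i; have := h j; lra.
Qed.

Lemma sqrtmx_whiten (R : realType) m (A : 'M[R]_m) : pdmx A ->
  sqrtmx A *m invmx A *m sqrtmx A = 1%:M.
Proof.
move=> pA; have [_ SS _] := sqrtmxP (pd_psd pA); have uS := pd_sqrt_unit pA.
apply: (can_inj (mulmxK uS)).
rewrite mul1mx -(mulmxA (sqrtmx A *m invmx A)) SS -(mulmxA (sqrtmx A)).
by rewrite mulVmx ?mulmx1// pd_unit.
Qed.

(** By concavity the logarithm lies above its chord from [1] to [1 + y]. The proof uses the tangent
    at [1 + x], evaluated at both ends of the chord. *)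
Lemma ln_scale (R : realType) (x y : R) : 0 <= x <= y -> x / y * ln (1 + y) <= ln (1 + x).
Proof.
move=> /andP[x0 xy]; have [y0|y0] := leP y 0.
  have -> : y = 0 by apply/eqP; rewrite eq_le y0 (le_trans x0).
  by rewrite invr0 mulr0 mul0r ln_ge0// lerDl.
have b0 : 0 < 1 + x by rewrite ltr_wpDr.
have y1 : 0 < 1 + y by rewrite ltr_wpDr// ltW.
have t0 : 0 <= x / y by rewrite divr_ge0// ltW.
have t1 : 0 <= 1 - x / y by rewrite subr_ge0 ler_pdivrMr// mul1r.
have tangent z : 0 < z -> ln z <= ln (1 + x) + (z / (1 + x) - 1).
  move=> z0; have := ln_leB1 (divr_gt0 z0 b0).
  by rewrite ln_div ?posrE// lerBlDl.
have h1 := ler_wpM2l t0 (tangent _ y1); have := ler_wpM2l t1 (tangent 1 ltr01); rewrite ln1 mulr0 => h2.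
apply: le_trans h1 _; rewrite -subr_ge0; apply: le_trans h2 _.
by rewrite le_eqVlt; apply/orP; left; apply/eqP; field; rewrite !gt_eqF.
Qed.

(** The inequality [ln det <= tr - m] is applied to [A / (1 + tr A)], whose trace is at most 1. The
    bound is logarithmic in the trace, as only a logarithmic moment is available. *)
Lemma ln_det_le_trace (R : realType) m (A : 'M[R]_m) : pdmx A ->
  ln (\det A) <= 1 + m%:R * ln (1 + \tr A).
Proof.
move=> pA; have t0 : 0 <= \tr A.
  by apply: sumr_ge0 => i _; rewrite -quad_delta; exact: (pd_psd pA).2.
pose c := 1 + \tr A; have c0 : 0 < c by rewrite ltr_wpDr.
have pcA : pdmx (c^-1 *: A).
  split; first by rewrite trmx_scale pA.1.
  by move=> u u0; rewrite quadZ mulr_gt0 ?invr_gt0//; exact: pA.2.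
have [_ h _] := pd_ln_det pcA; have [dA _ _] := pd_ln_det pA.
move: h; rewrite detZ lnM ?posrE ?exprn_gt0 ?invr_gt0// lnXn ?invr_gt0// lnV ?posrE// mxtraceZ.
rewrite -mulr_natl -/c => h.
have : c^-1 * \tr A <= 1 by rewrite mulrC ler_pdivrMr// mul1r /c lerDr.
have : 0 <= m%:R :> R by [].
lra.
Qed.

(** * Moments of the innovations *)

Section innovations.
Context d (T : measurableType d) (R : realType) (P : probability T R) (m : nat).
Variable Z : int -> T -> 'cV[R]_m.
Hypothesis HIN : IN P Z.
Local Notation integr f := (P.-integrable setT (EFin \o f)).
Local Notation Ex f := (Rintegral P setT f).

Lemma borel_entry (i : 'I_m) (B : set R) : open B -> borel [set z : 'cV[R]_m | B (z i 0)].
Proof.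
move=> oB; apply: sub_sigma_algebra => /=.
by apply: open_comp => // x _; exact: coord_continuous.
Qed.

Definition borel_cV := g_sigma_algebraType [set A : set 'cV[R]_m | open A].

Lemma measurable_entry i : measurable_fun [set: borel_cV] (fun z : borel_cV => (z : 'cV[R]_m) i 0).
Proof. by apply: measurable_of_lt => c; exact: (borel_entry i (open_lt (y := c))). Qed.

(* Bounded, so that the strong law for these products needs no fourth moment of Z. *)
Definition cut_product (j : nat) (k l : 'I_m) (z : 'cV[R]_m) : R :=
  if quad 1%:M z <= j%:R then z k 0 * z l 0 else 0.

Definition cut_moment j k l : R := Ex (fun w => cut_product j k l (Z 0 w)).

Lemma measurable_cut_product j k l :
  measurable_fun [set: borel_cV] (fun z : borel_cV => cut_product j k l z).
Proof.
apply: measurable_fun_ifT.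
- apply: measurable_fun_ler; last exact: measurable_cst.
  apply: meas_quad; first exact: mx_meas_cst.
  by move=> i' j'; rewrite ord1; exact: measurable_entry.
- by apply: measurable_funM; exact: measurable_entry.
- exact: measurable_cst.
Qed.

Lemma sqr_entry_le (z : 'cV[R]_m) k : z k 0 ^+ 2 <= quad 1%:M z.
Proof. by rewrite quad1E (bigD1 k)//= lerDl sumr_ge0// => i _; exact: sqr_ge0. Qed.

Lemma product_entry_le (z : 'cV[R]_m) k l : `|z k 0 * z l 0| <= quad 1%:M z.
Proof.
have := sqr_entry_le z k; have := sqr_entry_le z l.
rewrite normrM -[z k 0 ^+ 2]real_normK ?num_real// -[z l 0 ^+ 2]real_normK ?num_real//.
have := sqr_ge0 (`|z k 0| - `|z l 0|); nra.
Qed.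

Lemma cut_product_bound j k l z : `|cut_product j k l z| <= j%:R.
Proof.
rewrite /cut_product; case: ifP => [h|_]; last by rewrite normr0.
exact: le_trans (product_entry_le z k l) h.
Qed.

Lemma measurable_Z t : measurable_fun setT (Z t : T -> borel_cV).
Proof.
move=> _ B mB; rewrite setTI; have [[mZ _ _] _] := HIN.
by have := mZ t B mB; rewrite setTI.
Qed.

Lemma measurable_cut_Z j k l t : measurable_fun setT (fun w => cut_product j k l (Z t w)).
Proof. by apply: (measurableT_comp (measurable_cut_product j k l)); exact: measurable_Z. Qed.

Lemma cut_moment_cvg k l : cut_moment j k l @[j --> \oo] --> ((k == l)%:R : R).
Proof.
have [_ /(_ k l)[Zi ZE]] := HIN.
have -> : (k == l)%:R = Ex (fun w => Z 0 w k 0 * Z 0 w l 0).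
  by rewrite /Rintegral; move: ZE; rewrite unlock /= mxE => ->.
apply: (@Ex_dominated _ _ _ P (fun j w => cut_product j k l (Z 0 w)) _
  (fun w => `|Z 0 w k 0 * Z 0 w l 0|)).
- by move=> j; exact: measurable_cut_Z.
- exact: integr_meas Zi.
- exact: integr_norm.
- apply: aeW => w; apply: cvg_near_cst.
  exists (Num.truncn (quad 1%:M (Z 0 w))).+1 => // j /= hj.
  rewrite /cut_product ifT//; apply/ltW; apply: lt_le_trans (truncnS_gt _) _; by rewrite ler_nat.
- by move=> j w; rewrite /cut_product; case: ifP => // _; rewrite normr0.
Qed.

Lemma cut_moment_shift j k l t : Ex (fun w => cut_product j k l (Z t w)) = cut_moment j k l.
Proof.
have [[mZ sZ _] _] := HIN; pose f (z : borel_cV) := cut_product j k l z.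
have mf := measurable_cut_product j k l.
have fb s : integr (fun w => f (Z s w)).
  apply: (@integr_bounded _ _ _ P _ j%:R); first exact: measurable_cut_Z.
  by move=> w; exact: cut_product_bound.
pose Zm s : {mfun T >-> borel_cV} := mfun_Sub (mem_set (measurable_Z s)).
have mfE : measurable_fun [set: borel_cV] (EFin \o f) by exact/measurable_EFinP.
rewrite /cut_moment /Rintegral; congr fine.
have fiE u : P.-integrable setT ((EFin \o f) \o Zm u) by exact: fb.
rewrite -(integral_distribution (X := Zm t) (f := EFin \o f))//.
rewrite -(integral_distribution (X := Zm 0) (f := EFin \o f))//.
by apply: eq_measure_integral => A mA _; exact: sZ.
Qed.

Lemma past_cut_Ex (t : int) (f : T -> R) (K : R) j k l :
  measurable_fun [set: past_space P Z t] f -> measurable_fun setT f -> (forall w, `|f w| <= K) ->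
  Ex (fun w => f w * cut_product j k l (Z t w)) = Ex f * cut_moment j k l.
Proof.
move=> pf mf fK; rewrite -(cut_moment_shift j k l t).
apply: (@independent_Ex _ _ _ P _ _ (Num.max K j%:R)) => //; first exact: measurable_cut_Z.
- move=> A B mA mB; apply: (past_independent HIN.1 (t := t) (B := cut_product j k l @^-1` B)).
    by have := pf measurableT A mA; rewrite setTI.
  by have := measurable_cut_product j k l measurableT mB; rewrite setTI.
- by move=> w; rewrite le_max fK.
- by move=> w; rewrite le_max cut_product_bound orbT.
Qed.

(** Lets an estimate on [f] be proved where all expectations are finite: the uniform bound passes to
    [f] by monotone convergence. *)
Lemma integr_truncated_bound (f : T -> R) (B : R) : measurable_fun setT f ->
  (forall w, 0 <= f w) ->
  (forall n : nat, Ex (fun w => if f w <= n%:R then f w else 0) <= B) -> integr f.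
Proof.
move=> mf f0 fB; pose g (n : nat) w := if f w <= n%:R then f w else 0.
have mg n : measurable_fun setT (g n).
  apply: measurable_fun_ifT => //; exact: measurable_fun_ler.
have g0 n w : 0 <= g n w by rewrite /g; case: ifP.
have gi n : integr (g n).
  apply: (@integr_bounded _ _ _ P _ n%:R) => // w; rewrite ger0_norm//.
  by rewrite /g; case: ifP.
have cv : (\int[P]_w (g n w)%:E @[n --> \oo] --> \int[P]_w (f w)%:E)%E.
  have fE w : (f w)%:E = limn (fun n => (g n w)%:E).
    apply/esym/cvg_lim => //; apply: cvg_near_cst.
    exists (Num.truncn (f w)).+1 => // n /= hn; rewrite /g ifT//.
    by apply/ltW; apply: lt_le_trans (truncnS_gt _) _; rewrite ler_nat.
  under [X in _ --> X]eq_integral do rewrite fE.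
  apply: cvg_monotone_convergence => //.
  - by move=> n; apply/measurable_EFinP.
  - by move=> n w _; rewrite lee_fin.
  - move=> w _ a b ab; rewrite lee_fin /g; case: ifP => [h|_]; last exact: g0.
    by rewrite ifT// (le_trans h)// ler_nat.
apply/integrableP; split; first exact/measurable_EFinP.
rewrite (_ : (\int[P]_w `|_|)%E = (\int[P]_w (f w)%:E)%E); last first.
  by apply: eq_integral => w _; rewrite /= ger0_norm.
apply: (@le_lt_trans _ _ B%:E); last exact: ltry.
rewrite -(cvg_lim _ cv)//; apply: lime_le; first by apply/cvg_ex; eexists; exact: cv.
apply: nearW => n; rewrite -[leLHS]fineK; last exact: (integrable_fin_num measurableT (gi n)).
by rewrite lee_fin; exact: fB.
Qed.

(* The trace tau of S is controlled through X = sqrt(S) Z only when Z does not degenerate: with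
   zeta = X^T X on the event Z^T Z <= j and 0 on its complement, zeta <= a tau gives
   ln (1 + X^T X) >= ln (1 + zeta) >= zeta / (a tau) * ln (1 + a tau),
   and the conditional mean of zeta given S is at least tau / 2 for j large. *)
Lemma integr_log_trace (S : T -> 'M[R]_m) (t : int) :
  (forall i j, measurable_fun [set: past_space P Z t] (fun w : past_space P Z t => S w i j)) ->
  mx_meas S -> (forall w, psdmx (S w)) ->
  integr (fun w => log_plus `|sqrtmx (S w) *m Z t w|) ->
  integr (fun w => ln (1 + \tr (S w))).
Proof.
move=> pS mS psdS Xi.
have tr0 w : 0 <= \tr (S w).
  by apply: sumr_ge0 => i _; rewrite -quad_delta; exact: (psdS w).2.
(* Each of the [m^2] entries contributes an error of at most [tau * eps], for a total below
   [tau / 2]. *)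
pose eps : R := (2 * (m%:R ^+ 2 + 1))^-1.
have m21 : 0 < 2 * (m%:R ^+ 2 + 1) :> R by rewrite mulr_gt0// ltr_wpDl// sqr_ge0.
have eps0 : 0 < eps by rewrite invr_gt0.
have [j hj] : exists j, forall k l : 'I_m, `|(k == l)%:R - cut_moment j k l| <= eps.
  have H : \forall j \near \oo, forall kl : 'I_m * 'I_m,
      `|(kl.1 == kl.2)%:R - cut_moment j kl.1 kl.2| <= eps.
    apply: filter_forall => -[k l] /=.
    by have /cvgrPdist_le/(_ _ eps0) := @cut_moment_cvg k l.
  have [j _ /(_ j (leqnn j)) h] := H; exists j => k l; exact: (h (k, l)).
(* On the event [Z^T Z <= j] the quadratic form of [S] is at most [m * j * tau]. The successors
   ensure [1 <= a]. *)
pose a : R := m.+1%:R * j.+1%:R.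
have a0 : 0 < a by rewrite mulr_gt0.
have a1 : 1 <= a by rewrite /a -natrM ler1n muln_gt0.
pose tau w := \tr (S w).
pose G w := ln (1 + a * tau w).
have at0 w : 0 <= a * tau w by apply: mulr_ge0; [exact: ltW|exact: tr0].
have G0 w : 0 <= G w by rewrite ln_ge0// lerDl.
have mtau : measurable_fun setT tau by exact: meas_trace.
have mG : measurable_fun setT G.
  apply: measurableT_comp; first exact: measurable_ln.
  by apply: measurable_funD => //; exact: measurable_funM.
pose C := Ex (fun w => ln (m%:R + 1) + 2 * log_plus `|sqrtmx (S w) *m Z t w|).
have Gi : integr G.
  apply: (@integr_truncated_bound _ (2 * a * C)) => // n.
  (* These coefficients are bounded functions of the past, so each cut product of innovations can be
     replaced by its mean. Their sum against the cut products is [zeta / (a * tau) * G], truncated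
     to [G <= n]. *)
  pose c k l w := if G w <= n%:R then S w k l / (a * tau w) * G w else 0.
  have ratio k l w : `|S w k l / (a * tau w)| <= 1.
    have h : `|S w k l| <= a * tau w.
      apply: le_trans (psd_entry_trace k l (psdS w)) _.
      by rewrite -[leLHS]mul1r; apply: ler_wpM2r; [exact: tr0|].
    rewrite normrM normfV (ger0_norm (at0 w)); have [e|ne] := eqVneq (a * tau w) 0.
      by rewrite e invr0 mulr0.
    by rewrite ler_pdivrMr ?mul1r// lt_def ne at0.
  have cb k l w : `|c k l w| <= n%:R.
    rewrite /c; case: ifP => [Gn|_]; last by rewrite normr0.
    by rewrite normrM (ger0_norm (G0 w)) (le_trans _ Gn)// ler_piMl.
  have gen d' (T' : measurableType d') (S' : T' -> 'M[R]_m) k l : mx_meas S' ->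
      measurable_fun setT (fun w => if ln (1 + a * \tr (S' w)) <= n%:R then
        S' w k l / (a * \tr (S' w)) * ln (1 + a * \tr (S' w)) else 0).
    move=> mS'; have m1 : measurable_fun setT (fun w => a * \tr (S' w)).
      by apply: measurable_funM => //; exact: meas_trace.
    have m2 : measurable_fun setT (fun w => ln (1 + a * \tr (S' w))).
      by apply: measurableT_comp; [exact: measurable_ln|exact: measurable_funD].
    apply: measurable_fun_ifT => //; first exact: measurable_fun_ler.
    by apply: measurable_funM => //; apply: measurable_funM => //; exact: measurable_invr.
  have pc k l : measurable_fun [set: past_space P Z t] (c k l).
    exact: (@gen _ (past_space P Z t) S k l pS).
  have mc k l : measurable_fun setT (c k l) by exact: gen.
  pose s w := \sum_(kl : 'I_m * 'I_m) c kl.1 kl.2 w * cut_product j kl.1 kl.2 (Z t w).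
  have ci k l : integr (fun w => c k l w * cut_product j k l (Z t w)).
    apply: (@integr_bounded _ _ _ P _ (n%:R * j%:R)).
      by apply: measurable_funM => //; exact: measurable_cut_Z.
    by move=> w; rewrite normrM ler_pM// cut_product_bound.
  have ci' k l : integr (c k l) by exact: integr_bounded (mc k l) (cb k l).
  have cw k l : integr (fun w => c k l w * cut_moment j k l).
    by under eq_fun do rewrite mulrC; exact: integrZ.
  pose s' w := \sum_(kl : 'I_m * 'I_m) c kl.1 kl.2 w * cut_moment j kl.1 kl.2.
  have si : integr s by exact: (integr_sum _ (fun kl => ci kl.1 kl.2)).
  have si' : integr s' by exact: (integr_sum _ (fun kl => cw kl.1 kl.2)).
  have sE : Ex s = Ex s'.
    rewrite /s /s' (Ex_sum _ (fun kl => ci kl.1 kl.2)) (Ex_sum _ (fun kl => cw kl.1 kl.2)).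
    apply: eq_bigr => -[k l] _ /=; rewrite (past_cut_Ex j k l (pc k l) (mc k l) (cb k l)) mulrC -ExZ//.
    by congr (Rintegral P setT _); apply/funext => w; rewrite mulrC.
  have cE (F : 'I_m -> 'I_m -> R) w : \sum_(kl : 'I_m * 'I_m) c kl.1 kl.2 w * F kl.1 kl.2 =
      if G w <= n%:R then (\sum_k \sum_l S w k l * F k l) / (a * tau w) * G w else 0.
    rewrite /c; case: ifP => _; last by rewrite big1// => kl _; rewrite mul0r.
    rewrite pair_big /= mulr_suml mulr_suml; apply: eq_bigr => kl _.
    by rewrite mulrAC -!mulrA; congr (_ * _); rewrite mulrCA mulrA mulrC mulrA.
  have sC : Ex s <= C.
    apply: Ex_le => //; first by apply: integrD; [exact: integr_cst|exact: integrZ].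
    move=> w; set X := sqrtmx (S w) *m Z t w.
    have lp0 := log_plus_ge0 `|X|.
    have lm0 : 0 <= ln (m%:R + 1 : R) by rewrite ln_ge0// lerDr.
    rewrite /s (cE (fun k l => cut_product j k l (Z t w))).
    case: ifP => _; last by rewrite addr_ge0// mulr_ge0.
    have qS0 := (psdS w).2 (Z t w).
    have zE : \sum_k \sum_l S w k l * cut_product j k l (Z t w) =
        if quad 1%:M (Z t w) <= j%:R then quad (S w) (Z t w) else 0.
      rewrite [quad (S w) _]quadE /cut_product; case: (quad 1%:M (Z t w) <= j%:R) => //.
      by rewrite big1// => k _; rewrite big1// => l _; rewrite mulr0.
    rewrite zE; set zeta := (if _ then _ else _).
    have z0 : 0 <= zeta by rewrite /zeta; case: ifP.
    have zq : zeta <= quad (S w) (Z t w) by rewrite /zeta; case: ifP.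
    have za : zeta <= a * tau w.
      rewrite /zeta; case: ifP => [hz|_]; last exact: at0.
      apply: le_trans (ler_norm _) _.
      apply: le_trans (quad_bound _ (fun k l => psd_entry_trace k l (psdS w))) _.
      rewrite mulrAC; apply: ler_wpM2r; first exact: tr0.
      apply: ler_pM => //; first exact: quad1_ge0.
        by rewrite ler_nat.
      by rewrite (le_trans hz)// ler_nat.
    apply: le_trans (ln_scale _) _; first by rewrite z0.
    have XE : quad (S w) (Z t w) = quad 1%:M X.
      have [[sS _] SS _] := sqrtmxP (psdS w).
      by rewrite /X -quad_conj mulmx1 [_^T]sS SS.
    apply: (@le_trans _ _ (ln (1 + m%:R * `|X| ^+ 2))).
      rewrite ler_ln ?posrE ?ltr_wpDr// ?mulr_ge0 ?sqr_ge0// lerD2l (le_trans zq)// XE.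
      exact: quad1_le_norm.
    have p1 : 0 < 1 + m%:R * `|X| ^+ 2 by rewrite ltr_wpDr// mulr_ge0// sqr_ge0.
    have p2 : 0 < m%:R + 1 :> R by rewrite ltr_wpDl.
    have [X1|X1] := leP `|X| 1.
      apply: (@le_trans _ _ (ln (m%:R + 1))); last by rewrite lerDl mulr_ge0.
      rewrite ler_ln ?posrE// addrC lerD2r -[leRHS]mulr1; apply: ler_wpM2l => //.
      by rewrite expr_le1.
    have X0 : 0 < `|X| by exact: lt_trans X1.
    apply: (@le_trans _ _ (ln (m%:R + 1) + 2 * ln `|X|)); last first.
      by rewrite lerD2l ler_wpM2l// /log_plus le_max lexx orbT.
    rewrite [2 * ln _]mulr_natl -lnXn// -lnM ?posrE ?exprn_gt0//.
    rewrite ler_ln ?posrE ?mulr_gt0 ?exprn_gt0//.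
    by rewrite mulrDl mul1r addrC lerD2l exprn_ege1// ltW.
  have sG w : (if G w <= n%:R then G w else 0) <= 2 * a * s' w.
    rewrite /s' (cE (fun k l => cut_moment j k l)); case: ifP => _; last by rewrite mulr0.
    have [t0|tn] := eqVneq (tau w) 0; first by rewrite /G t0 mulr0 addr0 ln1 mulr0 mulr0.
    have tp : 0 < tau w by rewrite lt_def tn tr0.
    have low : tau w / 2 <= \sum_k \sum_l S w k l * cut_moment j k l.
      have trE : tau w = \sum_k \sum_l S w k l * (k == l)%:R.
        apply: eq_bigr => k _; rewrite (bigD1 k)//= eqxx mulr1 big1 ?addr0// => l.
        by rewrite eq_sym => /negPf ->; rewrite mulr0.
      have dE : \sum_k \sum_l S w k l * (k == l)%:R - \sum_k \sum_l S w k l * cut_moment j k l <=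
          \sum_(k < m) \sum_(l < m) tau w * eps.
        rewrite -sumrB; apply: ler_sum => k _; rewrite -sumrB; apply: ler_sum => l _.
        rewrite -mulrBr; apply: le_trans (ler_norm _) _; rewrite normrM.
        by apply: ler_pM => //; exact: psd_entry_trace.
      have me : m%:R ^+ 2 * eps <= 1 / 2.
        by rewrite /eps ler_pdivrMr//; have := sqr_ge0 (m%:R : R); lra.
      have sumE : \sum_(k < m) \sum_(l < m) tau w * eps = m%:R ^+ 2 * eps * tau w.
        rewrite !sumr_const card_ord -[_ *+ m *+ m]mulr_natl -[_ *+ m]mulr_natl; ring.
      have := ler_wpM2r (ltW tp) me; move: dE; rewrite sumE -trE; lra.
    have at1 : 0 < a * tau w by rewrite mulr_gt0.
    have := ler_wpM2r (G0 w) low => h.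
    rewrite -[X in _ * (X * _)]mulrC [leRHS](_ : _ = 2 / tau w * ((\sum_k \sum_l S w k l * cut_moment j k l) * G w)).
      apply: (@le_trans _ _ (2 / tau w * (tau w / 2 * G w))); last by apply: ler_wpM2l => //; rewrite divr_ge0// ltW.
      by rewrite le_eqVlt; apply/orP; left; apply/eqP; field.
    by field; rewrite tn gt_eqF.
  apply: (@le_trans _ _ (Ex (fun w => 2 * a * s' w))).
    apply: Ex_le => //; last exact: integrZ.
    apply: (@integr_bounded _ _ _ P _ n%:R).
      by apply: measurable_fun_ifT => //; exact: measurable_fun_ler.
    by move=> w; case: ifP => // Gn; rewrite ?normr0// ger0_norm.
  by rewrite ExZ// -sE; apply: ler_wpM2l => //; rewrite mulr_ge0// ltW.
apply: (integr_le _ _ Gi).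
  by apply: measurableT_comp; [exact: measurable_ln|exact: measurable_funD].
move=> w; rewrite ger0_norm ?ln_ge0 ?lerDl// ler_ln ?posrE ?ltr_wpDr// lerD2l.
by rewrite -[leLHS]mul1r; apply: ler_wpM2r.
Qed.

End innovations.

(** * Lower bound of the contrast near a parameter *)

Section criterion.
Context (R : realType) (p : nat) (F : metricType R) (N : 'rV[R]_p -> R).
Hypothesis mN : monotone_norm N.
Local Notation dE := (@prod_dist R p F N).
Local Notation block := ('I_p -> F).
Context (m : nat) (M : set 'M[R]_m) (h : 'M[R]_m -> F) (ell : F -> 'M[R]_m).
Local Notation I := (h @` M).
Local Notation E := (@prod_set R p F I).
Context (U : pseudoMetricType R) (Theta : set U) (theta0 : U) (y0 : block) (j0 : 'I_p).
Variables (q : nat -> block).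
Hypotheses (Eq : forall n, E (q n))
  (dq : forall x e, E x -> 0 < e -> exists n, dE x (q n) < e).
Hypotheses (Ecomp : complete dE E) (Ey0 : E y0) (cT : compact Theta) (T0 : Theta theta0).
Hypothesis link : link_function M h ell.
Variables K1 K2 : R.
Hypotheses (K10 : 0 <= K1) (K20 : 0 <= K2).
Hypothesis lip1 : forall y y', I y -> I y' ->
  `|invmx (ell y) - invmx (ell y')| <= K1 * mdist y y'.
Hypothesis lip2 : forall y y', I y -> I y' ->
  `|ln (\det (ell y)) - ln (\det (ell y'))| <= K2 * mdist y y'.

Definition contracting_maps (u : int -> block -> U -> block) :=
  good_path N E Theta u /\ contracting_path N E Theta y0 u.

(** Time is fixed at 0 and other times are reached by shifting the path, so that each quantity built
    on it is a single functional for the ergodic theorem. *)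
Definition limit_coord (th : U) (u : int -> block -> U -> block) : F :=
  limit_block N E y0 u 0 th j0.

Definition limit_precision th u : 'M[R]_m := invmx (ell (limit_coord th u)).
Definition limit_logdet th u : R := ln (\det (ell (limit_coord th u))).
Definition true_vol u : 'M[R]_m := ell (limit_coord theta0 u).

Lemma link_pd y : I y -> pdmx (ell y).
Proof. by move=> [A MA <-]; rewrite link.2//; exact: link.1. Qed.

Lemma link_inj y y' : I y -> I y' -> ell y = ell y' -> y = y'.
Proof. by move=> [A MA <-] [B MB <-]; rewrite !link.2// => ->. Qed.

Lemma limit_coord_in th u : contracting_maps u -> Theta th -> I (limit_coord th u).
Proof. by move=> [gu cu] Tth; apply: (limit_block_in mN Ecomp Ey0 gu cu). Qed.

Section measurability.
Context d (T : measurableType d) (u : int -> T -> block -> U -> block).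
Hypothesis cu : forall w, contracting_maps (u ^~ w).
Hypothesis mu : forall t y th, t <= 0 -> E y -> Theta th -> block_meas N q (fun w => u t w y th).
Local Notation meas f := (measurable_fun [set: T] f).

Lemma limit_coord_meas (f : T -> F -> R) (K : R) th : 0 <= K -> Theta th ->
  (forall y, I y -> meas (f ^~ y)) ->
  (forall w y y', I y -> I y' -> f w y <= f w y' + K * mdist y y') ->
  meas (fun w => f w (limit_coord th (u ^~ w))).
Proof.
move=> K0 Tth mf fK; have cc0 := coord_const_ge0 mN.
apply: (@measurable_lipschitz_comp _ T R _ dE E q (fun w => limit_block N E y0 (u ^~ w) 0 th)
  (fun w x => f w (x j0)) (fun=> K * coord_const N)).
- exact: prod_distC.
- exact: Eq.
- exact: dq.
- by move=> w; apply: (limit_block_in mN Ecomp Ey0 (cu w).1 (cu w).2).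
- by apply: (limit_block_meas mN Ecomp Ey0 (t0 := 0) Eq dq _ _ mu) => // w; have [] := cu w.
- by move=> n; apply: mf; exact: Eq.
- exact: measurable_cst.
- by move=> w; rewrite mulr_ge0.
- move=> w x y Ex Ey; apply: le_trans (fK w _ _ (Ex j0) (Ey j0)) _.
  by rewrite lerD2l -mulrA; apply: ler_wpM2l => //; exact: coord_dist.
Qed.

Lemma limit_dist_meas th th' : Theta th -> Theta th' ->
  meas (fun w => mdist (limit_coord th (u ^~ w)) (limit_coord th' (u ^~ w))).
Proof.
move=> Tth Tth'.
apply: (@limit_coord_meas (fun w y => mdist y (limit_coord th' (u ^~ w))) 1) => // [y Iy|w y y' _ _].
  apply: (@limit_coord_meas (fun w x => mdist y x) 1) => // w x x' _ _.
  by rewrite mul1r [mdist x x']metric_sym; exact: metric_triangle.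
by rewrite mul1r addrC; exact: metric_triangle.
Qed.

Lemma limit_logdet_meas th : Theta th -> meas (fun w => limit_logdet th (u ^~ w)).
Proof.
move=> Tth; apply: (@limit_coord_meas (fun w y => ln (\det (ell y))) K2) => // w y y' Iy Iy'.
by have := lip2 Iy Iy'; rewrite ler_norml => /andP[_]; rewrite lerBlDl.
Qed.

Lemma limit_precision_meas th : Theta th -> mx_meas (fun w => limit_precision th (u ^~ w)).
Proof.
move=> Tth i j; apply: (@limit_coord_meas (fun w y => invmx (ell y) i j) K1) => // w y y' Iy Iy'.
have := le_trans (mx_entry_le _ i j) (lip1 Iy Iy'); rewrite !mxE ler_norml => /andP[_].
by rewrite lerBlDl.
Qed.

Lemma true_vol_meas : mx_meas (fun w => true_vol (u ^~ w)).
Proof.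
(* No regularity is assumed on [ell] itself, only on its matrix inverse and its log determinant. The
   volatility is therefore measured as the inverse of the precision. *)
have -> : (fun w => true_vol (u ^~ w)) = (fun w => invmx (limit_precision theta0 (u ^~ w))).
  by apply/funext => w; rewrite invmxK.
apply: mx_meas_inv; last exact: limit_precision_meas.
by move=> w; rewrite unitmx_inv; apply/pd_unit/link_pd/limit_coord_in.
Qed.

Lemma true_sqrt_meas : mx_meas (fun w => sqrtmx (true_vol (u ^~ w))).
Proof.
apply: mx_meas_sqrt; last exact: true_vol_meas.
by move=> w; apply/pd_psd/link_pd/limit_coord_in.
Qed.

End measurability.

Lemma limit_coord_cont u th (e : R) : contracting_maps u -> Theta th -> 0 < e ->
  \forall th' \near within Theta (nbhs th), mdist (limit_coord th' u) (limit_coord th u) < e.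
Proof.
move=> [gu cu] Tth e0; have cc0 := coord_const_ge0 mN.
have c1 : 0 < coord_const N + 1 by rewrite ltr_wpDl.
have e'0 : 0 < e / (coord_const N + 1) by rewrite divr_gt0.
apply: filterS (limit_block_cont mN Ecomp Ey0 gu cu 0 Tth e'0) => th' hth'.
apply: le_lt_trans (coord_dist mN _ _ j0) _; move: hth'; rewrite ltr_pdivlMr// => hth'.
by apply: le_lt_trans hth'; rewrite mulrC; apply: ler_wpM2l; [exact: prod_dist_ge0|rewrite lerDl].
Qed.

Variables (th1 : U) (e : nat -> nat -> U).
Hypothesis T1 : Theta th1.
Local Notation V j := (Theta `&` ball th1 j.+1%:R^-1).
Hypothesis eV : forall j n, V j (e j n).
Hypothesis de : forall j x (r : R), V j x -> 0 < r -> exists n, ball x r (e j n).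

Definition oscillation (j : nat) u : R :=
  sup (range (fun n => mdist (limit_coord (e j n) u) (limit_coord th1 u))).

Lemma oscillation_bounded j u : contracting_maps u ->
  has_ubound (range (fun n => mdist (limit_coord (e j n) u) (limit_coord th1 u))).
Proof.
move=> cu.
have [|B _ hB] := @compact_local_bound R U Theta
  (fun th => mdist (limit_coord th u) (limit_coord th1 u)) cT.
  move=> th Tth; exists (1 + mdist (limit_coord th u) (limit_coord th1 u)).
  apply: filterS (limit_coord_cont cu Tth (ltr01 : (0 : R) < 1)) => th' h1.
  by apply: le_trans (metric_triangle _ (limit_coord th u) _) _; rewrite lerD2r ltW.
by exists B => _ [n _ <-]; apply: hB; have [] := eV j n.
Qed.

Lemma oscillation_ge0 j u : contracting_maps u -> 0 <= oscillation j u.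
Proof.
move=> cu; apply: (@le_trans _ _ (mdist (limit_coord (e j 0%N) u) (limit_coord th1 u))).
  exact: mdist_ge0.
by apply: ub_le_sup; [exact: oscillation_bounded|exists 0%N].
Qed.

Lemma oscillationP j u th : contracting_maps u -> V j th ->
  mdist (limit_coord th u) (limit_coord th1 u) <= oscillation j u.
Proof.
move=> cu [Tth bth]; apply/ler_addgt0Pr => r r0.
have /nbhs_ballP[r' /= r'0 hr'] := limit_coord_cont cu Tth r0.
have [n bn] := de (conj Tth bth) r'0; have [Tn _] := eV j n.
have := hr' _ bn Tn; rewrite metric_sym => h1.
apply: le_trans (metric_triangle _ (limit_coord (e j n) u) _) _.
rewrite addrC; apply: lerD; last exact: ltW.
by apply: ub_le_sup; [exact: oscillation_bounded|exists n].
Qed.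

Lemma oscillation_cvg u : contracting_maps u -> oscillation j u @[j --> \oo] --> (0 : R).
Proof.
move=> cu; apply/cvgrPdist_le => r r0.
have /nbhs_ballP[r' /= r'0 hr'] := limit_coord_cont cu T1 r0.
exists (Num.truncn r'^-1) => // j /= rj.
have jr : j.+1%:R^-1 < r'.
  rewrite -[r']invrK ltf_pV2 ?posrE ?invr_gt0//.
  by apply: lt_le_trans (truncnS_gt _) _; rewrite ler_nat.
rewrite sub0r normrN ger0_norm ?oscillation_ge0//.
apply: ge_sup; first by exists (mdist (limit_coord (e j 0%N) u) (limit_coord th1 u)), 0%N.
move=> _ [n _ <-]; have [Tn bn] := eV j n; apply/ltW/hr' => //.
exact: le_ball (ltW jr) _ bn.
Qed.

Lemma oscillation_meas j d (T : measurableType d) (u : int -> T -> block -> U -> block) :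
  (forall w, contracting_maps (u ^~ w)) ->
  (forall t y th, t <= 0 -> E y -> Theta th -> block_meas N q (fun w => u t w y th)) ->
  measurable_fun setT (fun w => oscillation j (u ^~ w)).
Proof.
move=> cu mu; apply: measurable_sup_seq => [n|w]; last exact: oscillation_bounded.
by apply: limit_dist_meas => //; have [] := eV j n.
Qed.

Variables (cm : nat -> 'I_m -> 'I_m -> R) (c0 : R).
Hypothesis cm_cvg : forall k l, cm j k l @[j --> \oo] --> ((k == l)%:R : R).

(* A lower bound, uniform over the ball of radius 1/(j+1) around th1, of the matrix of the
   quadratic form z |-> X^T A X with X = sqrt(Sigma) z. *)
Definition form_lower j u : 'M[R]_m :=
  sqrtmx (true_vol u) *m limit_precision th1 u *m sqrtmx (true_vol u)
  - (K1 * m%:R * oscillation j u) *: true_vol u.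

Definition form_mean j u : R := \sum_k \sum_l form_lower j u k l * cm j k l.

(* The condition on form_mean keeps crit_lower bounded below, for Fatou's lemma, and holds for j
   large because the form at th1 is positive. *)
Definition form_cut j u (k l : 'I_m) : R :=
  if (\sum_k \sum_l `|form_lower j u k l| <= j%:R) && (-1 <= form_mean j u)
  then form_lower j u k l else 0.

(** The maximum with [c0] provides a lower bound independent of [j] and remains below the log
    determinants, which exceed [c0] almost surely; the minimum with [j] makes the variable
    bounded. *)
Definition logdet_lower j u : R :=
  Num.min j%:R (Num.max c0 (limit_logdet th1 u - K2 * oscillation j u)).

Definition crit_lower j u : R := \sum_k \sum_l form_cut j u k l * cm j k l + logdet_lower j u.

Lemma form_cut_bound j u k l : `|form_cut j u k l| <= j%:R.
Proof.
rewrite /form_cut; case: ifP => [/andP[sj _]|_]; last by rewrite normr0.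
apply: le_trans sj; rewrite (bigD1 k)//= (bigD1 l)//= -addrA lerDl addr_ge0// ?sumr_ge0// => i _.
by rewrite sumr_ge0.
Qed.

Lemma crit_lowerE j u : crit_lower j u =
  (if (\sum_k \sum_l `|form_lower j u k l| <= j%:R) && (-1 <= form_mean j u)
   then form_mean j u else 0) + logdet_lower j u.
Proof.
rewrite /crit_lower /form_cut; case: (_ && _) => //; congr (_ + _).
by rewrite big1// => k _; rewrite big1// => l _; rewrite mul0r.
Qed.

Lemma logdet_lower_bound j u : Num.min 0 c0 <= logdet_lower j u <= j%:R.
Proof.
have jge : (0 : R) <= j%:R by [].
rewrite /logdet_lower; apply/andP; split; last by rewrite ge_min lexx.
rewrite le_min; apply/andP; split; first by rewrite ge_min jge.
by rewrite le_max ge_min lexx orbT.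
Qed.

Lemma crit_lower_ge j u : Num.min 0 c0 - 1 <= crit_lower j u.
Proof.
rewrite crit_lowerE [leLHS]addrC; have /andP[lb _] := logdet_lower_bound j u.
apply: lerD => //; case: ifP => [/andP[]//|_]; exact: lerN10.
Qed.

Lemma form_lower_meas j d (T : measurableType d) (u : int -> T -> block -> U -> block) :
  (forall w, contracting_maps (u ^~ w)) ->
  (forall t y th, t <= 0 -> E y -> Theta th -> block_meas N q (fun w => u t w y th)) ->
  mx_meas (fun w => form_lower j (u ^~ w)).
Proof.
move=> cu mu; apply: mx_measB.
  by apply: mx_measM; [apply: mx_measM|]; [exact: true_sqrt_meas|exact: limit_precision_meas|exact: true_sqrt_meas].
apply: mx_measZ; last exact: true_vol_meas.
by apply: measurable_funM => //; exact: oscillation_meas.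
Qed.

Lemma form_mean_meas j d (T : measurableType d) (u : int -> T -> block -> U -> block) :
  (forall w, contracting_maps (u ^~ w)) ->
  (forall t y th, t <= 0 -> E y -> Theta th -> block_meas N q (fun w => u t w y th)) ->
  measurable_fun setT (fun w => form_mean j (u ^~ w)).
Proof.
move=> cu mu; apply: measurable_sum => k; apply: measurable_sum => l.
by apply: measurable_funM => //; exact: form_lower_meas.
Qed.

Lemma form_cut_meas j k l d (T : measurableType d) (u : int -> T -> block -> U -> block) :
  (forall w, contracting_maps (u ^~ w)) ->
  (forall t y th, t <= 0 -> E y -> Theta th -> block_meas N q (fun w => u t w y th)) ->
  measurable_fun setT (fun w => form_cut j (u ^~ w) k l).
Proof.
move=> cu mu; have mf := form_lower_meas j cu mu.
apply: measurable_fun_ifT => //; apply: measurable_and; apply: measurable_fun_ler => //.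
  apply: measurable_sum => i; apply: measurable_sum => i'.
  by apply: measurableT_comp => //; exact: mf.
exact: form_mean_meas.
Qed.

Lemma logdet_lower_meas j d (T : measurableType d) (u : int -> T -> block -> U -> block) :
  (forall w, contracting_maps (u ^~ w)) ->
  (forall t y th, t <= 0 -> E y -> Theta th -> block_meas N q (fun w => u t w y th)) ->
  measurable_fun setT (fun w => logdet_lower j (u ^~ w)).
Proof.
move=> cu mu; apply: measurable_minr => //; apply: measurable_maxr => //.
apply: measurable_funB; first exact: limit_logdet_meas.
by apply: measurable_funM => //; exact: oscillation_meas.
Qed.

Lemma crit_lower_meas j d (T : measurableType d) (u : int -> T -> block -> U -> block) :
  (forall w, contracting_maps (u ^~ w)) ->
  (forall t y th, t <= 0 -> E y -> Theta th -> block_meas N q (fun w => u t w y th)) ->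
  measurable_fun setT (fun w => crit_lower j (u ^~ w)).
Proof.
move=> cu mu; apply: measurable_funD; last exact: logdet_lower_meas.
apply: measurable_sum => k; apply: measurable_sum => l.
by apply: measurable_funM => //; exact: form_cut_meas.
Qed.

Lemma crit_lower_bound j u :
  `|crit_lower j u| <= \sum_(k < m) \sum_(l < m) j%:R * `|cm j k l| + (j%:R + `|c0|).
Proof.
apply: le_trans (ler_normD _ _) _; apply: lerD.
  apply: le_trans (ler_norm_sum _ _ _) _; apply: ler_sum => k _.
  apply: le_trans (ler_norm_sum _ _ _) _; apply: ler_sum => l _.
  by rewrite normrM; apply: ler_wpM2r => //; exact: form_cut_bound.
have /andP[h1 h2] := logdet_lower_bound j u.
have : - `|c0| <= Num.min 0 c0 by rewrite le_min oppr_le0 normr_ge0 -lerNl -normrN ler_norm.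
have := normr_ge0 c0; have : (0 : R) <= j%:R by [].
by rewrite ler_norml => *; apply/andP; split; lra.
Qed.

(* On the event where z is not cut off the form is bounded below by its uniform lower bound;
   elsewhere it is bounded below by 0. *)
Lemma crit_lowerP j u z th : contracting_maps u -> V j th -> c0 <= limit_logdet th u ->
  \sum_k \sum_l form_cut j u k l * cut_product j k l z + logdet_lower j u <=
  quad (limit_precision th u) (sqrtmx (true_vol u) *m z) + limit_logdet th u.
Proof.
move=> cu Vth c0l; have [Tth _] := Vth.
have I1 := limit_coord_in cu T1; have It := limit_coord_in cu Tth.
have osc := oscillationP cu Vth.
apply: lerD; last first.
  rewrite /logdet_lower ge_min; apply/orP; right; rewrite ge_max c0l /=.
  have := lip2 I1 It; rewrite metric_sym => /le_trans/(_ (ler_wpM2l K20 osc)).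
  by rewrite ler_norml => /andP[_]; rewrite -/(limit_logdet _ _) -/(limit_logdet _ _); lra.
set X := sqrtmx (true_vol u) *m z.
have q0 : 0 <= quad (limit_precision th u) X.
  by apply: (pd_psd (pd_inv (link_pd It))).2.
rewrite /form_cut; case: (_ && _); last first.
  by rewrite big1// => k _; rewrite big1// => l _; rewrite mul0r.
rewrite /cut_product; case: (quad 1%:M z <= j%:R); last first.
  by rewrite big1// => k _; rewrite big1// => l _; rewrite mulr0.
rewrite -quadE /form_lower quadB quadZ.
have pS := pd_psd (link_pd (limit_coord_in cu T0)).
have [[sS _] SS _] := sqrtmxP pS.
have q1 : quad (sqrtmx (true_vol u) *m limit_precision th1 u *m sqrtmx (true_vol u)) z =
    quad (limit_precision th1 u) X.
  by rewrite /X -quad_conj [_^T]sS.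
have qS : quad (true_vol u) z = quad 1%:M X by rewrite /X -quad_conj mulmx1 [_^T]sS SS.
rewrite q1 qS.
(* The precisions at [th1] and [th] differ entrywise by at most [K1 * oscillation]. The form at [X]
   thus loses at most [K1 m oscillation |X|^2], and [|X|^2] is the form of the volatility at [z]. *)
have := @quad_bound _ _ (limit_precision th1 u - limit_precision th u) (K1 * oscillation j u) X.
have ent k l : `|(limit_precision th1 u - limit_precision th u) k l| <= K1 * oscillation j u.
  apply: le_trans (mx_entry_le _ k l) _; apply: le_trans (lip1 I1 It) _.
  by apply: ler_wpM2l => //; rewrite metric_sym.
move=> /(_ ent); rewrite quadB ler_norml => /andP[_].
have -> : m%:R * (K1 * oscillation j u) * quad 1%:M X = K1 * m%:R * oscillation j u * quad 1%:M X.
  by ring.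
lra.
Qed.

Lemma crit_lower_cvg u : contracting_maps u ->
  crit_lower j u @[j --> \oo] -->
    \tr (sqrtmx (true_vol u) *m limit_precision th1 u *m sqrtmx (true_vol u)) +
    Num.max c0 (limit_logdet th1 u).
Proof.
move=> cu; set B := sqrtmx _ *m _ *m _; have oc := oscillation_cvg cu.
have pS := pd_psd (link_pd (limit_coord_in cu T0)).
have [[sS _] SS _] := sqrtmxP pS.
have fc k l : form_lower j u k l @[j --> \oo] --> B k l.
  have -> : (fun j => form_lower j u k l) = (fun j => B k l - K1 * m%:R * oscillation j u * true_vol u k l).
    by apply/funext => j; rewrite /form_lower [LHS]mxE [X in _ + X = _]mxE [X in _ - X = _]mxE.
  have cv : B k l - K1 * m%:R * oscillation j u * true_vol u k l @[j --> \oo] -->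
      B k l - K1 * m%:R * 0 * true_vol u k l.
    apply: cvgB; first exact: cvg_cst.
    by apply: cvgM; [apply: cvgM => //; exact: cvg_cst|exact: cvg_cst].
  by rewrite mulr0 mul0r subr0 in cv.
have mc : form_mean j u @[j --> \oo] --> \tr B.
  have -> : \tr B = \sum_k \sum_l B k l * (k == l)%:R.
    apply: eq_bigr => k _; rewrite (bigD1 k)//= eqxx mulr1 big1 ?addr0// => l.
    by rewrite eq_sym => /negPf ->; rewrite mulr0.
  by apply: cvg_sum => k; apply: cvg_sum => l; exact: cvgM.
have ac : \sum_k \sum_l `|form_lower j u k l| @[j --> \oo] --> \sum_k \sum_l `|B k l|.
  by apply: cvg_sum => k; apply: cvg_sum => l; apply: cvg_norm.
have trB : 0 <= \tr B.
  have pA := pd_psd (pd_inv (link_pd (limit_coord_in cu T1))).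
  apply: sumr_ge0 => i _; rewrite -quad_delta.
  have -> : B = (sqrtmx (true_vol u))^T *m limit_precision th1 u *m sqrtmx (true_vol u).
    by rewrite [_^T]sS.
  by rewrite quad_conj; exact: pA.2.
set lam := limit_logdet th1 u.
have lc : Num.max c0 (lam - K2 * oscillation j u) @[j --> \oo] --> Num.max c0 lam.
  apply: (@squeeze_cvgr _ _ _ _ (fun j => Num.max c0 lam - K2 * oscillation j u) (fun=> Num.max c0 lam)).
  - apply: nearW => j; have o0 := oscillation_ge0 j cu; have k0 := mulr_ge0 K20 o0.
    have [c1|c1] := leP c0 lam.
      by rewrite le_max lexx orbT /= ge_max c1 gerBl.
    by rewrite le_max ge_max lexx gerBl k0 /= lerBlDr (le_trans (ltW c1))// lerDl.
  - have cv : Num.max c0 lam - K2 * oscillation j u @[j --> \oo] --> Num.max c0 lam - K2 * 0.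
      apply: cvgB; first exact: cvg_cst.
      by apply: cvgM => //; exact: cvg_cst.
    by rewrite mulr0 subr0 in cv.
  - exact: cvg_cst.
have cv : form_mean j u + Num.max c0 (lam - K2 * oscillation j u) @[j --> \oo] --> \tr B + Num.max c0 lam.
  exact: cvgD.
(* All cuts are eventually inactive: the entries of the form and the log determinant stay bounded
   while [j] grows, and the mean of the form tends to a nonnegative trace, hence exceeds -1. *)
suff H : \forall j \near \oo, form_mean j u + Num.max c0 (lam - K2 * oscillation j u) = crit_lower j u.
  by apply: cvg_trans cv; apply: near_eq_cvg.
have m1 : -1 < \tr B by apply: lt_le_trans trB; exact: ltrN10.
have /cvgr_gt/(_ _ m1) e1 := mc.
have a1 : \sum_k \sum_l `|B k l| < \sum_k \sum_l `|B k l| + 1 by rewrite ltrDl.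
have /cvgr_lt/(_ _ a1) e2 := ac.
have e3 : \forall j \near \oo, \sum_k \sum_l `|B k l| + 1 <= j%:R :> R.
  exists (Num.truncn (\sum_k \sum_l `|B k l| + 1)).+1 => // j /= hj.
  by apply/ltW; apply: lt_le_trans (truncnS_gt _) _; rewrite ler_nat.
have e4 : \forall j \near \oo, Num.max c0 lam <= j%:R :> R.
  exists (Num.truncn `|Num.max c0 lam|).+1 => // j /= hj; apply: le_trans (ler_norm _) _.
  by apply/ltW; apply: lt_le_trans (truncnS_gt _) _; rewrite ler_nat.
apply: filterS2 (filterI e1 e2) (filterI e3 e4) => j [h1 h2] [h3 h4].
rewrite crit_lowerE ifT; last by rewrite (ltW h1) andbT (le_trans (ltW h2)).
congr (_ + _); rewrite /logdet_lower -/lam; apply/esym/min_idPr; apply: le_trans h4.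
have o0 := oscillation_ge0 j cu; have k0 := mulr_ge0 K20 o0.
by rewrite ge_max le_max lexx /= le_max gerBl k0 orbT.
Qed.

Section expectation.
Context d (T : measurableType d) (P : probability T R).
Local Notation integr f := (P.-integrable setT (EFin \o f)).
Local Notation Ex f := (Rintegral P setT f).
Variable u : int -> T -> block -> U -> block.
Hypothesis cu : forall w, contracting_maps (u ^~ w).
Hypothesis mu : forall t y th, E y -> Theta th -> block_meas N q (fun w => u t w y th).

(** If no [j] separated [th1] from [theta0], Fatou's lemma would bound the mean of the limit by the
    value at [theta0], while the divergence inequality holds pointwise in the other direction. The
    difference then vanishes almost surely, and the equality case identifies the two
    volatilities. *)
Lemma crit_identification : integr (fun w => limit_logdet theta0 (u ^~ w)) ->
  {ae P, forall w, c0 <= limit_logdet th1 (u ^~ w)} ->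
  (forall j, Ex (fun w => crit_lower j (u ^~ w)) <= m%:R + Ex (fun w => limit_logdet theta0 (u ^~ w))) ->
  {ae P, forall w, limit_coord th1 (u ^~ w) = limit_coord theta0 (u ^~ w)}.
Proof.
move=> li c0l Qa; have mu0 t y th : t <= 0 -> E y -> Theta th -> block_meas N q (fun w => u t w y th).
  by move=> _; exact: mu.
pose v w := m%:R + limit_logdet theta0 (u ^~ w).
pose B w := sqrtmx (true_vol (u ^~ w)) *m limit_precision th1 (u ^~ w) *m sqrtmx (true_vol (u ^~ w)).
pose Qinf w := \tr (B w) + Num.max c0 (limit_logdet th1 (u ^~ w)).
have div w := gauss_divergence (link_pd (limit_coord_in (cu w) T0)) (link_pd (limit_coord_in (cu w) T1)).
have vQ w : v w <= Qinf w.
  by have [+ _] := div w; move=> /le_trans; apply; rewrite lerD2l le_max lexx orbT.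
pose b := 1 - Num.min 0 c0.
pose f j w := crit_lower j (u ^~ w) + b.
have f0 j w : 0 <= f j w by have := crit_lower_ge j (u ^~ w); rewrite /f /b; lra.
have mQ j : measurable_fun setT (fun w => crit_lower j (u ^~ w)) by exact: crit_lower_meas.
have Qi j : integr (fun w => crit_lower j (u ^~ w)).
  exact: integr_bounded (mQ j) (fun w => crit_lower_bound j (u ^~ w)).
have fi j : integr (f j) by apply: integrD => //; exact: integr_cst.
have cf w : f j w @[j --> \oo] --> Qinf w + b.
  by apply: cvgD; [exact: crit_lower_cvg|exact: cvg_cst].
have mQinf : measurable_fun setT (fun w => Qinf w + b).
  by apply: (@measurable_fun_cvg _ _ _ setT f) => // j; exact: integr_meas.
pose a := m%:R + Ex (fun w => limit_logdet theta0 (u ^~ w)).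
have Qb0 w : 0 <= Qinf w + b.
  by rewrite -(cvg_lim _ (cf w))//; apply: limr_ge; [apply/cvg_ex; eexists; exact: cf|exact: nearW].
have fat : (\int[P]_w (Qinf w + b)%:E <= (a + b)%:E)%E.
  have h1 : (\int[P]_w (Qinf w + b)%:E = \int[P]_w limn_einf (fun j => (f j w)%:E))%E.
    apply: eq_integral => w _; have cfE : (f j w)%:E @[j --> \oo] --> (Qinf w + b)%:E.
      by apply: cvg_EFin; [exact: nearW|exact: cf].
    rewrite is_cvg_limn_einfE; first by rewrite (cvg_lim _ cfE).
    by apply/cvg_ex; eexists; exact: cfE.
  rewrite h1; apply: le_trans (fatou _ _ _ _) _ => //.
  - by move=> j; apply/measurable_EFinP; exact: integr_meas.
  - by move=> j w _; rewrite lee_fin.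
  rewrite limn_einf_lim; apply: lime_le; first exact: is_cvg_einfs.
  apply: nearW => j; apply: (@le_trans _ _ (\int[P]_w (f j w)%:E)%E).
    by apply: ereal_inf_lbound; exists j => //=.
  rewrite -[leLHS]fineK; last exact: (integrable_fin_num measurableT (fi j)).
  rewrite lee_fin -/(Rintegral P setT (f j)) /f ExD ?Ex_cst ?lerD2r//; exact: integr_cst.
(* Nothing is assumed on the moments at [th1]: integrability of the limit is itself a consequence of
   Fatou's bound. *)
have Qbi : integr (fun w => Qinf w + b).
  apply/integrableP; split; first exact/measurable_EFinP.
  apply: (@le_lt_trans _ _ (a + b)%:E); last exact: ltry.
  by apply: le_trans fat; rewrite le_eqVlt; apply/orP; left; apply/eqP; apply: eq_integral => w _ /=; rewrite ger0_norm.
have vi : integr v by apply: integrD => //; exact: integr_cst.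
have QE : Ex (fun w => Qinf w + b) <= a + b.
  by move: fat; rewrite -[X in (X <= _)%E]fineK; [rewrite lee_fin|exact: (integrable_fin_num measurableT Qbi)].
pose g w := (Qinf w + b) - (v w + b).
have g0 w : 0 <= g w by rewrite /g; have := vQ w; lra.
have vbi : integr (fun w => v w + b) by apply: integrD => //; exact: integr_cst.
have gi : integr g by exact: integrB.
have gE : Ex g <= 0.
  rewrite ExB// [X in _ - X]ExD//; last exact: integr_cst.
  rewrite [Ex v]ExD ?Ex_cst//; last exact: integr_cst.
  by move: QE; rewrite /a; lra.
have g_ae : ae_eq P setT (EFin \o g) (cst 0%E).
  have mg : measurable_fun setT (EFin \o g) by apply/measurable_EFinP; exact: integr_meas gi.
  apply/(ae_eq_integral_abs P measurableT mg).
  have -> : (\int[P]_(x in setT) `|(EFin \o g) x| = \int[P]_x (g x)%:E)%E.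
    by apply: eq_integral => w _ /=; rewrite ger0_norm.
  rewrite -[LHS]fineK; last exact: (integrable_fin_num measurableT gi).
  congr EFin; apply/eqP; rewrite eq_le gE; exact: Ex_ge0.
apply: filterS2 c0l g_ae => w c0w /(_ Logic.I) [gw]; apply/esym.
apply: link_inj; try exact: limit_coord_in.
apply: (div w).2; move: gw; rewrite /g /Qinf /v (max_idPr c0w) /limit_logdet /B; lra.
Qed.

Variable Z : int -> T -> 'cV[R]_m.
Hypothesis HIN : IN P Z.
Hypothesis mpast : forall t s y th, s <= t -> E y -> Theta th ->
  block_meas N q (fun w : past_space P Z t => u s w y th).

(* The maps are stationary by themselves but not jointly with Z, so the ergodic theorem does not
   apply to these sums; their terms are orthogonal because Z is independent of the past. *)
Lemma form_cut_lln j : {ae P, forall w, forall r : R, 0 < r -> \forall n \near \oo,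
  `|\sum_(i < n) \sum_k \sum_l form_cut j (fun s => u (s + i.+1%:Z) w) k l *
     (cut_product j k l (Z i.+1%:Z w) - cut_moment P Z j k l)| <= r * n%:R}.
Proof.
have cus (t : int) w : contracting_maps (fun s => u (s + t) w).
  have [gu cu'] := cu w; split; first exact: (good_path_shift t gu).
  exact: (contracting_path_shift t cu').
pose H (t : int) k l w := form_cut j (fun s => u (s + t) w) k l.
pose W (t : int) k l w := cut_product j k l (Z t w) - cut_moment P Z j k l.
have mH t k l : measurable_fun setT (H t k l).
  apply: (form_cut_meas j k l (u := fun s w => u (s + t) w)) => // s y th _; exact: mu.
have mHp t t' k l : t <= t' -> measurable_fun [set: past_space P Z t'] (H t k l).
  move=> tt'; apply: (form_cut_meas j k l (T := past_space P Z t') (u := fun s w => u (s + t) w)) => //.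
  by move=> s y th s0 Ey Tth; apply: mpast => //; rewrite (le_trans _ tt')// gerDr.
have mW t k l : measurable_fun setT (W t k l).
  by rewrite /W; apply: measurable_funB; [exact: (measurable_cut_Z HIN)|exact: measurable_cst].
have mWp t t' k l : t <= t' - 1 -> measurable_fun [set: past_space P Z t'] (W t k l).
  move=> tt'; rewrite /W; apply: measurable_funB; last exact: measurable_cst.
  move=> _ B mB; rewrite setTI; apply: sub_sigma_algebra; left; apply: sub_sigma_algebra.
  exists t, (cut_product j k l @^-1` B); split=> //.
  by have := measurable_cut_product j k l measurableT mB; rewrite setTI.
pose K : R := \sum_(k < m) \sum_(l < m) j%:R * (j%:R + `|cut_moment P Z j k l|).
have HW t k l w : `|H t k l w * W t k l w| <= j%:R * (j%:R + `|cut_moment P Z j k l|).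
  rewrite normrM ler_pM//; first exact: form_cut_bound.
  by apply: le_trans (ler_normB _ _) _; rewrite lerD2r; exact: cut_product_bound.
pose D (i : nat) w := \sum_k \sum_l H i.+1%:Z k l w * W i.+1%:Z k l w.
have mD i : measurable_fun setT (D i).
  by apply: measurable_sum => k; apply: measurable_sum => l; exact: measurable_funM.
have DK i w : `|D i w| <= K.
  apply: le_trans (ler_norm_sum _ _ _) _; apply: ler_sum => k _.
  by apply: le_trans (ler_norm_sum _ _ _) _; apply: ler_sum => l _.
apply: (orthogonal_lln mD DK) => i i' ii'.
have pD : measurable_fun [set: past_space P Z i'.+1%:Z] (D i).
  apply: measurable_sum => k; apply: measurable_sum => l; apply: measurable_funM.
    by apply: mHp; rewrite lez_nat ltnS ltnW.
  by apply: mWp; lia.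
(* Everything known before the later time is gathered in [f]; the remaining centred product is
   independent of it. *)
pose f k l w := D i w * H i'.+1%:Z k l w.
have fK k l w : `|f k l w| <= K * j%:R.
  by rewrite normrM ler_pM// form_cut_bound.
have mf k l : measurable_fun setT (f k l) by exact: measurable_funM.
have pf k l : measurable_fun [set: past_space P Z i'.+1%:Z] (f k l).
  by apply: (measurable_funM pD); exact: mHp.
have fi k l : integr (f k l) by exact: integr_bounded (mf k l) (fK k l).
have fcut k l : integr (fun w => f k l w * cut_product j k l (Z i'.+1%:Z w)).
  apply: (@integr_bounded _ _ _ P _ (K * j%:R * j%:R)).
    by apply: measurable_funM => //; exact: (measurable_cut_Z HIN).
  by move=> w; rewrite normrM ler_pM// cut_product_bound.
have fW k l : integr (fun w => f k l w * W i'.+1%:Z k l w) /\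
    Ex (fun w => f k l w * W i'.+1%:Z k l w) = 0.
  have -> : (fun w => f k l w * W i'.+1%:Z k l w) = (fun w =>
      f k l w * cut_product j k l (Z i'.+1%:Z w) - cut_moment P Z j k l * f k l w).
    by apply/funext => w; rewrite /W mulrBr [_ * cut_moment _ _ _ _ _]mulrC.
  have iZ := integrZ (cut_moment P Z j k l) (fi k l).
  split; first exact: integrB.
  by rewrite ExB// ExZ// (past_cut_Ex HIN j k l (pf k l) (mf k l) (fK k l)) mulrC subrr.
have -> : (fun w => D i w * D i' w) = (fun w => \sum_(kl : 'I_m * 'I_m) f kl.1 kl.2 w * W i'.+1%:Z kl.1 kl.2 w).
  apply/funext => w; rewrite {2}/D pair_big /= mulr_sumr; apply: eq_bigr => kl _.
  by rewrite mulrA.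
rewrite (Ex_sum _ (fun kl => (fW kl.1 kl.2).1)) big1// => kl _.
by rewrite (fW kl.1 kl.2).2.
Qed.

End expectation.

End criterion.

(** * Consistency *)

Section stationary_marginals.
Context d (T : measurableType d) (R : realType) (P : probability T R).

Lemma stationary_marginal (S : Type) (SS : set_system S) (Y : int -> T -> S) t B :
  stationary P SS Y -> SS B -> P (Y t @^-1` B) = P (Y 0 @^-1` B).
Proof.
move=> [mY sY] SB; have step s : P (Y (s + 1) @^-1` B) = P (Y s @^-1` B).
  apply: (sY [set u | B (u s)]); apply: sub_sigma_algebra; by exists s, B.
have pos (n : nat) : P (Y n%:Z @^-1` B) = P (Y 0 @^-1` B).
  by elim: n => [//|n <-]; rewrite -(step n%:Z) -[n.+1]addn1 PoszD.
case: t => n; first exact: pos.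
elim: n => [|n ih]; first by rewrite -(step (Negz 0)).
by rewrite -ih -(step (Negz n.+1)); congr (P (Y _ @^-1` B)); lia.
Qed.

Lemma stationary_measurable (S : Type) (SS : set_system S) (Y : int -> T -> S) t B :
  stationary P SS Y -> SS B -> measurable (Y t @^-1` B).
Proof. by move=> [mY _] SB; have := mY t B SB; rewrite setTI. Qed.

Lemma borel_preimage (S S' : topologicalType) (f : S -> S') (B : set S') :
  continuous f -> borel B -> borel (f @^-1` B).
Proof.
move=> cf bB; apply: (preimage_sigma _ _ bB); first exact: smallest_sigma_algebra.
move=> C oC; apply: sub_sigma_algebra => /=.
by apply: open_comp => // x _; exact: cf.
Qed.

End stationary_marginals.

Lemma sum_eventually_le (R : realType) (b : nat -> R) (e : R) : 0 < e ->
  (\forall k \near \oo, b k <= e / 2) -> \forall n \near \oo, \sum_(k < n) b k <= e * n%:R.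
Proof.
move=> e0 [n0 _ bn0]; have [|B B0 bB] := @eventually_le_cst R b (fun=> e / 2).
  by exists n0.
have S n : \sum_(k < n) b k <= e / 2 * n%:R + B * (minn n n0)%:R.
  elim: n => [|n ih]; first by rewrite big_ord0 min0n !mulr0 addr0.
  rewrite big_ord_recr /= -(natr1 n) mulrDr mulr1; have [nn0|nn0] := ltnP n n0.
    rewrite (minn_idPl nn0) -(natr1 n) mulrDr mulr1; move: ih; rewrite (minn_idPl (ltnW nn0)).
    by have := bB n; lra.
  rewrite (minn_idPr (leqW nn0)); move: ih; rewrite (minn_idPr nn0).
  by have := bn0 n nn0; lra.
exists (Num.truncn (2 * (B * n0%:R) / e)).+1 => // n /= hn.
apply: le_trans (S n) _.
have h1 : B * (minn n n0)%:R <= B * n0%:R by apply: ler_wpM2l => //; rewrite ler_nat geq_minr.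
have : 2 * (B * n0%:R) / e <= n%:R.
  by apply/ltW; apply: lt_le_trans (truncnS_gt _) _; rewrite ler_nat.
by rewrite ler_pdivrMr// => h2; lra.
Qed.

Section consistency.
Context d (T : measurableType d) (R : realType)
  (P : probability T R) (m p q0 : nat) (F : metricType R) (U : pseudoMetricType R)
  (Theta : set U) (theta0 : U)
  (M : set 'M[R]_m) (h : 'M[R]_m -> F) (ell : F -> 'M[R]_m)
  (N : 'rV[R]_p -> R)
  (Z X : int -> T -> 'cV[R]_m) (Sigma : int -> T -> 'M[R]_m)
  (phi phi' : int -> T -> ('I_p -> F) -> U -> ('I_p -> F))
  (g ghat : int -> T -> U -> F).
Local Notation I := (h @` M).
Local Notation E := (@prod_set R p F I).
Local Notation dE := (@prod_dist R p F N).
Local Notation integr f := (P.-integrable setT (EFin \o f)).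
Local Notation Ex f := (Rintegral P setT f).
Hypothesis mN : monotone_norm N.
Hypotheses (cT : compact Theta) (T0 : Theta theta0).
Hypothesis link : link_function M h ell.
Hypothesis Ecomp : complete dE E.
Variables (q : nat -> 'I_p -> F) (y0 : 'I_p -> F) (j0 : 'I_p).
Hypothesis j00 : j0 = 0%N :> nat.
Hypotheses (Eq : forall n, E (q n))
  (dq : forall x e, E x -> 0 < e -> exists n, dE x (q n) < e) (Ey0 : E y0).
Variables (K1 K2 : R).
Hypotheses (K10 : 0 <= K1) (K20 : 0 <= K2).
Hypothesis lip1 : forall y y', I y -> I y' ->
  `|invmx (ell y) - invmx (ell y')| <= K1 * mdist y y'.
Hypothesis lip2 : forall y y', I y -> I y' ->
  `|ln (\det (ell y)) - ln (\det (ell y'))| <= K2 * mdist y y'.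
Hypothesis SigmaM : forall t w, M (Sigma t w).
Hypothesis modelX : {ae P, forall w, forall t, X t w = sqrtmx (Sigma t w) *m Z t w}.
Hypothesis obs : observable_maps P Theta M h X phi q0.
Hypothesis sol0 : solves_at P phi (hSigma h Sigma) theta0.
Hypothesis solg : stationary_solution P Theta M h phi g.
Hypothesis HST : ST P M h N Z X Sigma.
Hypothesis HIN : IN P Z.
Hypothesis phi'good : forall w, contracting_maps N M h Theta y0 (phi' ^~ w).
Hypothesis phi'meas : forall t B, sigma_maps Theta M h B -> measurable (phi' t @^-1` B).
Hypothesis phi'ae : {ae P, forall w, forall t, phi' t w = phi t w}.

Local Notation shifted t w := (fun s => phi' (s + t) w).
Local Notation coord := (limit_coord N M h y0 j0).
Local Notation prec := (limit_precision N M h ell y0 j0).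
Local Notation logdet := (limit_logdet N M h ell y0 j0).
Local Notation vol := (true_vol N M h ell theta0 y0 j0).

Lemma shifted_good t w : contracting_maps N M h Theta y0 (shifted t w).
Proof.
have [gu cu] := phi'good w; split; first exact: (good_path_shift t gu).
exact: (contracting_path_shift t cu).
Qed.

Lemma maps_meas t y th : E y -> Theta th -> block_meas N q (fun w => phi' t w y th).
Proof.
move=> Ey Tth; apply: (maps_block_meas mN dq _ _ Ey Tth); first exact: phi'meas.
by move=> w; have [gu _] := phi'good w; exact: gu.
Qed.

Lemma pair_fst_meas t B : borel B -> past Z t (X t @^-1` B).
Proof.
move=> bB; have [_ _ mXh _ _] := HST.
have bC : borel (@fst 'cV[R]_m F @^-1` B).
  by apply: (borel_preimage _ bB) => x; exact: cvg_fst.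
by have := mXh t _ bC; rewrite setTI.
Qed.

(** The map at time [s] depends on X up to [s - 1], and each X is a function of Z up to its own
    time. The modification changes it on a null event, which belongs to [past_events]. *)
Lemma past_maps_meas t s y th : s <= t -> E y -> Theta th ->
  block_meas N q (fun w : past_space P Z t => phi' s w y th).
Proof.
move=> st Ey Tth.
apply: (maps_block_meas (T := past_space P Z t) mN dq _ _ Ey Tth); last first.
  by move=> w; have [gu _] := phi'good w; exact: gu.
move=> B SB; have [_ _ mphi _ _] := obs.
have [N0 [mN0 N00] hN0] := ae_null_setP phi'ae.
have sa := @smallest_sigma_algebra _ setT (past_events P Z t).
have phB : <<s past_events P Z t >> (phi s @^-1` B).
  have := mphi s B SB; rewrite setTI; apply: smallest_sub => // _ [r [C [/andP[_ rs] bC ->]]].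
  apply: sub_sigma_algebra; left; have := @pair_fst_meas r C bC.
  apply: smallest_sub; first exact: smallest_sigma_algebra.
  move=> _ [r' [D [/= r'r bD ->]]]; apply: sub_sigma_algebra; exists r', D; split=> //=.
  by rewrite (le_trans r'r)// (le_trans rs)// lerD2r.
have nN0 : <<s past_events P Z t >> N0 by apply: sub_sigma_algebra; right.
have nB : <<s past_events P Z t >> (N0 `&` phi' s @^-1` B).
  have mB : measurable (N0 `&` phi' s @^-1` B) by apply: measurableI => //; exact: phi'meas.
  apply: sub_sigma_algebra; right; split=> //; apply/eqP.
  by rewrite eq_le measure_ge0 andbT -N00; apply: le_measure; rewrite ?inE.
change (measurable ((fun w : past_space P Z t => phi' s w) @^-1` B)).
rewrite (_ : _ @^-1` B = (~` (N0 : set (past_space P Z t)) `&` (phi s @^-1` B)) `|` (N0 `&` phi' s @^-1` B)).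
  by apply: measurableU => //; apply: measurableI => //; apply: measurableC.
apply/seteqP; split => w /=.
  by have [Nw|Nw] := pselect (N0 w); [right|left; rewrite -hN0].
by case=> -[Nw]; rewrite // hN0.
Qed.

Lemma limit_identified (v : int -> T -> F) th : Theta th -> (forall t w, I (v t w)) ->
  (forall t B, borel B -> measurable (v t @^-1` B)) ->
  (forall t B, borel B -> P (v t @^-1` B) = P (v 0 @^-1` B)) ->
  solves_at P phi v th ->
  {ae P, forall w, forall t, v t w = coord th (shifted t w)}.
Proof.
move=> Tth Iv mv sv sol.
have step : {ae P, forall w, forall t, lags p (v ^~ w) t = phi' t w (lags p (v ^~ w) (t - 1)) th}.
  by apply: filterS2 phi'ae sol => w e s t; rewrite s e.
have := stationary_solution_limit mN Ecomp Ey0 (u := phi') (fun w => (phi'good w).1)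
  (fun w => (phi'good w).2) Tth (fun t w j => Iv _ _) mv sv step.
apply: filterS => w hw t; rewrite /limit_coord (limit_block_shift N E y0 (phi' ^~ w) t 0 th) add0r -hw.
by rewrite /lags j00 subr0.
Qed.

Lemma solution_identified th : Theta th ->
  {ae P, forall w, forall t, g t w th = coord th (shifted t w)}.
Proof.
move=> Tth; have [Ig sg solv] := solg Tth.
apply: limit_identified => // t B bB; first exact: stationary_measurable sg bB.
exact: stationary_marginal sg bB.
Qed.

Lemma volatility_identified :
  {ae P, forall w, forall t, hSigma h Sigma t w = coord theta0 (shifted t w)}.
Proof.
have [sXh _ _ _ _] := HST.
have bC B : borel B -> borel (@snd 'cV[R]_m F @^-1` B).
  by move=> bB; apply: (borel_preimage _ bB) => x; exact: cvg_snd.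
apply: limit_identified => // [t w|t B /bC bB|t B /bC bB].
- by exists (Sigma t w).
- exact: (stationary_measurable t sXh bB).
- exact: (stationary_marginal t sXh bB).
Qed.

Lemma vol_identified : {ae P, forall w, forall t, Sigma t w = vol (shifted t w)}.
Proof.
apply: filterS volatility_identified => w hw t.
by rewrite /true_vol -hw /hSigma link.2.
Qed.

Variable C : U -> R.
Hypotheses (cC : {within Theta, continuous C}) (C0 : forall th, Theta th -> 0 < C th).
Hypothesis detC : forall th, Theta th -> {ae P, forall w, C th <= \det (ell (g 0 w th))}.

Lemma logdet_lower_exists : exists c0 : R, forall th, Theta th -> c0 <= ln (C th).
Proof.
have [|B _ hB] := @compact_local_bound R U Theta (fun th => - ln (C th)) cT.
  move=> th Tth; have Cp := C0 Tth; have C2 : 0 < C th / 2 by rewrite divr_gt0.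
  exists (- ln (C th / 2)); apply: filterS2 (within_continuous_near cC Tth C2) (withinT _ _) => th' bC Tth'.
  rewrite lerN2 ler_ln ?posrE//; last exact: C0.
  by move: bC; rewrite /ball /= ltr_distl => /andP[_]; lra.
by exists (- B) => th Tth; have := hB th Tth; lra.
Qed.

Variable c0 : R.
Hypothesis c0C : forall th, Theta th -> c0 <= ln (C th).

Let SS : set_system (('I_p -> F) -> U -> ('I_p -> F)) := sigma_maps Theta M h.
Let Good_shift (s : int) (u : int -> ('I_p -> F) -> U -> ('I_p -> F)) :
  contracting_maps N M h Theta y0 u -> contracting_maps N M h Theta y0 (fun t => u (t + s)).
Proof.
move=> [gu cu]; split; first exact: (good_path_shift s gu).
exact: (contracting_path_shift s cu).
Qed.

Local Notation Phi := (process_path SS phi'good).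
Let pt := exist (contracting_maps N M h Theta y0) (phi' ^~ point) (phi'good point).
Local Notation Om := (path_space SS pt).

Lemma path_maps_meas t y th : E y -> Theta th ->
  block_meas N q (fun u : Om => sval u t y th).
Proof.
move=> Ey Tth; apply: (maps_block_meas (T := Om) (f := fun u : Om => sval u t) mN dq _ _ Ey Tth).
  by move=> B SB; exact: measurable_coordinate.
by move=> u; have [gu _] := svalP u; exact: gu.
Qed.

Lemma coord_cont_lip th w t (r : R) : Theta th -> 0 < r ->
  \forall th' \near within Theta (nbhs th), `|logdet th' (shifted t w) - logdet th (shifted t w)| < r.
Proof.
move=> Tth r0; have gs := shifted_good t w.
have k1 : 0 < K2 + 1 by rewrite ltr_wpDl.
have r1 : 0 < r / (K2 + 1) by rewrite divr_gt0.
apply: filterS2 (limit_coord_cont mN j0 Ecomp Ey0 gs Tth r1) (withinT _ _) => th' hth' Tth'.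
apply: le_lt_trans (lip2 (limit_coord_in mN j0 Ecomp Ey0 gs Tth') (limit_coord_in mN j0 Ecomp Ey0 gs Tth)) _.
move: hth'; rewrite ltr_pdivlMr// => hth'; apply: le_lt_trans hth'.
by rewrite mulrC; apply: ler_wpM2l; rewrite ?mdist_ge0// lerDl.
Qed.

(** (IV) bounds the determinant at time 0 for each parameter, with a null event depending on the
    parameter. A countable dense set and continuity give all parameters, and invariance under the
    shift gives all times. *)
Lemma logdet_bounded_below : {ae P, forall w, forall t th, Theta th -> c0 <= logdet th (shifted t w)}.
Proof.
have [_ _ _ fs fe] := obs.
have [|eT eTT dT] := compact_dense_seq cT (fun x => id) _; first by exists theta0.
have each n : {ae P, forall w, forall t, c0 <= logdet (eT n) (shifted t w)}.
  pose A := [set u : Om | c0 <= logdet (eT n) (sval u)].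
  have ml : measurable_fun setT (fun u : Om => logdet (eT n) (sval u)).
    apply: (limit_logdet_meas mN j0 Eq dq Ecomp Ey0 K20 lip2 (u := fun t (u : Om) => sval u t)) => //.
    - by move=> u; exact: svalP u.
    - by move=> t y th _; exact: path_maps_meas.
    - exact: eTT.
  have mA : measurable A by apply: measurable_le_set => //; exact: measurable_cst.
  have PA : P (Phi @^-1` A) = 1%E.
    rewrite -(@probability_setT _ _ _ P); apply: prob_ae_eq => //.
      have mPhi : measurable_fun [set: T] (Phi : T -> Om) by apply: measurable_process_path; exact: phi'meas.
      by rewrite -[X in measurable X]setTI; exact: mPhi.
    apply: filterS2 (solution_identified (eTT n)) (detC (eTT n)) => w hw dw; split=> // _.
    rewrite /preimage /A /=; apply: le_trans (c0C (eTT n)) _.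
    have -> : logdet (eT n) (phi' ^~ w) = ln (\det (ell (g 0 w (eT n)))).
      by rewrite hw /limit_logdet; congr (ln (\det (ell (coord _ _)))); apply/funext => s; rewrite addr0.
    by rewrite ler_ln ?posrE ?C0//; apply: lt_le_trans dw; exact: C0.
  have H : {ae P, forall w, forall t, A (path_shift Good_shift t (Phi w))}.
    apply: (@ae_process_path _ _ _ P _ SS phi phi' _ Good_shift fs phi'good phi'meas phi'ae (fun u => A u)).
    exact: ae_of_probability1.
  by apply: filterS H => w hw t; exact: hw t.
have all := ae_foralln (fun n => each n).
apply: filterS all => w hw t th Tth; rewrite leNgt; apply/negP => lt.
have r0 : 0 < c0 - logdet th (shifted t w) by rewrite subr_gt0.
have /nbhs_ballP[r /= r1 hr] := coord_cont_lip w t Tth r0.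
have [n bn] := dT th r Tth r1; have := hr _ bn (eTT n); have := hw n t.
rewrite ltr_distl => h1 /andP[_]; lra.
Qed.

Lemma maps_meas_past (t : int) y th : t <= 0 -> E y -> Theta th ->
  block_meas N q (fun w : past_space P Z 0 => phi' t w y th).
Proof. by move=> t0; exact: past_maps_meas. Qed.

Lemma maps_meas_all (t : int) y th : t <= 0 -> E y -> Theta th ->
  block_meas N q (fun w => phi' t w y th).
Proof. by move=> _; exact: maps_meas. Qed.

Lemma vol_pd t w : pdmx (vol (shifted t w)).
Proof. by apply: (link_pd link); apply: (limit_coord_in mN j0 Ecomp Ey0 (shifted_good t w) T0). Qed.

Lemma shifted0 w : shifted 0 w = phi' ^~ w.
Proof. by apply/funext => s; rewrite addr0. Qed.

Lemma modelX_limit : {ae P, forall w, forall t, X t w = sqrtmx (vol (shifted t w)) *m Z t w}.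
Proof. by apply: filterS2 modelX vol_identified => w hX hv t; rewrite hX hv. Qed.

(** The log determinant is bounded below by [c0], and above by the logarithm of the trace, which the
    logarithmic moment of [X 0] controls through [integr_log_trace]. *)
Lemma logdet_integrable : integr (fun w => logdet theta0 (phi' ^~ w)).
Proof.
pose S w := vol (phi' ^~ w).
have mS : mx_meas S.
  exact: (true_vol_meas mN j0 Eq dq Ecomp Ey0 T0 link K10 lip1 phi'good maps_meas_all).
have pS : mx_meas (S : past_space P Z 0 -> _).
  exact: (true_vol_meas (T := past_space P Z 0) (u := phi') mN j0 Eq dq Ecomp Ey0 T0 link K10 lip1
    phi'good maps_meas_past).
have pd w : pdmx (S w) by rewrite /S -shifted0; exact: vol_pd.
have mX : mx_meas (fun w => sqrtmx (S w) *m Z 0 w).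
  apply: mx_measM; first by apply: mx_meas_sqrt => // w; exact/pd_psd.
  move=> i j; rewrite ord1.
  by apply: (measurableT_comp (measurable_entry i)); exact: (measurable_Z HIN).
have [_ _ mXh lX _] := HST.
have mlp (f : T -> R) : measurable_fun setT f -> measurable_fun setT (fun w : T => log_plus (f w)).
  by move=> mf; apply: measurable_maxr => //; apply: measurableT_comp => //; exact: measurable_ln.
have Xi : integr (fun w => log_plus `|sqrtmx (S w) *m Z 0 w|).
  apply: (integr_le_integral (mlp _ (meas_mx_norm mX)) (fun w => log_plus_ge0 _) _ _ lX).
    apply: filterS modelX_limit => w /(_ 0); rewrite shifted0 => ->; exact: lexx.
  by move=> w; rewrite lee_fin log_plus_ge0.
have li := integr_log_trace HIN pS mS (fun w => pd_psd (pd w)) Xi.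
have ml : measurable_fun setT (fun w => logdet theta0 (phi' ^~ w)).
  exact: (limit_logdet_meas mN j0 Eq dq Ecomp Ey0 K20 lip2 phi'good maps_meas_all T0).
have ub w : logdet theta0 (phi' ^~ w) <= 1 + m%:R * ln (1 + \tr (S w)).
  exact: ln_det_le_trace (pd w).
apply: (@integr_ae _ _ _ P _ (fun w => Num.max (logdet theta0 (phi' ^~ w)) c0)) => //.
  apply: filterS logdet_bounded_below => w /(_ 0 theta0 T0); rewrite shifted0 => h0.
  by apply/esym/max_idPl.
apply: (@integr_le _ _ _ P _ (fun w => `|c0| + (1 + m%:R * ln (1 + \tr (S w))))).
- by apply: measurable_maxr.
- move=> w; have t0 : 0 <= m%:R * ln (1 + \tr (S w)).
    by rewrite mulr_ge0// ln_ge0// lerDl sumr_ge0// => i _; rewrite -quad_delta; exact: (pd_psd (pd w)).2.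
  have := ler_norm c0; have := ler_norm (- c0); rewrite normrN => h1 h2; have := normr_ge0 c0 => h3.
  rewrite ler_norml ge_max le_max; have := ub w => h4.
  by apply/andP; split; [apply/orP; right; lra|apply/andP; split; lra].
- apply: integrD; first exact: integr_cst.
  by apply: integrD; [exact: integr_cst|exact: integrZ].
Qed.

(** Twice the limit of the contrast at [theta0]: the losses below omit the factor [2^-1] of
    [shat]. *)
Definition limit_value : R := m%:R + Ex (fun w => logdet theta0 (phi' ^~ w)).

Definition limit_loss th (t : int) w : R :=
  quad (prec th (shifted t w)) (X t w) + logdet th (shifted t w).

Let Y t w := (X t w, hSigma h Sigma t w).
(** The precision and the log determinant are Lipschitz, hence measurable, only on the image of [h];
    the paths of the pair are restricted accordingly. *)
Let Good2 : set (int -> 'cV[R]_m * F) := [set u | forall t, I (u t).2].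
Let Good2_shift (s : int) u : Good2 u -> Good2 (fun t => u (t + s)).
Proof. by move=> gu t; exact: gu. Qed.
Let Ygood w : Good2 (Y ^~ w).
Proof. by move=> t; exists (Sigma t w). Qed.
Let SS2 : set_system ('cV[R]_m * F) := @borel ('cV[R]_m * F)%type.
Let Ymeas t B : SS2 B -> measurable (Y t @^-1` B).
Proof. by have [sY _ _ _ _] := HST; exact: (stationary_measurable t sY). Qed.
Let Yae : {ae P, forall w, forall t, Y t w = Y t w}.
Proof. exact: aeW. Qed.
Let pt2 := exist Good2 (Y ^~ point) (Ygood point).
Local Notation Om2 := (path_space SS2 pt2).
Local Notation Phi2 := (process_path SS2 Ygood).

Lemma path_entry_meas : mx_meas (fun u : Om2 => (sval u 0).1).
Proof.
move=> i j; rewrite ord1; apply: measurable_of_lt => c.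
apply: (measurable_coordinate 0 (B := [set z : 'cV[R]_m * F | z.1 i 0 < c])).
have := @borel_preimage ('cV[R]_m * F)%type 'cV[R]_m fst _ _ (borel_entry i (open_lt (y := c))).
by apply => x; exact: cvg_fst.
Qed.

Lemma path_vol_meas (f : F -> R) (K : R) : 0 <= K ->
  (forall y y', I y -> I y' -> `|f y - f y'| <= K * mdist y y') ->
  measurable_fun setT (fun u : Om2 => f (sval u 0).2).
Proof.
move=> K0 fK.
apply: (@measurable_lipschitz_comp _ Om2 R F (@mdist R F) I (fun n => q n j0)
  (fun u : Om2 => (sval u 0).2) (fun u y => f y) (fun=> K)) => //.
- exact: metric_sym.
- by move=> n; exact: Eq.
- move=> x e Ix e0; have cc0 := coord_const_ge0 mN.
  have c1 : 0 < coord_const N + 1 by rewrite ltr_wpDl.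
  have e1 : 0 < e / (coord_const N + 1) by rewrite divr_gt0.
  have [n hn] := dq (x := fun=> x) (fun=> Ix) e1; exists n.
  apply: le_lt_trans (coord_dist mN (fun=> x) (q n) j0) _.
  move: hn; rewrite ltr_pdivlMr// => hn; apply: le_lt_trans hn.
  by rewrite mulrC; apply: ler_wpM2l; [exact: prod_dist_ge0|rewrite lerDl].
- by move=> u; exact: svalP u 0.
- move=> n; apply: measurable_of_lt => c.
  apply: (measurable_coordinate 0 (B := [set z : 'cV[R]_m * F | mdist z.2 (q n j0) < c])).
  have := @borel_preimage ('cV[R]_m * F)%type F snd _ _ (borel_mdist (q n j0) (open_lt (y := c))).
  by apply => x; exact: cvg_snd.
- move=> u y y' Iy Iy'; have := fK y y' Iy Iy'.
  by rewrite ler_norml => /andP[_]; rewrite lerBlDl.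
Qed.

(** At [theta0] the loss is a function of the ergodic pair [Y]. Whitening turns its quadratic part
    into [|Z_t|^2], which gives both its integrability and its mean [m]. *)
Lemma loss_upper (a : R) : limit_value < a -> {ae P, forall w, \forall n \near \oo,
  \sum_(k < n) limit_loss theta0 k.+1%:Z w <= a * n%:R}.
Proof.
move=> va; have [sY eY _ _ _] := HST.
pose f (u : Om2) := quad (invmx (ell (sval u 0).2)) (sval u 0).1 + ln (\det (ell (sval u 0).2)).
have mf : measurable_fun setT f.
  apply: measurable_funD; last exact: (path_vol_meas K20 lip2).
  apply: meas_quad; last exact: path_entry_meas.
  move=> i j; apply: (path_vol_meas (f := fun y => invmx (ell y) i j) K10) => y y' Iy Iy'.
  by have := le_trans (mx_entry_le _ i j) (lip1 Iy Iy'); rewrite !mxE.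
have fE : {ae P, forall w, f (Phi2 w) = quad 1%:M (Z 0 w) + logdet theta0 (phi' ^~ w)}.
  apply: filterS2 modelX_limit volatility_identified => w hX hv.
  rewrite /f /= hX hv shifted0; congr (_ + _).
  have pv : pdmx (vol (phi' ^~ w)) by rewrite -shifted0; exact: vol_pd.
  have [[sS _] _ _] := sqrtmxP (pd_psd pv).
  by rewrite -(sqrtmx_whiten pv) -[X in _ = quad (X *m _ *m _) _]sS quad_conj.
have [_ Zm] := HIN.
have Zi i : integr (fun w => Z 0 w i 0 * Z 0 w i 0) by have [] := Zm i i.
have ZE i : Ex (fun w => Z 0 w i 0 * Z 0 w i 0) = 1.
  by have [_] := Zm i i; rewrite unlock /Rintegral mxE eqxx => ->.
have qE : (fun w => quad 1%:M (Z 0 w)) = fun w => \sum_i Z 0 w i 0 * Z 0 w i 0.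
  by apply/funext => w; rewrite quad1E; apply: eq_bigr => i _; rewrite expr2.
have qi : integr (fun w => quad 1%:M (Z 0 w)) by rewrite qE; exact: integr_sum.
have qm : Ex (fun w => quad 1%:M (Z 0 w)) = m%:R.
  by rewrite qE Ex_sum//; under eq_bigr do rewrite ZE; rewrite sumr_const card_ord.
have li := logdet_integrable.
have sumi : integr (fun w => quad 1%:M (Z 0 w) + logdet theta0 (phi' ^~ w)) by exact: integrD.
have mfP : measurable_fun setT (fun w => f (Phi2 w)).
  have mPhi : measurable_fun [set: T] (Phi2 : T -> Om2) by apply: measurable_process_path; exact: Ymeas.
  exact: (measurableT_comp mf mPhi).
have fi : integr (f \o Phi2) by exact: integr_ae sumi.
have fEx : Ex (f \o Phi2) = limit_value.
  by rewrite (Ex_ae mfP (integr_meas sumi) fE) ExD// qm.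
have := process_upper Good2_shift sY eY Ymeas Yae mf fi; rewrite fEx => /(_ a va).
apply: filterS2 volatility_identified => w hv /(_ 1); apply: filterS => n.
apply: le_trans; rewrite le_eqVlt; apply/orP; left; apply/eqP; apply: eq_bigr => k _.
rewrite /limit_loss /f /= add0r.
have -> : k.+1%:Z = 1 + k%:Z by rewrite intS.
by rewrite hv.
Qed.

Lemma log_norm_small : {ae P, forall w, forall e : R, 0 < e -> \forall n \near \oo,
  log_plus `|X n.+1%:Z w| <= e * n%:R}.
Proof.
have [sY eY _ lX _] := HST.
pose f (u : Om2) := log_plus `|(sval u 0).1|.
have mf : measurable_fun setT f.
  apply: measurable_maxr => //; apply: (measurableT_comp (f := @ln R)); first exact: measurable_ln.
  exact: meas_mx_norm path_entry_meas.
have mfP : measurable_fun setT (fun w => f (Phi2 w)).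
  have mPhi : measurable_fun [set: T] (Phi2 : T -> Om2) by apply: measurable_process_path; exact: Ymeas.
  exact: (measurableT_comp mf mPhi).
have fi : integr (f \o Phi2).
  apply: (integr_le_integral mfP _ _ _ lX) => [w||w]; first exact: log_plus_ge0.
    by apply: aeW => w; exact: lexx.
  by rewrite lee_fin log_plus_ge0.
have := process_small Good2_shift sY eY Ymeas Yae mf fi (fun u => log_plus_ge0 _).
apply: filterS => w /(_ 1) hw e e0; apply: filterS (hw e e0) => n.
by rewrite /f /= add0r intS.
Qed.

Hypothesis Hid : identifiable P Theta theta0 h Sigma g.

Lemma loss_lower th1 : Theta th1 -> th1 <> theta0 -> exists j (eta : R), 0 < eta /\
  {ae P, forall w, \forall n \near \oo, forall th, Theta th -> ball th1 j.+1%:R^-1 th ->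
    (limit_value + eta) * n%:R <= \sum_(k < n) limit_loss th k.+1%:Z w}.
Proof.
move=> T1 th10.
have dense j : {f : nat -> U | (forall n, (Theta `&` ball th1 j.+1%:R^-1) (f n)) /\
    (forall x (r : R), (Theta `&` ball th1 j.+1%:R^-1) x -> 0 < r -> exists n, ball x r (f n))}.
  apply: cid; have [||f fV df] := @compact_dense_seq R U Theta (Theta `&` ball th1 j.+1%:R^-1) cT.
  - by move=> x [].
  - by exists th1; split=> //; exact: ballxx.
  - by exists f.
pose e j := sval (dense j); have he j := svalP (dense j).
have eV j n := (he j).1 n; have de j x r := (he j).2 x r.
pose cm := cut_moment P Z.
have cm_cvg k l : cm j k l @[j --> \oo] --> ((k == l)%:R : R) by exact: (cut_moment_cvg HIN).
pose Q j (u : int -> ('I_p -> F) -> U -> 'I_p -> F) := crit_lower N M h ell theta0 y0 j0 K1 K2 th1 e cm c0 j u.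
(* Failure for every [j] would make the solutions at [th1] and at [theta0] coincide almost surely,
   against identifiability. *)
have [j hj] : exists j, limit_value < Ex (fun w => Q j (phi' ^~ w)).
  apply/not_existsP => Qa; apply: th10; apply/Hid => //.
  have c0l : {ae P, forall w, c0 <= logdet th1 (phi' ^~ w)}.
    by apply: filterS logdet_bounded_below => w /(_ 0 th1 T1); rewrite shifted0.
  have Qb j : Ex (fun w => Q j (phi' ^~ w)) <= m%:R + Ex (fun w => logdet theta0 (phi' ^~ w)).
    by rewrite leNgt; apply/negP; exact: Qa.
  have id := crit_identification mN Eq dq Ecomp Ey0 cT T0 link K10 K20
    lip1 lip2 T1 eV cm_cvg phi'good maps_meas logdet_integrable c0l Qb.
  apply: filterS3 (solution_identified T1) volatility_identified id => w hg hv.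
  by rewrite (hg 0) (hv 0) shifted0.
(* A third of the gap is spent on the ergodic average, a third on the centred products, and the last
   third is the margin obtained. *)
pose eta := (Ex (fun w => Q j (phi' ^~ w)) - limit_value) / 3.
have eta0 : 0 < eta by rewrite divr_gt0// subr_gt0.
exists j, eta; split=> //.
have [_ _ _ fs fe] := obs.
have mQ : measurable_fun setT (fun u : Om => Q j (sval u)).
  apply: (crit_lower_meas mN j0 Eq dq Ecomp Ey0 cT T0 link K10 K20 lip1 lip2
    T1 eV cm c0 j (u := fun t (u : Om) => sval u t)).
    by move=> u; exact: svalP u.
  by move=> t y th _; exact: path_maps_meas.
have mQP : measurable_fun setT (fun w => Q j (phi' ^~ w)).
  exact: (crit_lower_meas mN j0 Eq dq Ecomp Ey0 cT T0 link K10 K20 lip1 lip2 T1 eV cm c0 j phi'good maps_meas_all).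
have Qi : integr (fun w => Q j (phi' ^~ w)).
  exact: integr_bounded mQP (fun w => crit_lower_bound N M h ell theta0 y0 j0 K1 K2 th1 e cm c0 j (phi' ^~ w)).
have aQ : limit_value + 2 * eta < Ex (fun w => Q j (phi' ^~ w)) by rewrite /eta; lra.
have lo := process_lower Good_shift fs fe phi'meas phi'ae mQ Qi aQ.
have lln := form_cut_lln mN j0 Eq dq Ecomp Ey0 cT T0 link K10 K20 lip1 T1 eV cm phi'good maps_meas HIN past_maps_meas j.
apply: filterS3 (filterI lo lln) modelX_limit logdet_bounded_below => w [/(_ 1) low /(_ eta eta0) llnw] hX hc.
apply: filterS2 low llnw => n low llnw th Tth bth.
pose H (i : nat) k l := form_cut N M h ell theta0 y0 j0 K1 th1 e cm j (shifted i.+1%:Z w) k l.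
pose L (i : nat) := logdet_lower N M h ell y0 j0 K2 th1 e c0 j (shifted i.+1%:Z w).
apply: (@le_trans _ _ (\sum_(i < n) (\sum_k \sum_l H i k l * cut_product j k l (Z i.+1%:Z w) + L i))); last first.
  apply: ler_sum => i _; rewrite /limit_loss hX.
  exact: (crit_lowerP mN Ecomp Ey0 cT T0 link K10 K20 lip1 lip2 T1 eV de cm (Z i.+1%:Z w)
    (shifted_good i.+1%:Z w) (conj Tth bth) (hc _ _ Tth)).
have -> : \sum_(i < n) (\sum_k \sum_l H i k l * cut_product j k l (Z i.+1%:Z w) + L i) =
    \sum_(i < n) Q j (shifted i.+1%:Z w) +
    \sum_(i < n) \sum_k \sum_l H i k l * (cut_product j k l (Z i.+1%:Z w) - cm j k l).
  rewrite -big_split; apply: eq_bigr => i _ /=; rewrite /Q /crit_lower -/(L i) addrAC; congr (_ + _).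
  rewrite -big_split; apply: eq_bigr => k _ /=; rewrite -big_split; apply: eq_bigr => l _ /=.
  by rewrite -/(H i k l); ring.
have lowE : \sum_(k < n) Q j (sval (path_shift Good_shift (1 + k%:Z) (Phi w))) = \sum_(i < n) Q j (shifted i.+1%:Z w).
  by apply: eq_bigr => k _; rewrite /= intS.
move: low llnw; rewrite lowE ler_norml => low /andP[llnw _]; move: llnw; rewrite /H /L.
by move: low; rewrite !mulrDl; lra.
Qed.

Hypothesis Hghat : approximate_solution P Theta M h phi ghat.

Lemma ghat_close : {ae P, forall w, exists A c : R, [/\ 0 <= A, 0 < c & forall th (k : nat), Theta th ->
  I (ghat k%:Z w th) /\ mdist (ghat k%:Z w th) (coord th (shifted k%:Z w)) <= A * expR (- c * k%:R)]}.
Proof.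
have [ini step] := Hghat; apply: filterS2 step phi'ae => w step phiE.
have [gu cu] := phi'good w.
pose x th := lags p (fun k => ghat k w th) 0.
have ini0 (i : 'I_p) : 1 - p%:Z <= 0 - (i : nat)%:Z <= 0 by have := ltn_ord i; lia.
have Ex th : Theta th -> E (x th) by move=> Tth i; apply: (ini _ (ini0 i) w).1.
have xc (i : 'I_p) : {within Theta, continuous (x ^~ i)} by apply: (ini _ (ini0 i) w).2.
have it th (k : nat) : Theta th -> lags p (fun t => ghat t w th) k%:Z = iter_maps (phi' ^~ w) k k%:Z (x th) th.
  move=> Tth; elim: k => [//|k ih]; rewrite step// iter_mapsS phiE.
  by have -> : k.+1%:Z - 1 = k%:Z by [lia]; rewrite ih.
have [D [c [D0 cpos hD]]] := limit_block_forward mN Ecomp Ey0 gu cu 0.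
(* Both the initial block of [ghat] and the limit are continuous in the parameter, so their initial
   distance is bounded on the compact set. *)
have [|B B0 hB] := @compact_local_bound R U Theta (fun th => dE (x th) (limit_block N E y0 (phi' ^~ w) 0 th)) cT.
  move=> th Tth; exists (1 + dE (x th) (limit_block N E y0 (phi' ^~ w) 0 th) + 1).
  have l01 : (0 : R) < 1 by [].
  apply: filterS2 (prod_dist_near mN xc Tth l01) (limit_block_cont mN Ecomp Ey0 gu cu 0 Tth l01) => th' h1 h2.
  apply: le_trans (prod_dist_triangle4 mN _ _ (x th) (limit_block N E y0 (phi' ^~ w) 0 th)) _.
  by rewrite prod_distC in h1; lra.
exists (coord_const N * (D * B)), c; split=> // [|th k Tth].
  by rewrite mulr_ge0 ?coord_const_ge0// mulr_ge0.
have Eit : E (iter_maps (phi' ^~ w) k k%:Z (x th) th).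
  by have [ + _ _] := good_iter mN k k%:Z gu; apply=> //; exact: Ex.
have gk : ghat k%:Z w th = iter_maps (phi' ^~ w) k k%:Z (x th) th j0.
  by rewrite -it// /lags j00 subr0.
split; first by rewrite gk; exact: Eit.
rewrite gk /limit_coord (limit_block_shift N E y0 (phi' ^~ w) k%:Z 0 th) add0r.
apply: le_trans (coord_dist mN _ _ j0) _; rewrite -mulrA; apply: ler_wpM2l; first exact: coord_const_ge0.
have := hD th (x th) k Tth (Ex th Tth); rewrite add0r => /le_trans; apply.
rewrite -!mulrA; apply: ler_wpM2l => //; rewrite mulrC; apply: ler_wpM2r; first exact: expR_ge0.
exact: hB.
Qed.

(** Only a logarithmic moment of X is available, so the comparison is made path by path: [|X_k|^2]
    grows more slowly than any exponential, while [ghat] approaches the limit exponentially fast,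
    uniformly in the parameter. *)
Lemma loss_approx : {ae P, forall w, forall e : R, 0 < e -> \forall n \near \oo, forall th, Theta th ->
  `|\sum_(k < n) (2 * shat ell X ghat k.+1%:Z w th - limit_loss th k.+1%:Z w)| <= e * n%:R}.
Proof.
apply: filterS2 ghat_close log_norm_small => w [A [c [A0 cpos hA]]] small e e0.
pose K := m%:R * K1 * m%:R + K2.
have K0 : 0 <= K by rewrite addr_ge0// !mulr_ge0.
pose b k := (m%:R * K1 * m%:R * `|X k.+1%:Z w| ^+ 2 + K2) * (A * expR (- c * k%:R)).
have bnd k th : Theta th ->
    `|2 * shat ell X ghat k.+1%:Z w th - limit_loss th k.+1%:Z w| <= b k.
  move=> Tth; have [Ig gd] := hA th k.+1 Tth; have gs := shifted_good k.+1%:Z w.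
  have Ic := limit_coord_in mN j0 Ecomp Ey0 gs Tth.
  set dl := mdist _ _ in gd; have dl0 : 0 <= dl by exact: mdist_ge0.
  have dlE : dl <= A * expR (- c * k%:R).
    apply: le_trans gd _; apply: ler_wpM2l => //; rewrite ler_expR !mulNr lerN2.
    by apply: ler_wpM2l; [exact: ltW|rewrite ler_nat].
  have qd := @quad_bound _ _ (invmx (ell (ghat k.+1%:Z w th)) - prec th (shifted k.+1%:Z w)) (K1 * dl) (X k.+1%:Z w).
  have {}qd := qd (fun i j => le_trans (mx_entry_le _ i j) (lip1 Ig Ic)).
  have ld := lip2 Ig Ic; rewrite -/dl -/(logdet _ _) in ld; rewrite quadB in qd.
  have {}qd := le_trans qd (ler_wpM2l (mulr_ge0 (ler0n _ m) (mulr_ge0 K10 dl0)) (quad1_le_norm (X k.+1%:Z w))).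
  have -> : 2 * shat ell X ghat k.+1%:Z w th - limit_loss th k.+1%:Z w =
     (quad (invmx (ell (ghat k.+1%:Z w th))) (X k.+1%:Z w) - quad (prec th (shifted k.+1%:Z w)) (X k.+1%:Z w)) +
     (ln (\det (ell (ghat k.+1%:Z w th))) - logdet th (shifted k.+1%:Z w)).
    by rewrite /shat /limit_loss; field.
  apply: le_trans (ler_normD _ _) _; apply: le_trans (lerD qd ld) _.
  apply: (@le_trans _ _ ((m%:R * K1 * m%:R * `|X k.+1%:Z w| ^+ 2 + K2) * dl)).
    by rewrite le_eqVlt; apply/orP; left; apply/eqP; ring.
  by apply: ler_wpM2l => //; rewrite addr_ge0// !mulr_ge0// exprn_ge0.
have cv : K * A * expR (- (c / 2) * k%:R) @[k --> \oo] --> (0 : R).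
  rewrite -(mulr0 (K * A)); apply: cvgM; first exact: cvg_cst.
  by apply: expR_geometric_cvg0; rewrite divr_gt0.
have e2 : 0 < e / 2 by rewrite divr_gt0.
(* With this constant [|X|^2] is at most [expR (c / 2 * k)], and half of the rate [c] remains. *)
have c4 : 0 < c / 4 by rewrite divr_gt0.
have near_b : \forall k \near \oo, b k <= e / 2.
  have /cvgr_lt/(_ _ e2) near_e := cv.
  apply: filterS2 near_e (small _ c4) => k ke lX; apply: le_trans (ltW ke).
  have ck : 0 <= c / 4 * k%:R by rewrite mulr_ge0// ltW.
  have XE : `|X k.+1%:Z w| ^+ 2 <= expR (c / 2 * k%:R).
    have -> : expR (c / 2 * k%:R) = expR (c / 4 * k%:R) ^+ 2 by rewrite expr2 -expRD; congr expR; field.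
    by rewrite ler_sqr ?nnegrE ?expR_ge0//; exact: log_plusP lX.
  have -> : K * A * expR (- (c / 2) * k%:R) = K * expR (c / 2 * k%:R) * (A * expR (- c * k%:R)).
    have -> : expR (- (c / 2) * k%:R) = expR (c / 2 * k%:R) * expR (- c * k%:R).
      by rewrite -expRD; congr expR; field.
    by ring.
  apply: ler_wpM2r; first by rewrite mulr_ge0// expR_ge0.
  rewrite /K mulrDl; apply: lerD; first by apply: ler_wpM2l => //; rewrite !mulr_ge0.
  rewrite ler_peMr// -expR0 ler_expR mulr_ge0// ltW// divr_gt0//.
apply: filterS (sum_eventually_le e0 near_b) => n hn th Tth.
apply: le_trans hn; apply: le_trans (ler_norm_sum _ _ _) _; apply: ler_sum => k _; exact: bnd.
Qed.

Lemma near_forall_seq (I : eqType) (s : seq I) (Q : I -> nat -> Prop) :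
  (forall i, i \in s -> \forall n \near \oo, Q i n) -> \forall n \near \oo, forall i, i \in s -> Q i n.
Proof.
elim: s => [|i s ih] hs; first exact: nearW.
have hi := hs i (mem_head _ _).
have {}ih := ih (fun j js => hs j (mem_behead (s := i :: s) js)).
by apply: filterS2 hi ih => n Qi Qs j; rewrite inE => /predU1P[->|/Qs].
Qed.

Variable thetahat : nat -> T -> U.
Hypothesis Hest : M_estimator P Theta ell X ghat thetahat.

Lemma loss_separation th1 : Theta th1 -> th1 <> theta0 -> exists j,
  {ae P, forall w, \forall n \near \oo, forall th, Theta th -> ball th1 j.+1%:R^-1 th ->
    Shat ell X ghat n w theta0 < Shat ell X ghat n w th}.
Proof.
move=> T1 th10; have [j [eta [eta0 lo]]] := loss_lower T1 th10; exists j.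
(* Three errors of [eta / 4], namely the ergodic average at [theta0] and the replacement of [ghat]
   at both parameters, leave a gap of [eta / 4]. *)
have e4 : 0 < eta / 4 by rewrite divr_gt0.
have up := @loss_upper (limit_value + eta / 4) ltac:(by rewrite ltrDl).
apply: filterS3 lo up loss_approx => w lo up /(_ _ e4) ap.
apply: filterS3 (filterI lo up) ap (nbhs_infty_gt 0) => n [{}lo {}up] {}ap n0 th Tth bth.
have n0' : 0 < n%:R :> R by rewrite ltr0n.
rewrite /Shat ltr_pM2l ?invr_gt0//.
have sE th' : \sum_(1 <= t < n.+1) shat ell X ghat t%:Z w th' = \sum_(k < n) shat ell X ghat k.+1%:Z w th'.
  by rewrite big_add1 big_mkord.
have sD th' : \sum_(k < n) (2 * shat ell X ghat k.+1%:Z w th' - limit_loss th' k.+1%:Z w) =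
    2 * (\sum_(k < n) shat ell X ghat k.+1%:Z w th') - \sum_(k < n) limit_loss th' k.+1%:Z w.
  by rewrite mulr_sumr -sumrB.
rewrite !sE; have := lo th Tth bth; have := ap th Tth; have := ap theta0 T0.
rewrite !sD !ler_norml => /andP[_ h1] /andP[h2 _] h3.
have : 0 < eta * n%:R by rewrite mulr_gt0.
move: up h1 h2 h3; rewrite !mulrDl [eta / 4 * _]mulrAC; lra.
Qed.

Lemma estimator_consistent : {ae P, forall w, thetahat n w @[n --> \oo] --> theta0}.
Proof.
pose sepa th1 j := {ae P, forall w, \forall n \near \oo, forall th, Theta th -> ball th1 j.+1%:R^-1 th ->
    Shat ell X ghat n w theta0 < Shat ell X ghat n w th}.
have sel th1 : {j | Theta th1 -> th1 <> theta0 -> sepa th1 j}.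
  apply: cid; have [[T1 th10]|H] := pselect (Theta th1 /\ th1 <> theta0).
    by have [j hj] := loss_separation T1 th10; exists j.
  by exists 0%N => T1 th10; case: H.
have loc k : {ae P, forall w, \forall n \near \oo, ball theta0 k.+1%:R^-1 (thetahat n w)}.
  (* The target ball at [theta0] and separating balls elsewhere. For large [n] a minimizer lies in
     no separating ball of the finite subcover, since its criterion would exceed the one at
     [theta0]. *)
  pose O th := ball th (if pselect (th = theta0) then k.+1%:R^-1 else (sval (sel th)).+1%:R^-1 : R).
  have [|s sT cov] := @compact_finite_cover U Theta O cT.
    by move=> th _; apply: nbhsx_ballx; case: (pselect (th = theta0)) => /= _; rewrite invr_gt0.
  have sp : {ae P, forall w, forall c, c \in s -> c <> theta0 -> \forall n \near \oo, forall th, Theta th ->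
      ball c (sval (sel c)).+1%:R^-1 th -> Shat ell X ghat n w theta0 < Shat ell X ghat n w th}.
    apply: ae_forall_seq => c cs; have [c0E|c0E] := pselect (c = theta0); first by apply: aeW.
    by apply: filterS (svalP (sel c) (sT c cs) c0E).
  apply: filterS2 sp Hest => w hs he.
  have near_s : \forall n \near \oo, forall c, c \in s -> c <> theta0 -> forall th, Theta th ->
      ball c (sval (sel c)).+1%:R^-1 th -> Shat ell X ghat n w theta0 < Shat ell X ghat n w th.
    apply: near_forall_seq => c cs; have [c0E|c0E] := pselect (c = theta0); first exact: nearW.
    by apply: filterS (hs c cs c0E) => n + _.
  apply: filterS2 near_s (nbhs_infty_gt 0) => n hn n0; have [Tn mn] := he n n0.
  have [c cs] := cov _ Tn; rewrite /O; case: (pselect (c = theta0)) => /= [->//|c0E] bc.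
  by have := hn c cs c0E _ Tn bc; rewrite ltNge mn.
apply: filterS (ae_foralln loc) => w hw; apply/cvg_ballP => e e0.
apply: filterS (hw (Num.truncn e^-1)) => n; apply: le_ball; apply: ltW.
rewrite -[ltRHS]invrK ltf_pV2 ?posrE ?invr_gt0//.
exact: truncnS_gt.
Qed.

End consistency.

Theorem theorem4 (d : measure_display) (T : measurableType d) (R : realType)
  (P : probability T R) (m p q : nat) (F : metricType R) (U : pseudoMetricType R)
  (Theta : set U) (theta0 : U)
  (M : set 'M[R]_m) (h : 'M[R]_m -> F) (ell : F -> 'M[R]_m)
  (N : 'rV[R]_p -> R)
  (Z X : int -> T -> 'cV[R]_m) (Sigma : int -> T -> 'M[R]_m)
  (psi : int -> T -> (nat -> F) -> U -> (nat -> F))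
  (phi : int -> T -> ('I_p -> F) -> U -> ('I_p -> F))
  (Lam : nat -> int -> T -> U -> R)
  (g ghat : int -> T -> U -> F) (thetahat : nat -> T -> U) :
  hausdorff_space U -> compact Theta -> Theta theta0 ->
  link_function M h ell ->
  state_space M h N ->
  volatility_model P Theta theta0 M h Z X Sigma psi ->
  observable_maps P Theta M h X phi q ->
  solves_at P phi (hSigma h Sigma) theta0 ->
  stationary_solution P Theta M h phi g ->
  approximate_solution P Theta M h phi ghat ->
  M_estimator P Theta ell X ghat thetahat ->
  ST P M h N Z X Sigma ->
  CI P Theta M h N phi Lam ->
  IN P Z ->
  IV P Theta M h ell g ->
  identifiable P Theta theta0 h Sigma g ->
  {ae P, forall w, thetahat n w @[n --> \oo] --> theta0}.
Proof.
move=> _ cT T0 link [p0 _ mN Ecomp sep] [_ SM modX _ _] obs sol0 solg Hghat Hest HST.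
move=> [lip [[r [r0 neg mom]] [y0 Ey0 jump]]] HIN [[K1 lip1] [K2 lip2] [C [cC C0 detC]]] Hid.
have [Q QE [cQ dQ]] := sep.
have Q0 : Q !=set0 by have [y Qy _] := dQ y0 1 Ey0 ltr01; exists y.
have [s Qs sQ] := countable_dense_seq cQ Q0.
have Es n : prod_set (h @` M) (s n) by exact/QE.
have ds x e : prod_set (h @` M) x -> 0 < e -> exists n, prod_dist N x (s n) < e.
  by move=> Ex e0; have [y Qy xy] := dQ x e Ex e0; have [n sn] := sQ y Qy; exists n; rewrite sn.
pose j0 : 'I_p := Ordinal p0.
have lipn (f : F -> F -> R) K : (forall y y', (h @` M) y -> (h @` M) y' -> f y y' <= K * mdist y y') ->
    forall y y', (h @` M) y -> (h @` M) y' -> f y y' <= `|K| * mdist y y'.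
  move=> fK y y' Iy Iy'; apply: le_trans (fK y y' Iy Iy') _; apply: ler_wpM2r; first exact: mdist_ge0.
  exact: ler_norm.
have {}lip1 := lipn _ _ lip1; have {}lip2 := lipn _ _ lip2.
have good : {ae P, forall w, contracting_maps N M h Theta y0 (phi ^~ w)}.
  by apply: filterS2 (ae_good_path mN cT obs lip) (ae_contracting_path mN cT obs lip sep T0 r0 Ey0 neg mom jump).
have [_ _ _ [phim _] _] := obs.
have [phi' [phi'good phi'meas phi'ae]] := good_modification phim good.
have [c0 c0C] := logdet_lower_exists cT cC C0.
exact: (estimator_consistent (j0 := j0) mN cT T0 link Ecomp erefl Es ds Ey0 (normr_ge0 K1) (normr_ge0 K2)
  lip1 lip2 SM modX obs sol0 solg HST HIN phi'good phi'meas phi'ae C0 detC c0C Hid Hghat Hest).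
Qed.
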